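(* Suppose the operators $B_N$ satisfy (C1)$'$, (C2)$'$ and (C3)$'$ as stated in the context, and $\alpha,\beta\in\sigma(A)$. Then $$K(\alpha,\beta)=\langle[u(\theta_{\beta})]_{0}\,|\,B^{\infty}([u(\theta_{\alpha})]_{\infty})\rangle.$$
   Context: Inner products are linear in the second argument. $H$ is a (nonzero) separable complex Hilbert space and $A=qV$ with $q\in\mathbb{C}\setminus\{0\}$ and $V$ unitary on $H$; thus $A^{*}A=AA^{*}=r_{A}I$ with $r_A=|q|^2$. For $P\in\mathbb{C}[X,Y]$, $P(A,A^{*})$ is obtained by substituting $A$ for $X$ and $A^{*}$ for $Y$. $\phi\in H$ is a fixed unit vector that is cyclic: $\{P(A,A^{*})(\phi)\mid P\in\mathbb{C}[X,Y]\}$ is dense in $H$. For $N\in\omega$: $H_N$ is the span of $\{A^{i}(A^{*})^{j}\phi\mid i\le N,\ j\le N\}$, $H_N^{-}$ the span of those with $i<N,\ j\le N$, $H_N^{+}$ the span of those with $0<i\le N,\ j\le N$; $W^{\pm}$ are the orthogonal complements of $H_N^{\pm}$ in $H_N$ (of equal dimension). Fix a unitary $U_N:W^{-}\to W^{+}$ and let $A_N$ be the linear operator on $H_N$ with $A_N(u)=A(u)$ for $u\in H_N^{-}$ and $A_N(u)=\sqrt{r_A}\,U_N(u)$ for $u\in W^{-}$; $A_N$ is normal. $D_N=\dim H_N$ and $u_N(n)$, $n<D_N$, is an orthonormal basis of eigenvectors of $A_N$ with eigenvalues $\lambda_N(n)$, chosen so that $\xi_N(n)=\langle u_N(n)|\phi\rangle$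 is a non-negative real. $M$ is a natural number strictly greater than $\|A\|$ and $\sqrt{r_A}$, $S=\{\lambda\in\mathbb{C}\mid |\mathrm{Re}\,\lambda|\le M,\ |\mathrm{Im}\,\lambda|\le M\}$, $C(S)$ is the space of continuous functions $S\to\mathbb C$, $\sigma(A)$ is the spectrum of $A$. $\mathcal{U}$ is an ultrafilter on $\omega$ such that for all $m\ge1$, $\{N\ge1\mid\sqrt N\in\omega,\ m\text{ divides }\sqrt N\}\in\mathcal{U}$. $H^{u}=\prod_NH_N/\mathcal{U}$ (an element need only be specified on a set of $N$ in $\mathcal U$); $\langle\cdot|\cdot\rangle^u$ is the ultraproduct of the inner products. For $f,g\in H^u$, $\langle f|g\rangle$ is the complex number infinitely close to $\langle f|g\rangle^u$, if it exists. For a bounded function $f:S\to\mathbb C$, $F_N(f)=\sum_{n<D_N}\xi_N(n)f(\lambda_N(n))u_N(n)$ and $F(f)=(F_N(f))_N$. Measure: for $X\subseteq\mathbb{C}$, $\mu_N(X)=\sum\{\xi_N(n)^2\mid n<D_N,\ \lambda_N(n)\in X\}$ and $\mu^{\mathrm n}(X)=\lim_{\mathcal U}\mu_N(X)$. For $r\in[-M,M]$, $\varepsilon>0$: $I_r=\{\lambda\in S\mid\mathrm{Re}\,\lambda=r\}$, $J_r=\{\lambda\in S\mid\mathrm{Im}\,\lambda=r\}$, $I_r^\varepsilon=\{\lambda\in S\mid|\mathrm{Re}\,\lambda-r|<\varepsilon\}$, $J_r^\varepsilon=\{\lambda\in S\mid|\mathrm{Im}\,\lambda-r|<\varepsilon\}$;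 $r$ is nice if for all $\delta>0$ there is $\varepsilon>0$ with $\mu^{\mathrm n}(I_r^\varepsilon),\mu^{\mathrm n}(J_r^\varepsilon)<\delta$. $NI$ is a fixed countable dense subset of $[-M,M]$ of nice reals with $\pm M\in NI$. $Sq^*$ is the family of sets $\{\lambda\in S\mid r_0<\mathrm{Re}\,\lambda<r_1,\ r_2<\mathrm{Im}\,\lambda<r_3\}$, $r_0,\dots,r_3\in NI$. For $Y\subseteq\mathrm{Int}(S)$, $\mu^*(Y)=\inf\{\sum_{i}\mu^{\mathrm n}(X_i)\mid X_i\in Sq^*,\ Y\subseteq\bigcup_{i<\omega}X_i\}$; for $Y\subseteq\mathbb C$, $\mu^*(Y)=\mu^*(Y\cap\mathrm{Int}(S))$; $\mu$ is the restriction of $\mu^*$ to the Carathéodory measurable sets, a Borel probability measure on $S$ with $\mu(S\setminus\sigma(A))=0$. Refinements: $Sq_n\subseteq Sq^*$ ($n<\omega$) are finite sets with (a) elements of $Sq_n$ are disjoint; (b) $\bigcup_{X\in Sq_n}\overline X=S$; (c) for all $X\in Sq^*$, $m<\omega$ there are $n>m$ and $Z\subseteq Sq_n$ with $\overline X=\bigcup_{Y\in Z}\overline Y$; (d) if $n<m$ and $X\in Sq_n$ there is $Z\subseteq Sq_m$ with $\overline X=\bigcup_{Y\in Z}\overline Y$; (e) each element of $Sq_n$ is a rectangle $\{\lambda\in S\mid r_0<\mathrm{Re}\,\lambda<r_1,\ r_2<\mathrm{Im}\,\lambda<r_3\}$ with $r_0,\dots,r_3\in NI$, $0<r_1-r_0<2M/(n+1)$,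 $0<r_3-r_2<2M/(n+1)$. The space $H^m_0$: for $v=(\sum_ka^N_ku_N(k))_N/\mathcal U$, $\|v\|_0^u$ is the class of $(\sum_k\xi_N(k)|a_k^N|)_N$. $Y\subseteq Sq_n$ is good if $S_1^Y=\bigcup_{R\in Sq_n\setminus Y}\overline R$ has positive distance from $\sigma(A)$ (or is empty). $v$ is $0$-good if for every $n$ and good $Y\subseteq Sq_n$, $(\sum_{\lambda_N(k)\in S_1^Y}\xi_N(k)|a^N_k|)_N/\mathcal U$ is infinitesimal. $H^{m0}$ is the set of $0$-good $v$ with $\|v\|_0^u$ bounded by a natural number, $u\sim_0v$ iff $\|u-v\|_0^u$ is infinitesimal, $H^m_0=H^{m0}/\sim_0$; $[v]_0$ denotes classes. The spaces $H^m_\infty$, $H^\infty_\infty$: for closed $X\subseteq\mathbb C$, $\|\sum_na_nu_N(n)\|^X_\infty=\sup\{\xi_N(n)^{-1}|a_n|\mid\lambda_N(n)\in X\}$ (with $0^{-1}=0$). $X_\varepsilon$ is the set of points at distance $\le\varepsilon$ from $\sigma(A)$; for $v=(v_N)_N/\mathcal U$, $\|v\|^\varepsilon_\infty=\lim_{\mathcal U}\|v_N\|^{X_\varepsilon}_\infty$ (or $\infty$). If there are $p<\omega$ and $Z\in\mathcal U$ with $|a^N_k|\xi_N(k)^{-1}<p$ for all $N\in Z$, $k<D_N$, then $\|v\|_\infty=\lim_{\varepsilon\to0}\|v\|^\varepsilon_\infty$; otherwise $\|v\|_\infty=\infty$. $u\sim_\infty v$ iff $\|u-v\|_\infty=0$;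 $H^\infty_\infty=H^u/\sim_\infty$; $H^{m}_\infty=\{v\in H^u\mid\|v\|_\infty<\infty\}/\sim_\infty$; $[v]_\infty$ denotes classes. Pairing: $\langle[f]_k|[g]_r\rangle=q\in\mathbb C$ if $\langle f'|g'\rangle^u$ is infinitely close to $q$ for all $f'\in[f]_k$, $g'\in[g]_r$ (and $=\infty$ if there is no such $q$). Kernel: for $P\in\mathbb C[X,Y]$ let $f_P(\lambda)=P(\lambda,\overline\lambda)$. $G:L_2(S,\mu)\to H$ is the isometric isomorphism determined by $G(f_P)=P(A,A^* )(\phi)$; $L_2(S,\mu)$ is identified with $L_2(\sigma(A),\mu\restriction\sigma(A))$. $B$ is a bounded linear operator on $H$ with a continuous kernel: there is a continuous $K:\sigma(A)^2\to\mathbb C$ such that for all $P$, $y\mapsto\int_{\sigma(A)}K(x,y)f_P(x)\,d\mu(x)$, $y\in\sigma(A)$, represents $G^{-1}BG(f_P)$. Fix a continuous extension of $K$ to $S^2$, also called $K$. Rectangles: given $\alpha,\beta\in\sigma(A)$, fix reals $r^n_i\in[-M,M]$ ($n<\omega$, $i<2^{n+2}+1$) with $r^n_i<r^n_{i+1}$, $r^n_{i+1}-r^n_i<2M/(n+1)$; $r^0_0=-M$, $r^0_4=M$; each $r^n_i$ equal to some $r^{n+1}_j$; neither $\alpha$ nor $\beta$ on any line $I_{r^n_i}$ or $J_{r^n_i}$; and for all $n$ and $\delta>0$ there is $\varepsilon>0$ with $\mu^{\mathrm n}(R^n_\varepsilon)<\delta$, where $R^n_\varepsilon=\bigcup_{i<2^{n+2}+1}(I^\varepsilon_{r^n_i}\cup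 J^\varepsilon_{r^n_i})$ (always with $\varepsilon$ so small that $r^n_j+\varepsilon<r^n_{j+1}-\varepsilon$). For $i,j<2^{n+2}$, $B^n_{ij}=\{\lambda\in S\mid r^n_i<\mathrm{Re}\,\lambda<r^n_{i+1},\ r^n_j<\mathrm{Im}\,\lambda<r^n_{j+1}\}$, and when $\mu(B^n_{ij})>0$, $\chi'_{B^n_{ij}}=\chi_{B^n_{ij}}/\mu(B^n_{ij})$ ($\chi$ = characteristic function) and $B_D(\chi'_{B^n_{ij}})(y)=\int_SK(x,y)\chi'_{B^n_{ij}}(x)\,d\mu(x)$. $u^n_{ij}(N)=\sum_{\lambda_N(k)\in B^n_{ij}}(\xi_N(k)/\mu_N(B^n_{ij}))u_N(k)$ if $\mu_N(B^n_{ij})\neq0$, and $0$ otherwise. For $\gamma\in\{\alpha,\beta\}$, $B^p_\gamma$ is the $B^p_{ij}$ containing $\gamma$, $u^p_\gamma(N)$ the corresponding $u^p_{ij}(N)$, and $u^p_\gamma=(u^p_\gamma(N))_N$. Conditions on linear operators $B_N$ on $H_N$ ($N<\omega$), with ultraproduct $B^u$ on $H^u$: (C1)$'$ There is a natural number $K_D$ with $\|B_N(v)\|^S_\infty\le K_D\|v\|^S_\infty$ for all $N$ and $v\in H_N$, and $B^u$ induces a well-defined operator $B^\infty$ on $H^\infty_\infty$. (C2)$'$ For all $B^n_{ij}$ with $\mu(B^n_{ij})>0$, $B^\infty([F(\chi'_{B^n_{ij}})]_\infty)=[F(B_D(\chi'_{B^n_{ij}}))]_\infty$. (C3)$'$ There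 is a natural number $p$ such that $\|B_N(u^n_{ij}(N))\|^S_\infty<p$ for all $n<\omega$, $i,j<2^{n+2}$, $N<\omega$. Dirac deltas: for $\gamma\in\{\alpha,\beta\}$, $\theta_\gamma:C(S)\to\mathbb C$ is the antilinear functional $\theta_\gamma(f)=\overline{f(\gamma)}$. An $X$-function is an $f\in C(S)$ with $|f|\le1$ on $S$ and $f=0$ on $S\setminus X$. $\varepsilon>0$ is very nice for $n$ if for every $i<2^{n+2}$ each of $r^n_i\pm\varepsilon$ is nice or outside $[-M,M]$. For $\theta=\theta_\gamma$, a pair $n:\omega\to\omega$, $\varepsilon:\omega\to\mathbb R_{>0}$ is $\theta$-good if (i) for all $m>0$, $\{N\mid n(N)>m,\ \varepsilon(N)<1/m\}\in\mathcal U$; (ii) there is $U(\theta,n,\varepsilon)\in\mathcal U$ such that for all $N$ in it with $n=n(N)>0$, putting $\varepsilon=\varepsilon(N)$, $\delta'=\min\{\mu_N(B^n_{ij})\mid\mu(B^n_{ij})>0\}$, $\delta=\delta'/2^{3(n+2)}$: (a) $|\theta(f)|<\delta$ for all $R^n_\varepsilon$-functions $f$, (b) $\sum_{\lambda_N(i)\in R^n_\varepsilon}\xi_N(i)^2<\delta$, (c) $|\mu_N(B^n_{ij})-\mu(B^n_{ij})|<\delta$ for all $i,j<2^{n+2}$; (iii) $\varepsilon(N)$ is very nice for $n(N)$. Fix a pair $(n,\varepsilon)$ that is both $\theta_\alpha$-good and $\theta_\beta$-good, with witnessing sets $U(\theta_\alpha,n,\varepsilon)$, $U(\theta_\beta,n,\varepsilon)$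 such that in addition, for $N\in U(\theta_\alpha,n,\varepsilon)\cap U(\theta_\beta,n,\varepsilon)$ with $p=n(N)>0$, $$|\langle u^p_\beta(N)|B_N(u^p_\alpha(N))\rangle-\langle u^p_\beta|B^u(u^p_\alpha)\rangle|<p^{-1}.$$ With $\theta(B^n_{ij},1)=\lim_{\varepsilon\to0}\theta(f_\varepsilon)$, where $f_\varepsilon$ is any $B^n_{ij}$-function equal to $1$ at all $x$ with $r^n_i+\varepsilon<\mathrm{Re}\,x<r^n_{i+1}-\varepsilon$, $r^n_j+\varepsilon<\mathrm{Im}\,x<r^n_{j+1}-\varepsilon$, define $u(\theta)=(u_N(\theta))_N/\mathcal U\in H^u$, where, with $n=n(N)$, $$u_N(\theta)=\sum_{\mu(B^n_{ij})\ne0}\ \sum_{\lambda_N(k)\in B^n_{ij}}\frac{\xi_N(k)\,\theta(B^n_{ij},1)}{\mu_N(B^n_{ij})}\,u_N(k).$$ *)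

(* Defs.v *)
From HB Require Import structures.
From mathcomp Require Import all_boot all_order all_algebra complex.
From mathcomp Require Import all_classical all_reals all_analysis.

Set Implicit Arguments.
Unset Strict Implicit.
Unset Printing Implicit Defensive.

Import Order.TTheory GRing.Theory Num.Theory.
Import numFieldNormedType.Exports.

Local Open Scope classical_set_scope.
Local Open Scope ring_scope.

(* Conventions.
   - The complex numbers are R[i] for R : realType, with the topology of the
     absolute value.  Norms are R[i]-valued in the library; [absr] and
     [complex.Re `|v|] turn them into elements of R.
   - An element of the ultraproduct H^u is represented by a sequence
     v : nat -> H with v N in H_N for U-almost all N; "infinitely close to a
     standard number" is convergence along the ultrafilter.  Elements of the
     quotients of H^u are represented by the sets of their representing
     sequences.
   - The library's [sup set0], [inf set0] and 0^-1 are 0. *)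

HB.instance Definition _ (R : realType) := PseudoPointedMetric.copy R[i] R[i]^o.
HB.instance Definition _ (R : realType) := NormedModule.copy R[i] R[i]^o.

Definition absr {R : realType} (z : R[i]) : R := complex.Re `|z|.

Section cover_outer_measure.
Context {R : realType} {T : Type}.
Variables (G : set (set T)) (m : set T -> \bar R).
Local Open Scope ereal_scope.

Definition cover_ext (Y : set T) : \bar R :=
  ereal_inf [set \sum_(i <oo) m (X i) |
             X in [set X : (set T)^nat |
                   (forall i, G (X i)) /\ Y `<=` \bigcup_i X i]].

Hypotheses (G0 : G set0) (m0 : m set0 = 0) (m_ge0 : forall X, 0 <= m X).

Lemma cover_ext_ge0 Y : 0 <= cover_ext Y.
Proof.
by apply: le_ereal_inf_tmp => x [B _ <-]; apply: nneseries_ge0 => *; exact: m_ge0.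
Qed.

Lemma cover_ext0 : cover_ext set0 = 0.
Proof.
apply/eqP; rewrite eq_le cover_ext_ge0 andbT.
apply: ereal_inf_lbound; exists (fun=> set0); first by split.
by rewrite eseries0.
Qed.

Lemma le_cover_ext : {homo cover_ext : A B / A `<=` B >-> A <= B}.
Proof.
move=> A B AB; apply/ereal_inf_le_tmp => x [X [GX BX] <-].
by exists X => //; split => //; exact: subset_trans BX.
Qed.

Lemma cover_ext_sigma_subadditive : sigma_subadditive cover_ext.
Proof.
move=> A; have [[i ioo]|] := pselect (exists i, cover_ext (A i) = +oo).
  rewrite (eseries_pinfty _ _ ioo) ?leey// => n _.
  by rewrite -ltNye (lt_le_trans _ (cover_ext_ge0 _)).
rewrite -forallNE => Aoo.
suff add2e (e : {posnum R}) :
    cover_ext (\bigcup_n A n) <= \sum_(i <oo) cover_ext (A i) + e%:num%:E.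
  by apply/lee_addgt0Pr => _/posnumP[].
rewrite (le_trans _ (epsilon_trick _ _ _))//; last first.
  by move=> n; exact: cover_ext_ge0.
pose P n (B : (set T)^nat) :=
  ((forall i, G (B i)) /\ A n `<=` \bigcup_i B i) /\
  \sum_(k <oo) m (B k) <= cover_ext (A n) + (e%:num / (2 ^ n.+1)%:R)%:E.
have [F PF] : {F : ((set T)^nat)^nat & forall n, P n (F n)}.
  apply: (@choice _ _ P) => n; rewrite /P /cover_ext.
  set S := (X in ereal_inf X); move infS : (ereal_inf S) => iS.
  case: iS infS => [r Sr|Soo|Soo].
  - have en1 : (0 < e%:num / (2 ^ n.+1)%:R)%R by [].
    have /(lb_ereal_inf_adherent en1) : ereal_inf S \is a fin_num by rewrite Sr.
    move=> [x [B [mB AnB] muBx] xS].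
    by exists B; split => //; rewrite muBx -Sr; exact/ltW.
  - by have := Aoo n; rewrite /cover_ext Soo.
  - suff : lbound S 0 by move/le_ereal_inf_tmp; rewrite Soo.
    by move=> /= _ [B [mB AnB] <-]; exact: nneseries_ge0.
have muF_ge0 x : 0 <= (m \o uncurry F) x by exact: m_ge0.
apply: (@le_trans _ _ (\esum_(i in setT) (m \o uncurry F) i)).
  apply: ereal_inf_lbound => /=.
  have /card_esym/ppcard_eqP[f] := card_nat2.
  exists (uncurry F \o f).
    split => [i|].
      by rewrite /= /uncurry; case: (f i) => a b; exact: (PF a).1.1.
    apply: (@subset_trans _ (\bigcup_n \bigcup_k F n k)) => [t [i _]|].
      by move=> /(PF i).1.2 -[j _ ?]; exists i => //; exists j.
    move=> t [i _ [j _ Bijt]]; exists (f^-1%FUN (i, j)) => //=.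
    by rewrite invK ?inE.
  rewrite -(esum_pred_image (m \o uncurry F) _ xpredT) ?[fun=> _]set_true//.
  by rewrite image_eq.
rewrite (_ : esum _ _ = \sum_(i <oo) \sum_(j <oo) m (F i j)); last first.
  pose J : nat -> set (nat * nat) := fun i => [set (i, j) | j in setT].
  rewrite (_ : setT = \bigcup_k J k); last first.
    by rewrite predeqE => -[a b]; split => // _; exists a => //; exists b.
  rewrite esum_bigcupT /=; last 2 first.
    - apply/trivIsetP => i j _ _ ij.
      rewrite predeqE => -[n k] /=; split => //= -[] [_] _ [<-{n} _].
      by move=> [k' _] [] /esym/eqP; rewrite (negbTE ij).
    - by move=> /= [n k]; exact: m_ge0.
  rewrite -(image_id [set: nat]) -fun_true esum_pred_image//; last first.
    by move=> n _; exact: esum_ge0.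
  apply: eq_eseriesr => /= j _.
  rewrite -(esum_pred_image (m \o uncurry F) (pair j) predT)//=; last first.
    by move=> ? ? _ _; exact: (@can_inj _ _ _ snd).
  by congr esum; rewrite predeqE => -[a b]; split; move=> [i _ <-]; exists i.
apply: lee_lim.
- apply: is_cvg_nneseries => n *.
  by apply: nneseries_ge0 => k *; exact: (muF_ge0 (n, k)).
- by apply: is_cvg_nneseries => n *; apply: adde_ge0 => //; exact: cover_ext_ge0.
- by near=> n; apply: lee_sum => i _; exact: (PF i).2.
Unshelve. all: by end_near. Qed.

End cover_outer_measure.

Section linear_algebra.
Context {R : realType} {H : completeNormedModType R[i]}.
Implicit Types (E : set H) (T : H -> H).

Definition lin_span E : set H :=
  [set v | exists n (c : 'I_n -> R[i]) (x : 'I_n -> H),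
     (forall k, E (x k)) /\ v = \sum_k c k *: x k].

Definition linear_from_to E E' T :=
  (forall v, E v -> E' (T v)) /\
  (forall a u v, E u -> E v -> T (a *: u + v) = a *: T u + T v).

Definition op_norm T : R :=
  sup [set complex.Re `|T v| | v in [set v : H | `|v| <= 1]].

Definition spectrum T : set R[i] :=
  [set l | ~ exists S : {linear H -> H}, [/\ continuous S,
     forall v, S (T v - l *: v) = v & forall v, T (S v) - l *: S v = v]].

(* P(T, T') v, for P in C[X,Y] seen as a polynomial in Y over C[X] *)
Definition eval2 (P : {poly {poly R[i]}}) T T' (v : H) : H :=
  \sum_(j < size P) \sum_(i < size P`_j) (P`_j)`_i *: iter i T (iter j T' v).

End linear_algebra.

(* The library's forms are linear on the left, so < u | v > is [form v u]. *)
Record cyclic_operator (R : realType) (H : completeNormedModType R[i]) := {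
  form : {dot H for Num.conj};
  normE : forall v, `|v| ^+ 2 = form v v;
  separableH : exists E : set H, countable E /\ dense E;
  opV : {linear H -> H};
  opV_isometry : forall u v, form (opV u) (opV v) = form u v;
  opV_surjective : forall v, exists u, opV u = v;
  cq : R[i];
  cq_neq0 : cq != 0;
  opA := (fun v => cq *: opV v) : H -> H;
  opA_adj : H -> H;
  opA_adjP : forall u v, form (opA v) u = form v (opA_adj u);
  phi : H;
  phi_unit : `|phi| = 1;
  phi_cyclic : dense (range (fun P => eval2 P opA opA_adj phi))
}.

Section finite_spaces.
Context {R : realType} {H : completeNormedModType R[i]}.
Variable X : cyclic_operator H.

Definition ip (u v : H) : R[i] := form X v u.

Definition sigma : set R[i] := spectrum (opA X).

Definition rA : R := absr (cq X) ^+ 2.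

Definition moment (i j : nat) : H := iter i (opA X) (iter j (opA_adj X) (phi X)).

Definition spH (N : nat) : set H :=
  lin_span [set v | exists i j, (i <= N)%N /\ (j <= N)%N /\ v = moment i j].

Definition spHminus (N : nat) : set H :=
  lin_span [set v | exists i j, (i < N)%N /\ (j <= N)%N /\ v = moment i j].

Definition spHplus (N : nat) : set H :=
  lin_span [set v | exists i j,
    (0 < i)%N /\ (i <= N)%N /\ (j <= N)%N /\ v = moment i j].

Definition orth_in (E F : set H) : set H :=
  [set v | E v /\ forall u, F u -> ip u v = 0].

Definition spWminus N := orth_in (spH N) (spHminus N).
Definition spWplus N := orth_in (spH N) (spHplus N).

End finite_spaces.

Record finite_models (R : realType) (H : completeNormedModType R[i])
    (X : cyclic_operator H) := {
  opU : nat -> H -> H;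
  opU_linear : forall N, linear_from_to (spWminus X N) (spWplus X N) (opU N);
  opU_isometry : forall N u v, spWminus X N u -> spWminus X N v ->
    ip X (opU N u) (opU N v) = ip X u v;
  opU_surjective : forall N w, spWplus X N w ->
    exists2 v, spWminus X N v & opU N v = w;
  opAN : nat -> H -> H;
  opAN_linear : forall N, linear_from_to (spH X N) (spH X N) (opAN N);
  opAN_minus : forall N u, spHminus X N u -> opAN N u = opA X u;
  opAN_W : forall N u, spWminus X N u ->
    opAN N u = (Num.sqrt (rA X))%:C%C *: opU N u;
  dimH : nat -> nat;
  eigvec : forall N, 'I_(dimH N) -> H;
  eigval : forall N, 'I_(dimH N) -> R[i];
  eigvec_orthonormal : forall N (k l : 'I_(dimH N)),
    ip X (eigvec k) (eigvec l) = (k == l)%:R;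
  eigvec_span : forall N, lin_span (range (@eigvec N)) = spH X N;
  eigvecP : forall N (k : 'I_(dimH N)),
    opAN N (eigvec k) = eigval k *: eigvec k;
  eigvec_phi : forall N (k : 'I_(dimH N)), 0 <= ip X (eigvec k) (phi X)
}.

Section counting.
Context {R : realType} {H : completeNormedModType R[i]} {X : cyclic_operator H}.
Variable Y : finite_models X.

Definition xi N (k : 'I_(dimH Y N)) : R := complex.Re (ip X (eigvec k) (phi X)).

Definition muN (N : nat) (A : set R[i]) : R :=
  \sum_(k < dimH Y N | eigval k \in A) xi k ^+ 2.

Definition mun (UU : set_system nat) (A : set R[i]) : R :=
  lim ((fun N => muN N A) @ UU).

Variable M : nat.

Definition square : set R[i] :=
  [set l | `|complex.Re l| <= M%:R /\ `|complex.Im l| <= M%:R].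

Definition stripI (r e : R) : set R[i] :=
  [set l | square l /\ `|complex.Re l - r| < e].

Definition stripJ (r e : R) : set R[i] :=
  [set l | square l /\ `|complex.Im l - r| < e].

Definition lineI (r : R) : set R[i] := [set l | square l /\ complex.Re l = r].

Definition lineJ (r : R) : set R[i] := [set l | square l /\ complex.Im l = r].

Definition rect (r0 r1 r2 r3 : R) : set R[i] :=
  [set l | [/\ square l, r0 < complex.Re l < r1 & r2 < complex.Im l < r3]].

Definition nice (UU : set_system nat) (r : R) :=
  - M%:R <= r <= M%:R /\
  forall d, 0 < d -> exists e, [/\ 0 < e,
    mun UU (stripI r e) < d & mun UU (stripJ r e) < d].

End counting.

Record spectral_setting (R : realType) (H : completeNormedModType R[i])
    (X : cyclic_operator H) (Y : finite_models X) := {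
  bM : nat;
  bM_op_norm : op_norm (opA X) < bM%:R;
  bM_rA : Num.sqrt (rA X) < bM%:R;
  UU : set_system nat;
  UU_ultra : UltraFilter UU;
  UU_squares : forall m, (1 <= m)%N ->
    UU [set N | (1 <= N)%N /\ exists s, N = (s ^ 2)%N /\ (m %| s)%N];
  NI : set R;
  NI_countable : countable NI;
  NI_nice : forall r, NI r -> nice Y bM UU r;
  NI_dense : [set r : R | - bM%:R <= r <= bM%:R] `<=` closure NI;
  NI_right : NI bM%:R;
  NI_left : NI (- bM%:R)
}.

Section measure.
Context {R : realType} {H : completeNormedModType R[i]} {X : cyclic_operator H}.
Context {Y : finite_models X}.
Variable Z : spectral_setting Y.

Definition sqS : set R[i] := square (bM Z).

Definition mu_n (A : set R[i]) : R := mun Y (UU Z) A.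

Definition Sqstar : set (set R[i]) :=
  [set A | exists r0 r1 r2 r3, [/\ NI Z r0, NI Z r1, NI Z r2 & NI Z r3] /\
                               A = rect (bM Z) r0 r1 r2 r3].

Definition mustar (A : set R[i]) : \bar R :=
  cover_ext Sqstar (fun B => (mu_n B)%:E) (A `&` interior sqS).

Lemma Sqstar0 : Sqstar set0.
Proof.
exists (bM Z)%:R, (bM Z)%:R, (bM Z)%:R, (bM Z)%:R; split.
  by split; exact: NI_right.
apply/seteqP; split=> // l [_ /andP[h1 h2] _].
by have := lt_trans h1 h2; rewrite ltxx.
Qed.

Lemma mu_n_ge0 A : 0 <= mu_n A.
Proof.
have UF := UU_ultra Z; rewrite /mu_n /mun.
have [h|h] := pselect (cvg ((fun N => muN Y N A) @ UU Z)).
  apply: limr_ge => //; apply: nearW => N.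
  by apply: sumr_ge0 => k _; exact: sqr_ge0.
by rewrite dvgP.
Qed.

Lemma mu_n0 : mu_n set0 = 0.
Proof.
have UF := UU_ultra Z; rewrite /mu_n /mun.
rewrite (_ : (fun N => _) = fun=> 0) ?lim_cst//.
by apply/funext => N; rewrite /muN big_pred0// => k; rewrite in_set0.
Qed.

Lemma mustar0 : mustar set0 = 0%E.
Proof.
by rewrite /mustar set0I cover_ext0 ?mu_n0 //=;
  [exact: Sqstar0|move=> ?; rewrite lee_fin mu_n_ge0].
Qed.

Lemma mustar_ge0 A : (0 <= mustar A)%E.
Proof. by apply: cover_ext_ge0 => B; rewrite lee_fin mu_n_ge0. Qed.

Lemma le_mustar : {homo mustar : A B / A `<=` B >-> (A <= B)%E}.
Proof. by move=> A B AB; apply: le_cover_ext; exact: setSI. Qed.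

Lemma mustar_sigma_subadditive : sigma_subadditive mustar.
Proof.
move=> F; rewrite /mustar setI_bigcupl.
by apply: cover_ext_sigma_subadditive => B; rewrite lee_fin mu_n_ge0.
Qed.

HB.instance Definition _ := isOuterMeasure.Build R R[i] mustar
  mustar0 mustar_ge0 le_mustar mustar_sigma_subadditive.

Definition mu_outer : {outer_measure set R[i] -> \bar R} := mustar.

(* mu_outer restricted to its Caratheodory measurable sets *)
Definition mu : {measure set (caratheodory_type mu_outer) -> \bar R} :=
  (mu_outer : set (caratheodory_type mu_outer) -> \bar R).

Definition cintegral (D : set R[i]) (f : R[i] -> R[i]) : R[i] :=
  Complex (Rintegral mu D (fun l => complex.Re (f l)))
          (Rintegral mu D (fun l => complex.Im (f l))).

(* Representatives of the elements of L_2(S, mu) *)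
Definition L2fun (f : R[i] -> R[i]) :=
  [/\ measurable_fun (sqS : set (caratheodory_type mu_outer))
        (fun l => complex.Re (f l)),
      measurable_fun (sqS : set (caratheodory_type mu_outer))
        (fun l => complex.Im (f l)) &
      (\int[mu]_(l in sqS) (absr (f l) ^+ 2)%:E < +oo)%E].

Definition fpoly (P : {poly {poly R[i]}}) (l : R[i]) : R[i] :=
  P.[(l^*)%:P].[l].

(* G acts on representatives; it respects almost everywhere equality because
   it is linear and isometric. *)
Definition spectral_iso (G : (R[i] -> R[i]) -> H) :=
  [/\ forall a f g, L2fun f -> L2fun g ->
        G (fun l => a * f l + g l) = a *: G f + G g,
      forall f, L2fun f ->
        complex.Re `|G f| ^+ 2 = Rintegral mu sqS (fun l => absr (f l) ^+ 2),
      forall v, exists2 f, L2fun f & G f = v &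
      forall P, G (fpoly P) = eval2 P (opA X) (opA_adj X) (phi X)].

(* K is already the continuous extension to S^2. *)
Definition continuous_kernel (G : (R[i] -> R[i]) -> H) (B : H -> H)
    (K : R[i] -> R[i] -> R[i]) :=
  {within sqS `*` sqS, continuous (fun p : R[i] * R[i] => K p.1 p.2)} /\
  forall P, exists2 g, L2fun g &
    (forall y, sigma X y ->
       g y = cintegral (sigma X) (fun x => K x y * fpoly P x)) /\
    G g = B (G (fpoly P)).

Definition refinement (Sq : nat -> set (set R[i])) :=
  (forall n, finite_set (Sq n) /\ Sq n `<=` Sqstar) /\
  (forall n, trivIset (Sq n) id) /\
  (forall n, \bigcup_(A in Sq n) closure A = sqS) /\
  (forall A m, Sqstar A -> exists n, (m < n)%N /\
     exists2 W, W `<=` Sq n & closure A = \bigcup_(B in W) closure B) /\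
  (forall n m A, (n < m)%N -> Sq n A ->
     exists2 W, W `<=` Sq m & closure A = \bigcup_(B in W) closure B) /\
  (forall n A, Sq n A -> exists r0 r1 r2 r3,
     [/\ [/\ NI Z r0, NI Z r1, NI Z r2 & NI Z r3],
         A = rect (bM Z) r0 r1 r2 r3,
         0 < r1 - r0 < 2 * (bM Z)%:R / n.+1%:R &
         0 < r3 - r2 < 2 * (bM Z)%:R / n.+1%:R]).

End measure.

Section ultraproduct.
Context {R : realType} {H : completeNormedModType R[i]} {X : cyclic_operator H}.
Context {Y : finite_models X}.
Variable Z : spectral_setting Y.
Implicit Types (u v w f g : nat -> H).

Definition Hu : set (nat -> H) := [set v | UU Z [set N | spH X N (v N)]].

Definition subu u v : nat -> H := fun N => u N - v N.

Definition st_ip f g : R[i] := lim ((fun N => ip X (f N) (g N)) @ UU Z).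

(* the coefficient a_k of v = \sum_k a_k u_N(k), for v in H_N *)
Definition coef N (v : H) (k : 'I_(dimH Y N)) : R[i] := ip X (eigvec k) v.

Definition Fseq (f : R[i] -> R[i]) : nat -> H := fun N =>
  \sum_(k < dimH Y N) ((xi k)%:C%C * f (eigval k)) *: eigvec k.

Definition norm0 (A : set R[i]) (N : nat) (v : H) : R :=
  \sum_(k < dimH Y N | eigval k \in A) xi k * absr (coef v k).

Definition infinitesimal (x : nat -> R) := x @ UU Z --> (0 : R).

Definition sim0 u v := infinitesimal (fun N => norm0 setT N (subu u v N)).

Definition set_dist (A B : set R[i]) : R :=
  inf [set d | exists x y, [/\ A x, B y & d = absr (x - y)]].

Section refined.
Variable Sq : nat -> set (set R[i]).

Definition outer_region (n : nat) (W : set (set R[i])) : set R[i] :=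
  \bigcup_(A in Sq n `\` W) closure A.

Definition good_subset (n : nat) (W : set (set R[i])) :=
  W `<=` Sq n /\
  (outer_region n W = set0 \/ 0 < set_dist (outer_region n W) (sigma X)).

Definition zero_good v :=
  forall n W, good_subset n W ->
    infinitesimal (fun N => norm0 (outer_region n W) N (v N)).

Definition Hm0 : set (nat -> H) :=
  [set v | [/\ Hu v, zero_good v &
              exists p : nat, UU Z [set N | norm0 setT N (v N) <= p%:R]]].

Definition class0 v : set (nat -> H) := [set w | Hm0 w /\ sim0 w v].

End refined.

Definition norm_infty (A : set R[i]) (N : nat) (v : H) : R :=
  \big[Num.max/0]_(k < dimH Y N | eigval k \in A) ((xi k)^-1 * absr (coef v k)).

Definition sigma_nbhd (e : R) : set R[i] :=
  [set l | set_dist [set l] (sigma X) <= e].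

(* Limits along an ultrafilter always exist in \bar R. *)
Definition norm_infty_eps (e : R) v : \bar R :=
  lim ((fun N => (norm_infty (sigma_nbhd e) N (v N))%:E) @ UU Z).

Definition infty_bounded v :=
  exists p : nat, UU Z [set N |
    forall k : 'I_(dimH Y N), absr (coef (v N) k) * (xi k)^-1 < p%:R].

Definition norm_infty_u v : \bar R :=
  if `[< infty_bounded v >] then
    lim ((fun e => norm_infty_eps e v) @ (0 : R)^'+)
  else +oo%E.

Definition sim_infty u v := norm_infty_u (subu u v) = 0%E.

Definition class_infty v : set (nat -> H) := [set w | Hu w /\ sim_infty w v].

Definition applyu (B : nat -> H -> H) v : nat -> H := fun N => B N (v N).

Definition Binfty (B : nat -> H -> H) (c : set (nat -> H)) : set (nat -> H) :=
  [set w | Hu w /\ exists2 v, c v & sim_infty w (applyu B v)].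

(* <c | d> = z; a class in a quotient of (a subset of) H^u is never empty, and
   the value z is then unique. *)
Definition pairs_to (c d : set (nat -> H)) (z : R[i]) :=
  [/\ c !=set0, d !=set0 &
      forall f g, c f -> d g -> (fun N => ip X (f N) (g N)) @ UU Z --> z].

End ultraproduct.

Arguments coef {R H X} Y {N} v k.
Arguments Fseq {R H X} Y f N.
Arguments norm0 {R H X} Y A N v.
Arguments norm_infty {R H X} Y A N v.

Section rectangles.
Context {R : realType} {H : completeNormedModType R[i]} {X : cyclic_operator H}.
Context {Y : finite_models X}.
Variables (Z : spectral_setting Y) (r : nat -> nat -> R).

Local Notation M := (bM Z).

(* r n i is used for i <= 2 ^ (n + 2) only *)
Definition strips (n : nat) (e : R) : set R[i] :=
  \bigcup_(i in [set i | (i < 2 ^ (n + 2) + 1)%N])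
     (stripI M (r n i) e `|` stripJ M (r n i) e).

Definition small_eps (n : nat) (e : R) :=
  forall j, (j < 2 ^ (n + 2))%N -> r n j + e < r n j.+1 - e.

Definition grid (alpha beta : R[i]) :=
  (forall n i, (i < 2 ^ (n + 2) + 1)%N -> - M%:R <= r n i <= M%:R) /\
  (forall n i, (i < 2 ^ (n + 2))%N ->
     r n i < r n i.+1 /\ r n i.+1 - r n i < 2 * M%:R / n.+1%:R) /\
  r 0%N 0%N = - M%:R /\
  r 0%N 4%N = M%:R /\
  (forall n i, (i < 2 ^ (n + 2) + 1)%N ->
     exists2 j, (j < 2 ^ (n.+1 + 2) + 1)%N & r n i = r n.+1 j) /\
  (forall n i, (i < 2 ^ (n + 2) + 1)%N ->
     [/\ ~ lineI M (r n i) alpha, ~ lineJ M (r n i) alpha,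
         ~ lineI M (r n i) beta & ~ lineJ M (r n i) beta]) /\
  (forall n d, 0 < d ->
     exists e, [/\ 0 < e, small_eps n e & mu_n Z (strips n e) < d]).

Definition cell (n i j : nat) : set R[i] :=
  rect M (r n i) (r n i.+1) (r n j) (r n j.+1).

Definition chi' (n i j : nat) (l : R[i]) : R[i] :=
  ((\1_(cell n i j) l / fine (mu Z (cell n i j))) : R)%:C%C.

Definition BD (K : R[i] -> R[i] -> R[i]) (h : R[i] -> R[i]) (y : R[i]) : R[i] :=
  cintegral Z (sqS Z) (fun x => K x y * h x).

Definition ucell (n i j : nat) : nat -> H := fun N =>
  if muN Y N (cell n i j) != 0 then
    \sum_(k < dimH Y N | eigval k \in cell n i j)
       (xi k / muN Y N (cell n i j))%:C%C *: eigvec k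
  else 0.

(* u^p_gamma; the cell containing gamma is unique when it exists *)
Definition upoint (gamma : R[i]) (p : nat) : nat -> H :=
  if [pick ij : 'I_(2 ^ (p + 2)) * 'I_(2 ^ (p + 2)) |
        gamma \in cell p ij.1 ij.2] is Some ij
  then ucell p ij.1 ij.2 else fun=> 0.

Definition C1' (B : nat -> H -> H) :=
  (exists KD : nat, forall N v, spH X N v ->
     norm_infty Y (sqS Z) N (B N v) <= KD%:R * norm_infty Y (sqS Z) N v) /\
  (forall u v, Hu Z u -> Hu Z v -> sim_infty Z u v ->
     sim_infty Z (applyu B u) (applyu B v)).

Definition C2' (K : R[i] -> R[i] -> R[i]) (B : nat -> H -> H) :=
  forall n i j, (i < 2 ^ (n + 2))%N -> (j < 2 ^ (n + 2))%N ->
    (0 < mu Z (cell n i j))%E ->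
    Binfty Z B (class_infty Z (Fseq Y (chi' n i j))) =
    class_infty Z (Fseq Y (BD K (chi' n i j))).

Definition C3' (B : nat -> H -> H) :=
  exists p : nat, forall n i j N,
    (i < 2 ^ (n + 2))%N -> (j < 2 ^ (n + 2))%N ->
    norm_infty Y (sqS Z) N (B N (ucell n i j N)) < p%:R.

(* the functional f |-> conj (f gamma) on C(S) *)
Definition dirac_delta (gamma : R[i]) (f : R[i] -> R[i]) : R[i] := (f gamma)^*.

Definition Xfunction (A : set R[i]) (f : R[i] -> R[i]) :=
  [/\ {within sqS Z, continuous f},
      forall l, sqS Z l -> absr (f l) <= 1 &
      forall l, sqS Z l -> ~ A l -> f l = 0].

Definition very_nice (n : nat) (e : R) :=
  forall i s, (i < 2 ^ (n + 2))%N -> s = r n i + e \/ s = r n i - e ->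
    nice Y M (UU Z) s \/ ~ (- M%:R <= s <= M%:R).

Definition delta' (n N : nat) : R :=
  inf [set d | exists i j, [/\ (i < 2 ^ (n + 2))%N, (j < 2 ^ (n + 2))%N,
                              (0 < mu Z (cell n i j))%E &
                              d = muN Y N (cell n i j)]].

Definition delta (n N : nat) : R := delta' n N / 2 ^+ (3 * (n + 2)).

(* W is the witnessing set U(theta, n, eps). *)
Definition good_pair (theta : (R[i] -> R[i]) -> R[i])
    (nn : nat -> nat) (ee : nat -> R) (W : set nat) :=
  [/\ forall N, 0 < ee N,
      forall m, (0 < m)%N -> UU Z [set N | (m < nn N)%N /\ ee N < m%:R^-1],
      UU Z W /\ (forall N, W N -> (0 < nn N)%N ->
        [/\ small_eps (nn N) (ee N),
            forall f, Xfunction (strips (nn N) (ee N)) f ->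
              absr (theta f) < delta (nn N) N,
            \sum_(k < dimH Y N | eigval k \in strips (nn N) (ee N)) xi k ^+ 2
              < delta (nn N) N &
            forall i j, (i < 2 ^ (nn N + 2))%N -> (j < 2 ^ (nn N + 2))%N ->
              `|muN Y N (cell (nn N) i j) - fine (mu Z (cell (nn N) i j))|
                < delta (nn N) N]) &
      forall N, very_nice (nn N) (ee N)].

Definition theta_cell (theta : (R[i] -> R[i]) -> R[i]) (n i j : nat) : R[i] :=
  get [set z : R[i] | forall f : R -> R[i] -> R[i],
    (forall e, 0 < e -> Xfunction (cell n i j) (f e) /\
       forall l, r n i + e < complex.Re l < r n i.+1 - e ->
                 r n j + e < complex.Im l < r n j.+1 - e -> f e l = 1) ->
    (fun e => theta (f e)) @ (0 : R)^'+ --> z].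

Definition utheta (theta : (R[i] -> R[i]) -> R[i]) (nn : nat -> nat) : nat -> H :=
  fun N =>
  \sum_(i < 2 ^ (nn N + 2)) \sum_(j < 2 ^ (nn N + 2)
                                 | mu Z (cell (nn N) i j) != 0%E)
    \sum_(k < dimH Y N | eigval k \in cell (nn N) i j)
      ((xi k)%:C%C * theta_cell theta (nn N) i j
         / (muN Y N (cell (nn N) i j))%:C%C) *: eigvec k.

End rectangles.

(* Main.v *)
From HB Require Import structures.
Require Import Defs.
From mathcomp Require Import all_boot all_order all_algebra complex.
From mathcomp Require Import all_classical all_reals all_analysis.
From mathcomp Require Import finmap measurable_realfun ring lra.
Import Order.TTheory GRing.Theory Num.Theory numFieldNormedType.Exports.
Local Open Scope classical_set_scope.
Local Open Scope ring_scope.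

Set Implicit Arguments.
Unset Strict Implicit.
Unset Printing Implicit Defensive.

(** Why the formula holds.  At stage [N] let [p] be the level [nn N] of the grid.
    At almost every stage the vector of the Dirac delta at [gamma] is the normalized
    cell vector of the level [p] cell containing [gamma]: the tents supported in
    a cell and tending to [1] inside it ([theta_cellE]) make the coefficient of
    that cell equal to [1] and all the others equal to [0] ([uthetaE]).  The
    hypothesis [Hclose] replaces the pairing of the two cell vectors at stage
    [N] by its ultralimit at the standard level [p], so it suffices to show that
    this ultralimit tends to [K alpha beta] as [p] grows ([level_pairing]).

    For a fixed level [p] the cell vector at [alpha] differs from the vector of
    the normalized characteristic function only by the factor relating the mass
    of the cell for [muN] to its mass for [mu], and the former tends to the
    latter.  [C1'] allows the replacement and [C2'] identifies the image of the
    second vector with the vector of [BD K], whose value at a point [y] of the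
    cell of [beta] is the average of [K x y] over the cell of [alpha].  Pairing
    with the cell vector at [beta] averages over [y] as well.  By continuity of
    [K] both averages are close to [K alpha beta] ([kernel_near],
    [BD_average], [ip_ucell_Fseq]).

    Equality of classes in the infinity norm is a statement about a neighbourhood
    of the spectrum only, so the replacements it allows need the other factor of the
    pairing to carry no weight away from the spectrum ([pairing_infinitesimal]).
    For members of the 0-classes this is 0-goodness.  For the cell vectors it says
    that the spectral masses concentrate near the spectrum
    ([vanishing_off_tube]); dually, dividing by the mass of the cell of [gamma]
    is possible because a point of the spectrum charges its neighbourhoods
    ([sigma_not_vanishing]).  Both facts are obtained without the spectral
    theorem, from the average of the identity and of the unitary [A / x]: by the
    parallelogram law its contraction factor measures the distance of [x] to the
    spectrum ([hnorm_avg]), both for [A] on [H] and for the eigenvalues of the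
    models, and it decides at the same time whether [A - x] is invertible
    ([sigma_not_below]) and how much mass sits around [x] ([resolvent_mass]).
    The transfer between [H] and the models rests on the identity
    [A_N v = A v] on [H_N^-], by which the eigenvector coefficients of a fixed
    polynomial vector are exact as soon as [N] is large ([coef_opA]).

    Finally the mass of a fixed cell converges because the cell is, up to grid
    lines, a union of cells of the level [nn N], on which [muN] and [mu] differ by
    less than the tolerance of a good pair ([cell_error]).  This needs [mu] to be
    additive on cells: half-planes are Caratheodory measurable since they cut a
    covering rectangle into two covering rectangles and a null line. *)

(** * Complex modulus and inner product *)

Section modulus.
Context {R : realType}.
Implicit Types (z w : R[i]) (x : R).

Lemma absrE z : (absr z)%:C%C = `|z|.
Proof. by rewrite /absr RRe_real. Qed.

Lemma absr_eq z x : `|z| = x%:C%C -> absr z = x.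
Proof. by rewrite /absr => ->. Qed.

Lemma absr_ge0 z : 0 <= absr z.
Proof. by rewrite -ler0c absrE. Qed.

Lemma absrM z w : absr (z * w) = absr z * absr w.
Proof. by apply: absr_eq; rewrite normrM rmorphM /= !absrE. Qed.

Lemma absrX z n : absr (z ^+ n) = absr z ^+ n.
Proof. by apply: absr_eq; rewrite normrX rmorphXn /= !absrE. Qed.

Lemma absrD z w : absr (z + w) <= absr z + absr w.
Proof. by rewrite -lecR rmorphD /= !absrE ler_normD. Qed.

Lemma absrN z : absr (- z) = absr z.
Proof. by rewrite /absr normrN. Qed.

Lemma absrB z w : absr (z - w) = absr (w - z).
Proof. by rewrite -absrN opprB. Qed.

Lemma absr0 : absr (0 : R[i]) = 0.
Proof. by rewrite /absr normr0. Qed.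

Lemma absr_eq0 z : (absr z == 0) = (z == 0).
Proof. by rewrite -[RHS]normr_eq0 -absrE eq_complex /= eqxx andbT. Qed.

Lemma absr_gt0 z : (0 < absr z) = (z != 0).
Proof. by rewrite lt_neqAle eq_sym absr_eq0 absr_ge0 andbT. Qed.

Lemma absrC x : absr x%:C%C = `|x|.
Proof. by rewrite /absr normc_def /= expr0n /= addr0 sqrtr_sqr. Qed.

Lemma absrJ z : absr (z^*) = absr z.
Proof. by rewrite /absr norm_conjC. Qed.

Lemma absrV z : absr z^-1 = (absr z)^-1.
Proof. by apply: absr_eq; rewrite normfV fmorphV /= absrE. Qed.

Lemma absr_sum I (s : seq I) (P : pred I) (F : I -> R[i]) :
  absr (\sum_(i <- s | P i) F i) <= \sum_(i <- s | P i) absr (F i).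
Proof.
elim/big_rec2: _ => [|i y z _ h]; first by rewrite absr0.
by apply: (le_trans (absrD _ _)); rewrite lerD2l.
Qed.

Lemma absr_sqr z : absr z ^+ 2 = complex.Re z ^+ 2 + complex.Im z ^+ 2.
Proof.
by apply: (@complexI R); rewrite add_Re2_Im2 -absrE rmorphXn.
Qed.

Lemma absr_sqrC z : (absr z ^+ 2)%:C%C = z * z^*.
Proof. by rewrite -normCK -absrE rmorphXn. Qed.

Lemma absr_Re z : `|complex.Re z| <= absr z.
Proof.
rewrite -[leRHS]ger0_norm ?absr_ge0// -ler_sqr ?nnegrE// !real_normK ?num_real//.
by rewrite absr_sqr lerDl sqr_ge0.
Qed.

Lemma absr_Im z : `|complex.Im z| <= absr z.
Proof.
rewrite -[leRHS]ger0_norm ?absr_ge0// -ler_sqr ?nnegrE// !real_normK ?num_real//.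
by rewrite absr_sqr lerDr sqr_ge0.
Qed.

Lemma absr_ReIm z : absr z <= `|complex.Re z| + `|complex.Im z|.
Proof.
rewrite -[leLHS]ger0_norm ?absr_ge0// -[leRHS]ger0_norm ?addr_ge0//.
rewrite -ler_sqr ?nnegrE// !real_normK ?num_real// absr_sqr.
rewrite sqrrD !real_normK ?num_real// addrAC lerDl.
by rewrite mulrn_wge0 ?mulr_ge0.
Qed.

Lemma conjC_conjc z : z^* = (z^*)%C.
Proof. by []. Qed.

Lemma ReB z w : complex.Re (z - w) = complex.Re z - complex.Re w.
Proof. by case: z w => [a b] [c d]. Qed.

Lemma ImB z w : complex.Im (z - w) = complex.Im z - complex.Im w.
Proof. by case: z w => [a b] [c d]. Qed.

Lemma absr_dist z w v : absr (z - v) <= absr (z - w) + absr (w - v).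
Proof. by apply: le_trans (absrD _ _); rewrite addrA subrK. Qed.

End modulus.

Section inner_product.
Context {R : realType} {H : completeNormedModType R[i]}.
Variable X : cyclic_operator H.
Implicit Types (u v w : H) (a : R[i]).

Definition hnorm v : R := complex.Re `|v|.

Lemma hnormE v : (hnorm v)%:C%C = `|v|.
Proof. by rewrite /hnorm RRe_real. Qed.

Lemma hnorm_ge0 v : 0 <= hnorm v.
Proof. by rewrite -ler0c hnormE. Qed.

Lemma hnormZ a v : hnorm (a *: v) = absr a * hnorm v.
Proof.
by apply: (@complexI R); rewrite hnormE rmorphM /= hnormE absrE normrZ.
Qed.

Lemma hnormD u v : hnorm (u + v) <= hnorm u + hnorm v.
Proof. by rewrite -lecR rmorphD /= !hnormE ler_normD. Qed.

Lemma hnormN v : hnorm (- v) = hnorm v.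
Proof. by rewrite /hnorm normrN. Qed.

Lemma hnorm_eq0 v : (hnorm v == 0) = (v == 0).
Proof. by rewrite -[RHS]normr_eq0 -hnormE eq_complex /= eqxx andbT. Qed.

Lemma hnorm0 : hnorm 0 = 0.
Proof. by apply/eqP; rewrite hnorm_eq0. Qed.

Lemma ipDr u v w : ip X u (v + w) = ip X u v + ip X u w.
Proof. exact: linearDl. Qed.

Lemma ipZr a u v : ip X u (a *: v) = a * ip X u v.
Proof. by rewrite /ip linearZl_LR. Qed.

Lemma ipC u v : ip X u v = (ip X v u)^*.
Proof. by rewrite /ip hermC /= expr0 mul1r. Qed.

Lemma ipNr u v : ip X u (- v) = - ip X u v.
Proof. exact: linearNl. Qed.

Lemma ipBr u v w : ip X u (v - w) = ip X u v - ip X u w.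
Proof. by rewrite ipDr ipNr. Qed.

Lemma ip0r u : ip X u 0 = 0.
Proof. exact: linear0l. Qed.

Lemma ip0l u : ip X 0 u = 0.
Proof. by rewrite ipC ip0r conjC0. Qed.

Lemma ipDl u v w : ip X (u + v) w = ip X u w + ip X v w.
Proof. by rewrite ipC ipDr rmorphD /= -!ipC. Qed.

Lemma ipBl u v w : ip X (u - v) w = ip X u w - ip X v w.
Proof. by rewrite ipC ipBr rmorphB /= -!ipC. Qed.

Lemma ipZl a u v : ip X (a *: u) v = a^* * ip X u v.
Proof. by rewrite ipC ipZr rmorphM /= -ipC. Qed.

Lemma ip_sumr I (s : seq I) (P : pred I) (F : I -> H) u :
  ip X u (\sum_(i <- s | P i) F i) = \sum_(i <- s | P i) ip X u (F i).
Proof.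
elim/big_rec2: _ => [|i y z _ h]; first by rewrite ip0r.
by rewrite ipDr h.
Qed.

Lemma ip_suml I (s : seq I) (P : pred I) (F : I -> H) u :
  ip X (\sum_(i <- s | P i) F i) u = \sum_(i <- s | P i) ip X (F i) u.
Proof.
elim/big_rec2: _ => [|i y z _ h]; first by rewrite ip0l.
by rewrite ipDl h.
Qed.

Lemma ip_hnorm v : ip X v v = (hnorm v ^+ 2)%:C%C.
Proof. by rewrite /ip -normE -hnormE rmorphXn. Qed.

Lemma ip_eq0 v : ip X v v = 0 -> v = 0.
Proof.
rewrite ip_hnorm => /(@complexI R _ 0) /eqP; rewrite sqrf_eq0 hnorm_eq0.
by move/eqP.
Qed.

Lemma ip_ext u v : (forall w, ip X w u = ip X w v) -> u = v.
Proof.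
move=> h; apply/eqP; rewrite -subr_eq0; apply/eqP/ip_eq0.
by rewrite ipBr !h subrr.
Qed.

Lemma hnorm_pythagoras u v : ip X u v = 0 ->
  hnorm (u + v) ^+ 2 = hnorm u ^+ 2 + hnorm v ^+ 2.
Proof.
move=> uv; apply: (@complexI R); rewrite rmorphD /= -!ip_hnorm.
by rewrite ipDr !ipDl uv [ip X v u]ipC uv conjC0 addr0 add0r.
Qed.

Lemma hnorm_parallelogram u v :
  hnorm (u + v) ^+ 2 + hnorm (u - v) ^+ 2 = 2 * (hnorm u ^+ 2 + hnorm v ^+ 2).
Proof.
apply: (@complexI R).
have -> : (2 * (hnorm u ^+ 2 + hnorm v ^+ 2))%:C%C =
    2 * ((hnorm u ^+ 2)%:C%C + (hnorm v ^+ 2)%:C%C) :> R[i].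
  by rewrite rmorphM /= rmorph_nat rmorphD.
rewrite rmorphD /= -!ip_hnorm !(ipBr, ipBl, ipDr, ipDl); ring.
Qed.

End inner_product.

Section span.
Context {R : realType} {H : completeNormedModType R[i]}.
Variable X : cyclic_operator H.
Implicit Types (u v w : H) (a : R[i]) (E F : set H).

Lemma span_gen E v : E v -> lin_span E v.
Proof.
move=> Ev; exists 1%N, (fun=> 1), (fun=> v); split=> //.
by rewrite big_ord_recl big_ord0 addr0 scale1r.
Qed.

Lemma span_comb E a u v :
  lin_span E u -> lin_span E v -> lin_span E (a *: u + v).
Proof.
move=> [n [c [x [Ex ->]]]] [m [d [y [Ey ->]]]].
exists (n + m)%N, (fun k => match fintype.split k with inl i => a * c i | inr j => d j end),
  (fun k => match fintype.split k with inl i => x i | inr j => y j end); split.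
  by move=> k; case: (fintype.split k).
rewrite big_split_ord /= scaler_sumr; congr (_ + _); apply: eq_bigr => i _.
  by rewrite (unsplitK (inl i)) scalerA.
by rewrite (unsplitK (inr i)).
Qed.

Lemma span0 E : lin_span E 0.
Proof.
by exists 0%N, (fun=> 0), (fun=> 0); split=> [[]//|]; rewrite big_ord0.
Qed.

Lemma spanZ E a u : lin_span E u -> lin_span E (a *: u).
Proof. by move=> Eu; rewrite -[_ *: _]addr0; apply: span_comb => //; exact: span0. Qed.

Lemma spanD E u v : lin_span E u -> lin_span E v -> lin_span E (u + v).
Proof. by move=> Eu Ev; rewrite -[u]scale1r; exact: span_comb. Qed.

Lemma spanB E u v : lin_span E u -> lin_span E v -> lin_span E (u - v).
Proof. by move=> Eu Ev; rewrite addrC -scaleN1r; exact: span_comb. Qed.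

Lemma span_sum E I (s : seq I) (P : pred I) (F : I -> H) :
  (forall i, P i -> lin_span E (F i)) -> lin_span E (\sum_(i <- s | P i) F i).
Proof.
by move=> EF; elim/big_rec: _ => [|i y Pi Ey]; [exact: span0|apply: spanD => //; exact: EF].
Qed.

Lemma span_ind E (Q : H -> Prop) : Q 0 ->
  (forall a u v, E u -> Q v -> Q (a *: u + v)) ->
  forall v, lin_span E v -> Q v.
Proof.
move=> Q0 Qs v [n [c [x [Ex ->]]]].
elim/big_rec: _ => // i y _ Qy; exact: Qs.
Qed.

Lemma span_mono E F v : (forall u, E u -> lin_span F u) -> lin_span E v -> lin_span F v.
Proof.
move=> EF; elim/span_ind => [|a u w /EF Fu Fw]; first exact: span0.
exact: span_comb.
Qed.

Lemma ip_span0 E u v : (forall x, E x -> ip X x u = 0) -> lin_span E v -> ip X v u = 0.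
Proof.
move=> h; elim/span_ind => [|a w y /h wu yu]; first exact: ip0l.
by rewrite ipDl ipZl wu yu mulr0 addr0.
Qed.

(** Gram-Schmidt: adjoin to the span of [s] the part of the new vector that is
    orthogonal to it. *)
Lemma orthogonal_projection (s : seq H) v :
  exists2 w, lin_span [set x | x \in s] w &
    forall u, lin_span [set x | x \in s] u -> ip X u (v - w) = 0.
Proof.
suff [w sw ws] : exists2 w, lin_span [set x | x \in s] w &
    forall x, x \in s -> ip X x (v - w) = 0.
  by exists w => // u; apply: ip_span0.
have mono y t u : lin_span [set x | x \in t] u -> lin_span [set x | x \in y :: t] u.
  by apply: span_mono => z /= zt; apply: span_gen => /=; rewrite inE zt orbT.
elim: s v => [|y s IH] v.
  by exists 0; [exact: span0|].
have [py spy orthy] := IH y; have [pv spv orthv] := IH v.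
pose z := y - py.
have [z0|zn0] := eqVneq z 0.
  exists pv; first exact: mono.
  move=> x; rewrite inE => /orP[/eqP ->|/orthv//].
  have -> : y = py by apply/eqP; rewrite -subr_eq0; exact/eqP.
  by apply: ip_span0 spy.
have zz : ip X z z != 0 by apply: contra zn0 => /eqP/ip_eq0 ->.
pose c := ip X z (v - pv) / ip X z z.
have szy : lin_span [set x | x \in y :: s] z.
  by apply: spanB; [apply: span_gen; rewrite /= mem_head|exact: mono].
exists (pv + c *: z); first by apply: spanD; [exact: mono|exact: spanZ].
have orth x : x \in s -> ip X x (v - (pv + c *: z)) = 0.
  by move=> xs; rewrite opprD addrA ipBr ipZr (orthv x)// (orthy x)// mulr0 subr0.
move=> x; rewrite inE => /orP[/eqP ->|/orth//].
rewrite -[y](subrK py) -/z ipDl [X in _ + X](ip_span0 orth spy) addr0.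
by rewrite opprD addrA ipBr ipZr /c divfK// subrr.
Qed.

End span.

(** * The scaled unitary and its finite models *)

Section operator.
Context {R : realType} {H : completeNormedModType R[i]}.
Variable X : cyclic_operator H.
Implicit Types (u v w : H) (a : R[i]).

Local Notation A := (opA X).
Local Notation A' := (opA_adj X).

Lemma rA_gt0 : 0 < rA X.
Proof. by rewrite exprn_gt0// absr_gt0 cq_neq0. Qed.

Lemma opA_comb a u v : A (a *: u + v) = a *: A u + A v.
Proof. by rewrite /opA linearP scalerDr !scalerA mulrC. Qed.

Lemma opAZ a u : A (a *: u) = a *: A u.
Proof. by rewrite /opA linearZ /= !scalerA mulrC. Qed.

Lemma opAB u v : A (u - v) = A u - A v.
Proof. by rewrite /opA linearB scalerBr. Qed.

Lemma ip_opA u v : ip X (A u) (A v) = (rA X)%:C%C * ip X u v.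
Proof.
by rewrite /opA ipZl ipZr {1}/ip opV_isometry -/(ip X u v) /rA absr_sqrC; ring.
Qed.

Lemma hnorm_opA v : hnorm (A v) ^+ 2 = rA X * hnorm v ^+ 2.
Proof. by apply: (@complexI R); rewrite [in RHS]rmorphM /= -!(ip_hnorm X) ip_opA. Qed.

Lemma ip_adj u v : ip X u (A v) = ip X (A' u) v.
Proof. exact: opA_adjP. Qed.

Lemma opA_surj v : exists u, A u = v.
Proof.
have [u uv] := opV_surjective X ((cq X)^-1 *: v).
by exists u; rewrite /opA uv scalerA divff ?scale1r// cq_neq0.
Qed.

Lemma adj_opA v : A' (A v) = (rA X)%:C%C *: v.
Proof.
apply: (ip_ext (X := X)) => w.
by rewrite ipC -ip_adj ip_opA rmorphM /= -ipC ipZr conjC_conjc conjc_real.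
Qed.

Lemma opA_adj_eq v : A (A' v) = (rA X)%:C%C *: v.
Proof. by have [u <-] := opA_surj v; rewrite adj_opA opAZ. Qed.

Lemma hnorm_phi : hnorm (phi X) = 1.
Proof. by rewrite /hnorm phi_unit. Qed.

Lemma spHminus_spH N v : spHminus X N v -> spH X N v.
Proof.
apply: span_mono => _ [i [j [iN [jN ->]]]].
by apply: span_gen; exists i, j; split=> //; exact: ltnW.
Qed.

Lemma spHplus_spH N v : spHplus X N v -> spH X N v.
Proof.
apply: span_mono => _ [i [j [_ [iN [jN ->]]]]].
by apply: span_gen; exists i, j.
Qed.

Lemma opA_spHplus N v : spHminus X N v -> spHplus X N (A v).
Proof.
move: v; apply: span_ind => [|a u v [i [j [iN [jN ->]]]] Av].
  by rewrite -(scale0r 0) opAZ scale0r; exact: span0.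
rewrite opA_comb; apply: span_comb => //.
by apply: span_gen; exists i.+1, j.
Qed.

Lemma opA_spH N v : spHminus X N v -> spH X N (A v).
Proof. by move=> /opA_spHplus/spHplus_spH. Qed.

Lemma moment_spHminus N i j : (i < N)%N -> (j <= N)%N -> spHminus X N (moment X i j).
Proof. by move=> iN jN; apply: span_gen; exists i, j. Qed.

Lemma moment_spH N i j : (i <= N)%N -> (j <= N)%N -> spH X N (moment X i j).
Proof. by move=> iN jN; apply: span_gen; exists i, j. Qed.

Lemma spHminusE N : spHminus X N =
  lin_span [set x | x \in [seq moment X i j | i <- iota 0 N, j <- iota 0 N.+1]].
Proof.
rewrite /spHminus; congr lin_span; apply/seteqP; split=> x.
  by move=> [i [j [iN [jN ->]]]]; apply/allpairsP; exists (i, j); rewrite !mem_iota.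
move=> /allpairsP[[i j] []]; rewrite !mem_iota !add0n !ltnS => iN jN ->.
by exists i, j.
Qed.

Lemma spH_split N v : spH X N v ->
  exists u w, [/\ spHminus X N u, spWminus X N w & v = u + w].
Proof.
move=> vN.
have [u] := orthogonal_projection X [seq moment X i j | i <- iota 0 N, j <- iota 0 N.+1] v.
rewrite -spHminusE => uN orth; exists u, (v - u); split => //; last by rewrite addrC subrK.
by split => //; apply: spanB => //; exact: spHminus_spH.
Qed.

End operator.

Section models.
Context {R : realType} {H : completeNormedModType R[i]} {X : cyclic_operator H}.
Variable Y : finite_models X.
Implicit Types (u v w : H) (a : R[i]).

Local Notation A := (opA X).

Lemma linear_from_to_in (E F : set H) (T : H -> H) v : linear_from_to E F T -> E v -> F (T v).
Proof. by case=> + _; apply. Qed.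

Lemma linear_from_to_comb (E F : set H) (T : H -> H) a u v :
  linear_from_to E F T -> E u -> E v -> T (a *: u + v) = a *: T u + T v.
Proof. by case=> _; apply. Qed.

(** On [H_N^-] the model acts as [A], on its complement as a multiple of an isometry,
    and the two images are again orthogonal.  Hence all eigenvalues lie on the circle
    of radius [Num.sqrt (rA X)]. *)
Lemma hnorm_opAN N u : spH X N u -> hnorm (opAN Y N u) ^+ 2 = rA X * hnorm u ^+ 2.
Proof.
move=> uN; have [v [w [vN wN ->]]] := spH_split uN.
have wH : spH X N w by case: wN.
rewrite -[v in LHS]scale1r (linear_from_to_comb _ (opAN_linear Y N))//; last exact: spHminus_spH.
rewrite scale1r opAN_minus// opAN_W//.
have [UwH Uw] : spWplus X N (opU Y N w) by exact: linear_from_to_in (opU_linear Y N) wN.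
have Uww : hnorm (opU Y N w) ^+ 2 = hnorm w ^+ 2.
  by apply: (@complexI R); rewrite -!(ip_hnorm X) opU_isometry.
rewrite (@hnorm_pythagoras _ _ X (A v)); last by rewrite ipZr Uw ?mulr0//; exact: opA_spHplus.
rewrite hnorm_opA hnormZ absrC exprMn ger0_norm ?sqrtr_ge0// sqr_sqrtr ?(ltW (rA_gt0 X))//.
by rewrite Uww -mulrDr (@hnorm_pythagoras _ _ X v)//; case: wN => _; apply.
Qed.

Lemma eigvec_spH N (k : 'I_(dimH Y N)) : spH X N (eigvec k).
Proof. by rewrite -(eigvec_span Y); apply: span_gen; exists k. Qed.

Lemma hnorm_eigvec N (k : 'I_(dimH Y N)) : hnorm (eigvec k) ^+ 2 = 1.
Proof.
by apply: (@complexI R); rewrite -(ip_hnorm X) eigvec_orthonormal eqxx.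
Qed.

Lemma absr_eigval N (k : 'I_(dimH Y N)) : absr (eigval k) ^+ 2 = rA X.
Proof.
have := hnorm_opAN (eigvec_spH k).
by rewrite eigvecP hnormZ exprMn hnorm_eigvec !mulr1.
Qed.

Lemma eigval_neq0 N (k : 'I_(dimH Y N)) : eigval k != 0.
Proof.
by rewrite -absr_eq0 -sqrf_eq0 absr_eigval gt_eqF// rA_gt0.
Qed.

Lemma coef_comb N a u v (k : 'I_(dimH Y N)) :
  coef Y (a *: u + v) k = a * coef Y u k + coef Y v k.
Proof. by rewrite /coef ipDr ipZr. Qed.

Lemma coefB N u v (k : 'I_(dimH Y N)) : coef Y (u - v) k = coef Y u k - coef Y v k.
Proof. by rewrite /coef ipBr. Qed.

Lemma coef0 N (k : 'I_(dimH Y N)) : coef Y 0 k = 0.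
Proof. by rewrite /coef ip0r. Qed.

Lemma coef_sum N (P : pred 'I_(dimH Y N)) (c : 'I_(dimH Y N) -> R[i]) k :
  coef Y (\sum_(l | P l) c l *: eigvec l) k = if P k then c k else 0.
Proof.
rewrite /coef ip_sumr; under eq_bigr do rewrite ipZr eigvec_orthonormal.
have [Pk|nPk] := ifP.
  rewrite (bigD1 k)//= eqxx mulr1 big1 ?addr0// => l /andP[_ lk].
  by rewrite eq_sym (negbTE lk) mulr0.
rewrite big1// => l Pl; have [kl|kl] := eqVneq k l; last by rewrite mulr0.
by rewrite kl Pl in nPk.
Qed.

Lemma coef_expand N v : spH X N v -> v = \sum_(k < dimH Y N) coef Y v k *: eigvec k.
Proof.
rewrite -(eigvec_span Y); move: v; apply: span_ind => [|a _ v [k _ <-] vE].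
  by rewrite big1// => k _; rewrite coef0 scale0r.
under eq_bigr do rewrite coef_comb scalerDl -scalerA.
rewrite big_split /= -scaler_sumr -vE; congr (a *: _ + v).
rewrite (bigD1 k)//= big1 ?addr0 => [|l lk].
  by rewrite /coef eigvec_orthonormal eqxx scale1r.
by rewrite /coef eigvec_orthonormal (negbTE lk) scale0r.
Qed.

Lemma parseval N u v : spH X N u -> ip X u v = \sum_(k < dimH Y N) (coef Y u k)^* * coef Y v k.
Proof.
move=> uN; rewrite {1}(coef_expand uN) ip_suml.
by apply: eq_bigr => k _; rewrite ipZl.
Qed.

Lemma parseval_norm N v : spH X N v -> hnorm v ^+ 2 = \sum_(k < dimH Y N) absr (coef Y v k) ^+ 2.
Proof.
move=> vN; apply: (@complexI R); rewrite -(ip_hnorm X) (parseval _ vN) rmorph_sum /=.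
by apply: eq_bigr => k _; rewrite absr_sqrC mulrC.
Qed.

(** As long as [v] stays in [H_N^-], [A] agrees with the model and multiplies the
    eigenvector coefficients by the eigenvalues. *)
Lemma coef_opA N v (k : 'I_(dimH Y N)) : spHminus X N v ->
  coef Y (A v) k = eigval k * coef Y v k.
Proof.
move=> vN; rewrite -(opAN_minus Y vN).
move/spHminus_spH : vN; rewrite -(eigvec_span Y); move: v.
suff h v : lin_span (range (@eigvec _ _ _ Y N)) v ->
    spH X N v /\ coef Y (opAN Y N v) k = eigval k * coef Y v k.
  by move=> v /h [].
move: v; apply: span_ind => [|a _ v [l _ <-] [vN vE]].
  have T0 : opAN Y N 0 = 0.
    have := linear_from_to_comb 1 (opAN_linear Y N) (span0 _) (span0 _).
    by rewrite !scale1r addr0 => /eqP; rewrite -subr_eq subrr eq_sym => /eqP.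
  by rewrite T0 coef0 mulr0; split=> //; exact: span0.
have lN := eigvec_spH l.
split; first exact: span_comb.
rewrite (linear_from_to_comb _ (opAN_linear Y N))// !coef_comb vE eigvecP mulrDr; congr (_ + _).
rewrite /coef ipZr eigvec_orthonormal; have [->|_] := eqVneq k l; first ring.
by rewrite !mulr0.
Qed.

Lemma coef_phi N (k : 'I_(dimH Y N)) : coef Y (phi X) k = (xi k)%:C%C.
Proof. by rewrite /xi RRe_real// ger0_real// eigvec_phi. Qed.

Lemma xi_ge0 N (k : 'I_(dimH Y N)) : 0 <= xi k.
Proof. by rewrite -ler0c -coef_phi eigvec_phi. Qed.

(** The adjoint is [rA] times the inverse of [A], so it divides coefficients by the
    eigenvalues, which have constant modulus. *)
Lemma absr_coef_moment N i j (k : 'I_(dimH Y N)) : (i <= N)%N -> (j <= N)%N ->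
  absr (coef Y (moment X i j) k) = absr (eigval k) ^+ (i + j) * xi k.
Proof.
have l0 : absr (eigval k) != 0 by rewrite absr_eq0 eigval_neq0.
elim: i j => [|i IHi] j iN jN; last first.
  have -> : moment X i.+1 j = A (moment X i j) by [].
  rewrite coef_opA; last exact: moment_spHminus.
  by rewrite absrM IHi// ?(ltnW iN)// addSn exprS mulrA.
elim: j jN => [|j IHj] jN.
  by rewrite /moment /= coef_phi absrC ger0_norm ?xi_ge0// mul1r.
have := IHj (ltnW jN); rewrite !add0n => {}IHj.
have AA : A (moment X 0 j.+1) = (rA X)%:C%C *: moment X 0 j by exact: opA_adj_eq.
have := @coef_opA N (moment X 0 j.+1) k.
rewrite AA -[_ *: _]addr0 coef_comb coef0 addr0.
move=> /(_ (moment_spHminus _ (leq_ltn_trans (leq0n j) jN) jN)).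
move=> /(congr1 absr); rewrite !absrM IHj absrC ger0_norm ?(ltW (rA_gt0 X))//.
rewrite -(absr_eigval k) => e; apply: (mulfI l0); rewrite -e [_ ^+ j.+1]exprS; ring.
Qed.

(** A vanishing [xi k] would make [eigvec k] orthogonal to all the moments, which span
    [H_N].  So dividing by [xi k] in the infinity norm loses nothing. *)
Lemma xi_gt0 N (k : 'I_(dimH Y N)) : 0 < xi k.
Proof.
rewrite lt_neqAle xi_ge0 andbT eq_sym; apply/eqP => xi0.
have h v : spH X N v -> coef Y v k = 0.
  move: v; apply: span_ind => [|a _ v [i [j [iN [jN ->]]]] v0].
    by rewrite coef0.
  rewrite coef_comb v0 addr0.
  have /eqP : absr (coef Y (moment X i j) k) = 0 by rewrite absr_coef_moment// xi0 mulr0.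
  by rewrite absr_eq0 => /eqP ->; rewrite mulr0.
have := h _ (eigvec_spH k); rewrite /coef eigvec_orthonormal eqxx => /eqP.
by rewrite oner_eq0.
Qed.

Lemma muN_ge0 N (E : set R[i]) : 0 <= muN Y N E.
Proof. by apply: sumr_ge0 => k _; exact: sqr_ge0. Qed.

Lemma muNT N : muN Y N setT = 1.
Proof.
rewrite -(expr1n _ 2) -(hnorm_phi X) (@parseval_norm N); last exact: (@moment_spH _ _ _ N 0 0).
apply: eq_big => k; first by rewrite in_setT.
by rewrite coef_phi absrC ger0_norm ?xi_ge0.
Qed.

Lemma le_muN N (E F : set R[i]) : E `<=` F -> muN Y N E <= muN Y N F.
Proof.
move=> EF; rewrite /muN [leRHS](bigID (fun k => eigval k \in E)) /=.
rewrite (eq_bigl (fun k : 'I_(dimH Y N) => (eigval k \in F) && (eigval k \in E))).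
  by rewrite lerDl; apply: sumr_ge0 => k _; exact: sqr_ge0.
move=> k /=; rewrite andb_idl// => /set_mem/EF; exact: mem_set.
Qed.

Lemma muN_le1 N (E : set R[i]) : muN Y N E <= 1.
Proof. by rewrite -(muNT N); exact: le_muN. Qed.

Lemma muN_setU N (E F : set R[i]) : [disjoint E & F] ->
  muN Y N (E `|` F) = muN Y N E + muN Y N F.
Proof.
move=> /disj_setPS dEF; rewrite /muN [in LHS](bigID (fun k => eigval k \in E)) /=; congr (_ + _).
  by apply/eq_bigl => k; rewrite in_setU; case: (_ \in E) => //=; rewrite andbF.
apply/eq_bigl => k; rewrite in_setU; case: (boolP (eigval k \in E)) => //= kE.
  rewrite ?andbF; apply/esym/negbTE/negP => kF.
  by case: (dEF (eigval k)); split; exact: set_mem.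
by rewrite andbT.
Qed.

Lemma muNU_le N (E F : set R[i]) : muN Y N (E `|` F) <= muN Y N E + muN Y N F.
Proof.
have -> : E `|` F = E `|` (F `\` E) by rewrite setUDr setDv setD0.
rewrite muN_setU; last by apply/disj_setPS => l [El [_ /(_ El)]].
by rewrite lerD2l; apply: le_muN => l [].
Qed.

End models.

(** * Resolvent of the scaled unitary *)

Section real_filters.
Context {R : realType}.

Lemma expr_lt_eps (q e : R) : 0 <= q < 1 -> 0 < e ->
  exists N, forall n, (N <= n)%N -> q ^+ n < e.
Proof.
move=> /andP[q0 q1] e0.
have /cvgrPdist_lt/(_ _ e0)[N _ h] : q ^+ n @[n --> \oo] --> (0 : R).
  by apply: cvg_expr; rewrite ger0_norm.
exists N => n Nn; have := h n Nn.
by rewrite /= sub0r normrN ger0_norm// exprn_ge0.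
Qed.

Lemma le_eps (x y C : R) : (forall e, 0 < e -> x <= y + C * e) -> x <= y.
Proof.
move=> h; apply/ler_addgt0Pr => e e0.
have C1 : 0 < `|C| + 1 by rewrite ltr_wpDl.
apply: le_trans (h (e / (`|C| + 1)) (divr_gt0 e0 C1)) _.
rewrite lerD2l mulrCA ger_pMr// ler_pdivrMr// mul1r.
by rewrite (le_trans (ler_norm C))// lerDl.
Qed.

End real_filters.

Section contraction.
Context {R : realType} {H : completeNormedModType R[i]}.
Implicit Types (u v w : H) (T : H -> H).

Lemma hnorm_lt v (e : R) : (`|v| < e%:C%C) = (hnorm v < e).
Proof. by rewrite -hnormE ltcR. Qed.

Lemma complex_gt0 (e : R[i]) : 0 < e -> e = (complex.Re e)%:C%C /\ 0 < complex.Re e.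
Proof.
move=> e0; have := RRe_real (gtr0_real e0); move=> /esym ee; split => //.
by rewrite -ltcR -ee.
Qed.

Lemma hnorm_cvg (F : set_system nat) (FF : Filter F) (y : nat -> H) w :
  y @ F --> w <-> forall e : R, 0 < e -> \forall n \near F, hnorm (w - y n) < e.
Proof.
split=> [/cvgrPdist_lt h e e0|h].
  have := h e%:C%C; rewrite ltcR => /(_ e0).
  by apply: filterS => n; rewrite hnorm_lt.
apply/cvgrPdist_lt => e /complex_gt0[-> e0].
by have := h _ e0; apply: filterS => n; rewrite hnorm_lt.
Qed.

(** Picard iteration for [v |-> w + T v]. *)
Lemma contraction_solve T (q : R) : 0 <= q < 1 ->
  (forall u v, T (u - v) = T u - T v) ->
  (forall v, hnorm (T v) <= q * hnorm v) ->
  forall w, exists v, v - T v = w.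
Proof.
move=> q01 TB Tq w; have /andP[q0 q1] := q01.
pose y := fix y n := if n is m.+1 then w + T (y m) else 0.
pose C := hnorm w / (1 - q).
have q1' : 0 < 1 - q by rewrite subr_gt0.
have C0 : 0 <= C by rewrite divr_ge0 ?hnorm_ge0// ltW.
have CE : hnorm w + q * C = C by rewrite /C; field; rewrite gt_eqF.
have yC n : hnorm (y n) <= C.
  elim: n => [|n IH] /=; first by rewrite hnorm0.
  rewrite (le_trans (hnormD _ _))// -CE lerD2l (le_trans (Tq _))//.
  exact: ler_wpM2l.
have dy n m : hnorm (y n - y (n + m)%N) <= q ^+ n * C.
  elim: n => [|n IH]; first by rewrite add0n sub0r hnormN mul1r.
  rewrite addSn /= opprD addrACA subrr add0r -TB (le_trans (Tq _))// exprS -mulrA.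
  exact: ler_wpM2l.
have small e : 0 < e -> exists N, forall n, (N <= n)%N -> q ^+ n * C < e.
  move=> e0; have C1 : 0 < C + 1 by rewrite ltr_wpDl.
  have [N hN] := expr_lt_eps q01 (divr_gt0 e0 C1).
  exists N => n /hN; rewrite ltr_pdivlMr// => /(le_lt_trans _); apply.
  by rewrite ler_wpM2l ?exprn_ge0// lerDl.
have cy : cvg (y @ \oo).
  apply: cauchy_cvg; apply: cauchy_exP => e /complex_gt0[-> /small[N hN]].
  exists (y N); exists N => // n Nn; rewrite /= -ball_normE /= hnorm_lt.
  by rewrite -(subnKC Nn); apply: le_lt_trans (dy _ _) (hN _ _).
have /hnorm_cvg yl : y @ \oo --> lim (y @ \oo) by [].
set v := lim _ in yl; exists v; apply/eqP; rewrite -subr_eq0 -hnorm_eq0.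
rewrite eq_le hnorm_ge0 andbT; apply: (@le_eps _ _ _ 2) => e e0; rewrite add0r.
have [N _ hN] := yl _ e0.
have := hN N (leqnn N); have := hN N.+1 (leqnSn N); rewrite /= => h1 h2.
have -> : v - T v - w = (v - (w + T (y N))) - T (v - y N).
  by rewrite TB opprB opprD !addrA subrK [RHS]addrAC.
apply: le_trans (hnormD _ _) _; rewrite hnormN mulr_natl mulr2n; apply: lerD; first exact: ltW.
apply: le_trans (Tq _) _; rewrite -[leRHS]mul1r; apply: ler_pM => //.
- exact: hnorm_ge0.
- exact: ltW.
- exact: ltW.
Qed.

End contraction.

Section spectrum.
Context {R : realType} {H : completeNormedModType R[i]}.
Variable X : cyclic_operator H.
Implicit Types (u v w : H) (x : R[i]).

Local Notation A := (opA X).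

Lemma opAB_shift x u v : A (u - v) - x *: (u - v) = (A u - x *: u) - (A v - x *: v).
Proof.
by rewrite opAB scalerBr !opprB addrACA [RHS]addrACA [- A v - _]addrC.
Qed.

(** The inverse is obtained by choice; the lower bound makes it linear, by injectivity,
    and bounded. *)
Lemma sigmaPn x (c : R) : 0 < c ->
  (forall v, c * hnorm v <= hnorm (A v - x *: v)) ->
  (forall w, exists v, A v - x *: v = w) -> ~ sigma X x.
Proof.
move=> c0 bnd surj; apply; have [S SE] := choice surj.
have inj u v : A u - x *: u = A v - x *: v -> u = v.
  move/eqP; rewrite -subr_eq0 -opAB_shift => /eqP e.
  have := bnd (u - v); rewrite e hnorm0 pmulr_rle0// => h.
  by apply/eqP; rewrite -subr_eq0 -hnorm_eq0 eq_le h hnorm_ge0.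
have Slin : linear S.
  move=> a u v; apply: inj.
  rewrite SE opA_comb scalerDr (scalerA x) (mulrC x) -scalerA opprD addrACA -scalerBr.
  by rewrite !SE.
pose S' : {linear H -> H} := HB.pack S (GRing.isLinear.Build _ _ _ _ S Slin).
exists S'; split.
- apply: bounded_linear_continuous; apply/linear_boundedP.
  exists (c^-1)%:C%C; split; first by rewrite ger0_real// ler0c invr_ge0 ltW.
  move=> r cr v; apply: (@le_trans _ _ ((c^-1)%:C%C * `|v|)); last first.
    by rewrite ler_wpM2r// ltW.
  rewrite -!hnormE -rmorphM lecR ler_pdivlMl//= (le_trans (bnd _))//.
  by rewrite SE.
- by move=> v; apply: inj; rewrite /= SE.
- by move=> v; exact: SE.
Qed.

Lemma notin_sigma x : ~ sigma X x ->
  exists2 c : R, 0 < c & forall v, c * hnorm v <= hnorm (A v - x *: v).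
Proof.
move=> /contrapT[S [Sc Sl _]].
have /linear_boundedP/pinfty_ex_gt0[r r0 hr] :=
  continuous_linear_bounded 0 (Sc 0).
have [rE r0'] := complex_gt0 r0.
exists (complex.Re r)^-1; first by rewrite invr_gt0.
move=> v; rewrite ler_pdivrMl// -lecR rmorphM /= -rE !hnormE -{1}(Sl v).
exact: hr.
Qed.

Lemma opA_hnorm v : hnorm (A v) = Num.sqrt (rA X) * hnorm v.
Proof.
apply/eqP; rewrite -(@eqrXn2 _ 2)// ?hnorm_ge0// ?mulr_ge0 ?sqrtr_ge0 ?hnorm_ge0//.
by rewrite exprMn sqr_sqrtr ?(ltW (rA_gt0 X))// hnorm_opA.
Qed.

(** Off the circle one of [A] and [x] dominates the other, and the equation
    [A v - x v = w] is solved by Picard iteration. *)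
Lemma sigma_circle x : sigma X x -> absr x = Num.sqrt (rA X).
Proof.
set s := Num.sqrt (rA X); have s0 : 0 < s by rewrite sqrtr_gt0 rA_gt0.
have sE : s * s = rA X by rewrite -expr2 sqr_sqrtr// ltW// rA_gt0.
move=> sx; apply: contrapT => /eqP; rewrite neq_lt => /orP[xs|xs]; move: sx.
- apply: (@sigmaPn x (s - absr x)); first by rewrite subr_gt0.
    move=> v; rewrite mulrBl -opA_hnorm -hnormZ lerBlDr.
    by rewrite (le_trans _ (hnormD _ _))// subrK.
  move=> w; pose T v := (x / (rA X)%:C%C) *: opA_adj X v.
  have AT v : A (T v) = x *: v.
    by rewrite /T opAZ opA_adj_eq scalerA divfK// eq_complex /= eqxx andbT gt_eqF// rA_gt0.
  have Ainj u v : A u = A v -> u = v.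
    move=> e; have := adj_opA X u; rewrite e adj_opA => /scalerI -> //.
    by rewrite eq_complex /= eqxx andbT gt_eqF// rA_gt0.
  have [] := @contraction_solve _ _ T (absr x / s) _ _ _ ((rA X)%:C%C^-1 *: opA_adj X w).
  + by rewrite divr_ge0 ?absr_ge0 ?(ltW s0)//= ltr_pdivrMr ?mul1r.
  + move=> u v; by apply: Ainj; rewrite AT opAB !AT scalerBr.
  + move=> v; rewrite -(@ler_pM2l _ s)// -opA_hnorm AT hnormZ mulrA [s * _]mulrC.
    by rewrite divfK// gt_eqF.
  + move=> v e; exists v; rewrite -AT; have := congr1 A e.
    rewrite opAB => ->; rewrite opAZ opA_adj_eq scalerA mulVf ?scale1r//.
    by rewrite eq_complex /= eqxx andbT gt_eqF// rA_gt0.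
- have x0 : x != 0 by rewrite -absr_gt0 (lt_trans s0).
  apply: (@sigmaPn x (absr x - s)); first by rewrite subr_gt0.
    move=> v; rewrite mulrBl -opA_hnorm -hnormZ lerBlDr -(hnormN (_ - _)) opprB.
    by rewrite (le_trans _ (hnormD _ _))// subrK.
  move=> w; pose T v := x^-1 *: A v.
  have [] := @contraction_solve _ _ T (s / absr x) _ _ _ (- x^-1 *: w).
  + by rewrite divr_ge0 ?absr_ge0 ?(ltW s0)//= ltr_pdivrMr ?mul1r ?absr_gt0.
  + move=> u v; by rewrite /T opAB scalerBr.
  + by move=> v; rewrite /T hnormZ opA_hnorm absrV mulrA [_ * s]mulrC.
  + move=> v e; exists v.
    have : (- x) *: (v - T v) = w by rewrite e scaleNr scaleNr scalerN opprK scalerA divff// scale1r.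
    by move=> <-; rewrite /T scalerBr (scalerA (- x) x^-1) mulNr divff// scaleN1r opprK scaleNr addrC.
Qed.

(** The average of the identity and of [A / x], which is unitary for [x] on the
    circle: the further [x] is from the spectrum, the more it contracts. *)
Definition avg x v : H := 2^-1 *: (v + x^-1 *: A v).

(** The parallelogram law for [v] and [A v / x], which have the same norm. *)
Lemma hnorm_avg x v : absr x ^+ 2 = rA X ->
  hnorm (avg x v) ^+ 2 = hnorm v ^+ 2 - hnorm (A v - x *: v) ^+ 2 / (4 * rA X).
Proof.
move=> xr; have r0 := rA_gt0 X.
have x0 : x != 0 by rewrite -absr_eq0 -sqrf_eq0 xr gt_eqF.
have := hnorm_parallelogram X v (x^-1 *: A v).
have -> : hnorm (v - x^-1 *: A v) ^+ 2 = hnorm (A v - x *: v) ^+ 2 / rA X.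
  have -> : v - x^-1 *: A v = - x^-1 *: (A v - x *: v).
    by rewrite scalerBr (scalerA (- x^-1) x) mulNr mulVf// !scaleNr opprK scale1r addrC.
  by rewrite hnormZ absrN absrV exprMn exprVn xr mulrC.
rewrite (hnormZ _ (A v)) absrV exprMn exprVn xr hnorm_opA mulKf ?gt_eqF// => e.
rewrite /avg hnormZ exprMn absrV.
have -> : absr (2 : R[i]) = 2.
  have -> : (2 : R[i]) = (2 : R)%:C%C by rewrite rmorph_nat.
  by rewrite absrC ger0_norm.
have -> : hnorm (v + x^-1 *: A v) ^+ 2 =
    2 * (hnorm v ^+ 2 + hnorm v ^+ 2) - hnorm (A v - x *: v) ^+ 2 / rA X by rewrite -e addrK.
by field; rewrite gt_eqF.
Qed.

(** If [A - x] is bounded below then the average at [x] is a strict contraction, and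
    one minus the average is a multiple of [A - x]. *)
Lemma sigma_not_below x (c : R) : sigma X x -> 0 < c ->
  ~ (forall v, c * hnorm v <= hnorm (A v - x *: v)).
Proof.
move=> sx c0 bnd; have r0 := rA_gt0 X.
have xr : absr x ^+ 2 = rA X by rewrite sigma_circle// sqr_sqrtr// ltW.
have x0 : x != 0 by rewrite -absr_eq0 -sqrf_eq0 xr gt_eqF.
apply: (@sigmaPn x c) => // w; pose k := 1 - c ^+ 2 / (4 * rA X).
have [] := @contraction_solve _ _ (avg x) (Num.sqrt k) _ _ _ (- (x^-1 / 2) *: w).
- rewrite sqrtr_ge0 /= -[ltRHS]sqrtr1 ltr_sqrt// /k ltrBlDr ltrDl.
  by rewrite divr_gt0 ?exprn_gt0// mulr_gt0.
- move=> u v; rewrite /avg -scalerBr; congr (_ *: _).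
  by rewrite opAB scalerBr opprD addrACA.
- move=> v; rewrite -[leLHS]ger0_norm ?hnorm_ge0// -sqrtr_sqr.
  rewrite -[X in _ * X]ger0_norm ?hnorm_ge0// -sqrtr_sqr mulrC -sqrtrM ?sqr_ge0//.
  rewrite ler_wsqrtr// hnorm_avg// /k mulrBr mulr1 lerB// mulrA ler_wpM2r//.
    by rewrite invr_ge0 mulr_ge0// ltW.
  by rewrite -exprMn mulrC ler_pXn2r ?nnegrE ?hnorm_ge0 ?mulr_ge0 ?hnorm_ge0 ?(ltW c0).
- move=> v e; exists v.
  have -> : w = (- (2 * x)) *: (- (x^-1 / 2) *: w).
    by rewrite scalerA (_ : _ * _ = 1) ?scale1r//; field.
  rewrite -e /avg.
  have -> : v - 2^-1 *: (v + x^-1 *: A v) = 2^-1 *: (v - x^-1 *: A v).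
    rewrite {1}(_ : v = 2^-1 *: (2 *: v)); last by rewrite scalerA mulVf ?scale1r// pnatr_eq0.
    by rewrite -scalerBr; congr (_ *: _); rewrite scaler_nat mulr2n opprD addrACA subrr add0r.
  rewrite scalerA mulNr mulrAC divff ?pnatr_eq0// mul1r scaleNr scalerBr.
  by rewrite scalerA divff// scale1r opprB.
Qed.

End spectrum.

(** * The spectral masses and the spectrum *)

Section spectral_mass.
Context {R : realType} {H : completeNormedModType R[i]} {X : cyclic_operator H}.
Variables (Y : finite_models X).
Implicit Types (u v w : H) (x : R[i]).

Local Notation A := (opA X).

Definition moments : set H := [set v | exists i j, v = moment X i j].

Lemma moments_dense v (e : R) : 0 < e ->
  exists2 w, lin_span moments w & hnorm (v - w) < e.
Proof.
move=> e0; have e0' : 0 < e%:C%C by rewrite ltcR.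
have [] := @phi_cyclic _ _ X (ball v e%:C%C).
- by exists v; exact: ballxx.
- exact: ball_open.
move=> w [vw [P _ Pw]]; exists w; last by move: vw; rewrite -ball_normE /= hnorm_lt.
rewrite -Pw /eval2; apply: span_sum => j _; apply: span_sum => i _.
by apply: spanZ; apply: span_gen; exists i, j.
Qed.

(** At every stage a moment of degree [d] has density of modulus
    [Num.sqrt (rA X) ^+ d] with respect to [phi]. *)
Lemma moments_bounded v : lin_span moments v ->
  exists N0 (C : R), forall N, (N0 <= N)%N -> spHminus X N v /\
    forall k : 'I_(dimH Y N), absr (coef Y v k) <= C * xi k.
Proof.
move: v; apply: span_ind => [|a _ v [i [j ->]] [N0 [C hv]]].
  exists 0%N, 0 => N _; split; first exact: span0.
  by move=> k; rewrite coef0 absr0 mul0r.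
exists (maxn N0 (maxn i.+1 j)), (absr a * Num.sqrt (rA X) ^+ (i + j) + C) => N.
rewrite !geq_max => /andP[N0N /andP[iN jN]].
have [vN vk] := hv N N0N; split.
  by apply: span_comb => //; exact: moment_spHminus.
move=> k; rewrite coef_comb (le_trans (absrD _ _))// mulrDl lerD//.
rewrite absrM absr_coef_moment ?(ltnW iN)// mulrA.
suff -> : absr (eigval k) = Num.sqrt (rA X) by [].
by rewrite -(absr_eigval k) sqrtr_sqr ger0_norm// absr_ge0.
Qed.

Lemma coef_shift N x v (k : 'I_(dimH Y N)) : spHminus X N v ->
  coef Y (A v - x *: v) k = (eigval k - x) * coef Y v k.
Proof.
move=> vN; rewrite coefB coef_opA// mulrBl; congr (_ - _).
by rewrite -[_ *: _]addr0 coef_comb coef0 addr0.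
Qed.

Definition cball x (a : R) : set R[i] := [set l | absr (l - x) < a].

(** A point of the spectrum charges its neighbourhoods: otherwise [A - x] would
    be bounded below on the dense set of polynomial vectors. *)
Lemma sigma_mass (F : set_system nat) (FF : ProperFilter F) x (a : R) :
  (forall n, F [set N | (n <= N)%N]) -> sigma X x -> 0 < a ->
  ~ (forall e : R, 0 < e -> F [set N | muN Y N (cball x a) < e]).
Proof.
move=> Ftail sx a0 small; apply: (@sigma_not_below _ _ X x a) => //.
(* The squared coefficients of [v] are at most [C ^ 2] times those of [phi], so the
   ones inside the ball can be neglected. *)
have dense_bound v : lin_span moments v -> a * hnorm v <= hnorm (A v - x *: v).
  move=> /moments_bounded[N0 [C hC]].
  rewrite -(@ler_pXn2r _ 2)// ?nnegrE ?hnorm_ge0 ?mulr_ge0 ?hnorm_ge0 ?(ltW a0)//.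
  rewrite exprMn; apply: (@le_eps _ _ _ (a ^+ 2 * C ^+ 2)) => e e0.
  have [N [Ne NN0]] := filter_ex (filterI (small _ e0) (Ftail N0)).
  have [vN vk] := hC N NN0.
  rewrite (parseval_norm Y (spHminus_spH vN)).
  rewrite (parseval_norm Y (spanB (opA_spH vN) (spanZ x (spHminus_spH vN)))).
  rewrite (bigID (fun k => eigval k \in cball x a)) /= mulrDr addrC; apply: lerD.
    rewrite mulr_sumr [leRHS](bigID (fun k => eigval k \in cball x a)) /= addrC.
    apply: ler_wpDr; first by apply: sumr_ge0 => k _; exact: sqr_ge0.
    apply: ler_sum => k kx; rewrite coef_shift// absrM exprMn ler_wpM2r ?sqr_ge0//.
    rewrite ler_pXn2r ?nnegrE ?absr_ge0 ?(ltW a0)//.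
    by rewrite leNgt; apply: contra kx => ?; exact: mem_set.
  rewrite -mulrA ler_wpM2l ?sqr_ge0//.
  apply: (@le_trans _ _ (C ^+ 2 * muN Y N (cball x a))); last first.
    by rewrite ler_wpM2l ?sqr_ge0// ltW.
  rewrite /muN mulr_sumr; apply: ler_sum => k _; rewrite -exprMn.
  rewrite ler_pXn2r ?nnegrE ?absr_ge0//; last exact: le_trans (absr_ge0 _) (vk k).
move=> v; apply: (@le_eps _ _ _ (a + Num.sqrt (rA X) + absr x)) => e e0.
have [w /dense_bound wb vw] := moments_dense v e0.
have vE : v = w + (v - w) by rewrite addrC subrK.
apply: (@le_trans _ _ (a * hnorm w + a * e)).
  rewrite -mulrDr ler_wpM2l ?(ltW a0)// {1}vE (le_trans (hnormD _ _))// lerD2l.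
  exact: ltW.
have h : hnorm (A w - x *: w) <= hnorm (A v - x *: v) + (Num.sqrt (rA X) + absr x) * e.
  have -> : A w - x *: w = (A v - x *: v) - (A (v - w) - x *: (v - w)).
    by rewrite opAB_shift opprB [RHS]addrC subrK.
  rewrite (le_trans (hnormD _ _))// lerD2l hnormN (le_trans (hnormD _ _))// hnormN.
  rewrite hnormZ opA_hnorm -mulrDl ler_wpM2l ?(ltW vw)//.
  by rewrite addr_ge0 ?sqrtr_ge0 ?absr_ge0.
have -> : (a + Num.sqrt (rA X) + absr x) * e = (Num.sqrt (rA X) + absr x) * e + a * e by ring.
by rewrite addrA lerD2r (le_trans wb).
Qed.

Lemma avg_coef N x v (k : 'I_(dimH Y N)) : spHminus X N v ->
  coef Y (avg X x v) k = 2^-1 * (1 + x^-1 * eigval k) * coef Y v k.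
Proof.
move=> vN; rewrite /avg -[_ *: _]addr0 coef_comb coef0 addr0 -mulrA; congr (_ * _).
by rewrite addrC coef_comb coef_opA// mulrDl mul1r mulrA addrC.
Qed.

Lemma iter_avg_spHminus x m N : (m < N)%N -> spHminus X N (iter m (avg X x) (phi X)).
Proof.
move=> mN; suff : lin_span [set v | exists2 i, (i <= m)%N & v = moment X i 0]
    (iter m (avg X x) (phi X)).
  apply: span_mono => _ [i im ->]; apply: moment_spHminus => //.
  exact: leq_ltn_trans mN.
elim: m {mN} => [|m IH]; first by apply: span_gen; exists 0%N.
rewrite iterS /avg; apply: spanZ; apply: spanD.
  by apply: span_mono IH => _ [i im ->]; apply: span_gen; exists i => //; exact: leqW.
apply: spanZ; move: IH; move: (iter _ _ _); apply: span_ind => [|a _ v [i im ->] Av].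
  by rewrite -(scale0r 0) opAZ scale0r; exact: span0.
by rewrite opA_comb; apply: span_comb => //; apply: span_gen; exists i.+1.
Qed.

(** The powers stay in the span of the moments of degree at most [m], where the model
    is exact. *)
Lemma iter_avg_coef x m N (k : 'I_(dimH Y N)) : (m <= N)%N ->
  coef Y (iter m (avg X x) (phi X)) k = (2^-1 * (1 + x^-1 * eigval k)) ^+ m * (xi k)%:C%C.
Proof.
elim: m => [|m IH] mN; first by rewrite /= coef_phi mul1r.
by rewrite iterS (avg_coef _ _ (iter_avg_spHminus _ mN)) IH ?(ltnW mN)// mulrA -exprS.
Qed.

Lemma absr_parallelogram (z w : R[i]) :
  absr (z + w) ^+ 2 + absr (z - w) ^+ 2 = 2 * (absr z ^+ 2 + absr w ^+ 2).
Proof. by case: z w => [a b] [c d]; rewrite !absr_sqr /=; ring. Qed.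

Lemma absr_avg (x l : R[i]) : x != 0 -> absr l = absr x ->
  absr (2^-1 * (1 + x^-1 * l)) ^+ 2 = 1 - absr (l - x) ^+ 2 / (4 * absr x ^+ 2).
Proof.
move=> x0 lx; have ax0 : absr x != 0 by rewrite absr_eq0.
have -> : 2^-1 * (1 + x^-1 * l) = (x + l) / (2 * x) by field.
rewrite absrM absrV absrM exprMn exprVn exprMn.
have -> : absr (2 : R[i]) = 2.
  have -> : (2 : R[i]) = (2 : R)%:C%C by rewrite rmorph_nat.
  by rewrite absrC ger0_norm.
rewrite absrB; have := absr_parallelogram x l; rewrite lx => /(canRL (addrK _)) ->.
by field.
Qed.

(** Repeated averaging at a point of the resolvent set contracts [phi] faster
    than it damps the eigenvectors with eigenvalues close to that point, which
    therefore carry almost no mass. *)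
Lemma resolvent_mass x : ~ sigma X x -> exists2 a : R, 0 < a &
  forall e : R, 0 < e -> exists N0, forall N, (N0 <= N)%N -> muN Y N (cball x a) < e.
Proof.
move=> sx; have r0 := rA_gt0 X.
have eigl N (k : 'I_(dimH Y N)) : absr (eigval k) = Num.sqrt (rA X).
  by rewrite -(absr_eigval k) sqrtr_sqr ger0_norm// absr_ge0.
have [xr|xr] := eqVneq (absr x) (Num.sqrt (rA X)); last first.
  exists `|absr x - Num.sqrt (rA X)|; first by rewrite normr_gt0 subr_eq0.
  move=> e e0; exists 0%N => N _; rewrite /muN big_pred0// => k.
  apply/negbTE/negP => /set_mem; rewrite /cball /= ltNge => /negP; apply.
  have h1 := absrD (eigval k - x) x; have h2 := absrD (x - eigval k) (eigval k).
  rewrite !subrK eigl in h1 h2; rewrite absrB in h2.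
  by rewrite ler_norml; apply/andP; split; lra.
have x0 : x != 0 by rewrite -absr_eq0 xr sqrtr_eq0 -ltNge.
have xr2 : absr x ^+ 2 = rA X by rewrite xr sqr_sqrtr// ltW.
have [c c0 bnd] := notin_sigma sx.
pose t := c ^+ 2 / (4 * rA X); have t0 : 0 < t by rewrite divr_gt0 ?exprn_gt0// mulr_gt0.
have avgle v : hnorm (avg X x v) ^+ 2 <= (1 - t) * hnorm v ^+ 2.
  rewrite hnorm_avg// mulrBl mul1r lerB// /t mulrAC ler_wpM2r//.
    by rewrite invr_ge0 mulr_ge0// ltW.
  by rewrite -exprMn ler_pXn2r ?nnegrE ?hnorm_ge0 ?mulr_ge0 ?hnorm_ge0 ?(ltW c0).
have t1 : 0 <= 1 - t.
  have := avgle (phi X); rewrite hnorm_phi expr1n mulr1.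
  exact: le_trans (sqr_ge0 _).
have iterle m : hnorm (iter m (avg X x) (phi X)) ^+ 2 <= (1 - t) ^+ m.
  elim: m => [|m IH]; first by rewrite /= hnorm_phi expr1n.
  by rewrite iterS (le_trans (avgle _))// [_ ^+ m.+1]exprS ler_wpM2l.
pose s := 1 - t / 4; have s0 : 0 < s by rewrite /s; lra.
(* [1 - t] bounds the square of the contraction factor of the average; on the ball of
   radius [c / 2] the squared modulus of its eigenvalue is at least [s > 1 - t]. *)
exists (c / 2); first by rewrite divr_gt0.
have q01 : 0 <= (1 - t) / s < 1.
  by rewrite divr_ge0 ?(ltW s0)//= ltr_pdivrMr// mul1r /s; lra.
move=> e e0; have [N0 hN0] := expr_lt_eps q01 e0.
exists N0 => N /hN0; apply: le_lt_trans.
rewrite expr_div_n ler_pdivlMr ?exprn_gt0// (le_trans _ (iterle N))//.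
have mom : spH X N (iter N (avg X x) (phi X)).
  case: N {hN0} => [|N]; first exact: (@moment_spH _ _ X 0 0 0).
  rewrite iterS /avg; apply: spanZ; apply: spanD; last apply: spanZ.
    by apply: spHminus_spH; exact: iter_avg_spHminus.
  by apply: opA_spH; exact: iter_avg_spHminus.
rewrite (parseval_norm Y mom) /muN mulr_suml.
rewrite [leRHS](bigID (fun k => eigval k \in cball x (c / 2))) /=.
apply: ler_wpDr; first by apply: sumr_ge0 => k _; exact: sqr_ge0.
apply: ler_sum => k /set_mem kx.
rewrite iter_avg_coef// absrM absrX absrC exprMn ger0_norm ?xi_ge0//.
rewrite mulrC ler_wpM2r ?sqr_ge0// -exprM mulnC exprM.
apply: lerXn2r; rewrite ?nnegrE ?sqr_ge0 ?(ltW s0)//.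
rewrite (absr_avg x0 (etrans (eigl N k) (esym xr))) /s xr2 lerB// /t.
have -> : c ^+ 2 / (4 * rA X) / 4 = (c / 2) ^+ 2 / (4 * rA X).
  by field; rewrite gt_eqF.
apply: ler_wpM2r; first by rewrite invr_ge0 mulr_ge0 ?(ltW r0).
by rewrite ler_pXn2r ?nnegrE ?absr_ge0 ?divr_ge0 ?(ltW c0)// ltW.
Qed.

End spectral_mass.

(** * Ultralimits and the mass away from the spectrum *)

Section ultrafilter_limits.
Context {R : realType} {T : Type} (F : set_system T) (FU : UltraFilter F).

(** Compactness of a segment gives a cluster point, and along an ultrafilter every
    cluster point is a limit. *)
Lemma ultra_cvg_bounded (f : T -> R) (C : R) : F [set t | `|f t| <= C] ->
  exists2 l : R, `|l| <= C & f @ F --> l.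
Proof.
move=> fC; have [l [lC cl]] : `[- C, C] `&` cluster (f @ F) !=set0.
  apply: segment_compact.
  rewrite /fmap /=; apply: filterS fC => t /=.
  by rewrite in_itv /= ler_norml.
exists l; first by move: lC; rewrite /= in_itv /= ler_norml.
move=> V lV; have [//|nV] := in_ultra_setVsetC (f @^-1` V) FU.
by have [z [? ?]] := cl (~` V) V nV lV.
Qed.

Lemma ultra_cvg_complex (f : T -> R[i]) (C : R) : F [set t | absr (f t) <= C] ->
  exists l : R[i], f @ F --> l.
Proof.
move=> fC.
have [a _ fa] : exists2 l : R, `|l| <= C & (fun t => complex.Re (f t)) @ F --> l.
  by apply: ultra_cvg_bounded; apply: filterS fC => t; exact: le_trans (absr_Re _).
have [b _ fb] : exists2 l : R, `|l| <= C & (fun t => complex.Im (f t)) @ F --> l.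
  by apply: ultra_cvg_bounded; apply: filterS fC => t; exact: le_trans (absr_Im _).
exists (Complex a b); apply/cvgrPdist_lt => e /complex_gt0[-> e0].
have e2 : 0 < complex.Re e / 2 by rewrite divr_gt0.
move: fa fb => /cvgrPdist_lt/(_ _ e2) + /cvgrPdist_lt/(_ _ e2).
apply: filterS2 => t ha hb; rewrite -absrE ltcR (le_lt_trans (absr_ReIm _))//.
by rewrite ReB ImB [ltRHS]splitr ltrD.
Qed.

End ultrafilter_limits.

Section complex_topology.
Context {R : realType}.

Lemma cvg_absr {T : Type} (F : set_system T) (FF : Filter F) (f : T -> R[i]) (l : R[i]) :
  f @ F --> l <-> forall e : R, 0 < e -> \forall t \near F, absr (l - f t) < e.
Proof.
split=> [/cvgrPdist_lt h e e0|h].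
  have := h e%:C%C; rewrite ltcR => /(_ e0).
  by apply: filterS => n; rewrite -absrE ltcR.
apply/cvgrPdist_lt => e /complex_gt0[-> e0].
by have := h _ e0; apply: filterS => n; rewrite -absrE ltcR.
Qed.

Lemma cball_open (x : R[i]) (a : R) : open (cball x a).
Proof.
have -> : cball x a = ball x a%:C%C.
  by apply/seteqP; split=> y; rewrite -ball_normE /cball /= distrC -absrE ltcR.
exact: ball_open.
Qed.

Lemma square_compact M : compact (@square R M).
Proof.
rewrite compact_ultra => F FU FS.
have [a aM Fa] : exists2 l : R, `|l| <= M%:R & @complex.Re R @ F --> l.
  by apply: ultra_cvg_bounded; apply: filterS FS => z [].
have [b bM Fb] : exists2 l : R, `|l| <= M%:R & @complex.Im R @ F --> l.
  by apply: ultra_cvg_bounded; apply: filterS FS => z [].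
exists (Complex a b); split; first by split.
have /cvg_absr h : id @ F --> Complex a b.
  apply/cvg_absr => e e0; have e2 : 0 < e / 2 by rewrite divr_gt0.
  move: Fa Fb => /cvgrPdist_lt/(_ _ e2) + /cvgrPdist_lt/(_ _ e2).
  apply: filterS2 => t ha hb; rewrite (le_lt_trans (absr_ReIm _))//.
  by rewrite ReB ImB [ltRHS]splitr ltrD.
by apply/cvg_absr => e /h.
Qed.

End complex_topology.

#[local] Instance UU_ultra_instance (R : realType) (H : completeNormedModType R[i])
  (X : cyclic_operator H) (Y : finite_models X) (Z : spectral_setting Y) :
  UltraFilter (UU Z) := UU_ultra Z.

#[local] Instance UU_proper_instance (R : realType) (H : completeNormedModType R[i])
  (X : cyclic_operator H) (Y : finite_models X) (Z : spectral_setting Y) :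
  ProperFilter (UU Z) := @ultra_proper _ _ (UU_ultra Z).

Section ultrafilter_mass.
Context {R : realType} {H : completeNormedModType R[i]} {X : cyclic_operator H}.
Context {Y : finite_models X}.
Variable Z : spectral_setting Y.

(** Divisibility of the square roots of the indices makes the ultrafilter free. *)
Lemma UU_tail m : UU Z [set N | (m <= N)%N].
Proof.
have := @UU_squares _ _ _ _ Z m.+1 isT; apply: filterS => N [N1 [s [Ns ms]]] /=.
have s0 : (0 < s)%N by move: N1; rewrite Ns; case: (s).
by rewrite Ns (leq_trans (leqnSn m))// (leq_trans (dvdn_leq s0 ms))// leq_pmulr.
Qed.

Definition vanishing (E : set R[i]) :=
  forall e : R, 0 < e -> UU Z [set N | muN Y N E < e].

Lemma vanishing_sub E E' : E `<=` E' -> vanishing E' -> vanishing E.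
Proof.
move=> EE h e /h; apply: filterS => N /=; apply: le_lt_trans; exact: le_muN.
Qed.

Lemma vanishingU E E' : vanishing E -> vanishing E' -> vanishing (E `|` E').
Proof.
move=> h h' e e0; have e2 : 0 < e / 2 by rewrite divr_gt0.
apply: filterS2 (h _ e2) (h' _ e2) => N /= h1 h2.
by rewrite (le_lt_trans (muNU_le _ _ _ _))// [ltRHS]splitr ltrD.
Qed.

Lemma vanishing0 : vanishing set0.
Proof.
move=> e e0; apply: (@filterE _ (UU Z)) => N /=.
by rewrite /muN big_pred0// => k; rewrite in_set0.
Qed.

Lemma eigval_absr N (k : 'I_(dimH Y N)) : absr (eigval k) = Num.sqrt (rA X).
Proof. by rewrite -(absr_eigval k) sqrtr_sqr ger0_norm// absr_ge0. Qed.

Lemma circle_in_square (x : R[i]) : absr x = Num.sqrt (rA X) ->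
  `|complex.Re x| < (bM Z)%:R /\ `|complex.Im x| < (bM Z)%:R.
Proof.
move=> xr; have h := bM_rA Z.
by split; apply: le_lt_trans h; rewrite -xr ?absr_Re ?absr_Im.
Qed.

Lemma eigval_sqS N (k : 'I_(dimH Y N)) : sqS Z (eigval k).
Proof. by have [/ltW ? /ltW ?] := circle_in_square (eigval_absr k). Qed.

Definition sigma_tube (e : R) : set R[i] :=
  [set l | exists2 s, sigma X s & absr (l - s) < e].

Lemma sigma_tube_nbhd e : sigma_tube e `<=` sigma_nbhd (X := X) e.
Proof.
move=> l [s ss ls]; rewrite /sigma_nbhd /= /set_dist.
apply: le_trans (ltW ls); apply: ge_inf.
  by exists 0 => _ [x [y [_ _ ->]]]; exact: absr_ge0.
by exists l, s.
Qed.

(** Every point of the square has a neighbourhood whose part outside the tube has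
    vanishing mass; finitely many of them cover the square. *)
Lemma vanishing_off_tube e : 0 < e -> vanishing (~` sigma_tube e).
Proof.
move=> e0.
have pt x : exists a : R, 0 < a /\ vanishing (cball x a `\` sigma_tube e).
  have [sx|/(resolvent_mass Y)[a a0 ha]] := pselect (sigma X x).
    exists e; split=> //; apply: vanishing_sub vanishing0 => l [lx] []; by exists x.
  exists a; split=> // d /ha[N0 hN0].
  apply: filterS (UU_tail N0) => N /hN0; apply: le_lt_trans.
  by apply: le_muN => l [].
have [a ha] := choice pt.
have := @square_compact R (bM Z); rewrite compact_cover.
move=> /(_ R[i] setT (fun x => cball x (a x))) [].
- by move=> x _; exact: cball_open.
- by move=> x _; exists x => //; rewrite /cball /= subrr absr0; have [] := ha x.
move=> D _ SD.
have : vanishing (sqS Z `\` sigma_tube e).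
  suff : vanishing (\bigcup_(x in [set` D]) (cball x (a x)) `\` sigma_tube e).
    by apply: vanishing_sub => l [Sl nl]; split=> //; exact: SD.
  rewrite bigcup_fset; elim/big_ind : _ => [|E E' hE hE'|x _].
  - by rewrite set0D; exact: vanishing0.
  - by rewrite setDUl; exact: vanishingU.
  - by have [] := ha x.
move=> h d /h; apply: filterS => N /=; apply: le_lt_trans.
rewrite /muN le_eqVlt; apply/orP; left; apply/eqP; apply: eq_bigl => k.
rewrite in_setD in_setC andb_idl// => _.
by apply: mem_set; exact: eigval_sqS.
Qed.

Lemma sigma_not_vanishing x (a : R) : sigma X x -> 0 < a -> ~ vanishing (cball x a).
Proof. by move=> sx a0; apply: sigma_mass => //; exact: UU_tail. Qed.

End ultrafilter_mass.

(** * Caratheodory measurability of rectangles *)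

Section outer_measure.
Context {R : realType} {H : completeNormedModType R[i]} {X : cyclic_operator H}.
Context {Y : finite_models X}.
Variable Z : spectral_setting Y.

Local Notation M := (bM Z).

Lemma mu_n_cvg E : muN Y N E @[N --> UU Z] --> mu_n Z E.
Proof.
have [l _ hl] : exists2 l : R, `|l| <= 1 & muN Y N E @[N --> UU Z] --> l.
  apply: ultra_cvg_bounded; apply: filterE => N /=.
  by rewrite ger0_norm ?muN_ge0 ?muN_le1.
by rewrite /mu_n /mun (cvg_lim _ hl).
Qed.

Lemma mu_n_superadditive E1 E2 E : [disjoint E1 & E2] -> E1 `|` E2 `<=` E ->
  mu_n Z E1 + mu_n Z E2 <= mu_n Z E.
Proof.
move=> d12 s12.
have h : muN Y N E1 + muN Y N E2 @[N --> UU Z] --> mu_n Z E1 + mu_n Z E2.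
  by apply: cvgD; exact: mu_n_cvg.
apply: (ler_cvg_to h (@mu_n_cvg E)).
by apply: filterE => N; rewrite /= -muN_setU//; exact: le_muN.
Qed.

Lemma le_mu_n E E' : E `<=` E' -> mu_n Z E <= mu_n Z E'.
Proof.
move=> EE; apply: (ler_cvg_to (@mu_n_cvg E) (@mu_n_cvg E')).
by apply: filterE => N; exact: le_muN.
Qed.

Lemma mu_n_le1 E : mu_n Z E <= 1.
Proof.
have h1 : (fun _ : nat => 1 : R) @ UU Z --> (1 : R) by exact: cvg_cst.
apply: (ler_cvg_to (@mu_n_cvg E) h1).
by apply: filterE => N; exact: muN_le1.
Qed.

(** The covering consists of [B] and of empty rectangles. *)
Lemma mustar_le E B : Sqstar Z B -> E `&` interior (sqS Z) `<=` B ->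
  (mustar Z E <= (mu_n Z B)%:E)%E.
Proof.
move=> BS EB; apply: ereal_inf_lbound.
exists (fun n => if n is 0%N then B else set0).
  split=> [[|n]//|l El]; first exact: Sqstar0.
  by exists 0%N => //; exact: EB.
rewrite nneseries_recl//; last by move=> n _; rewrite lee_fin mu_n_ge0.
by rewrite eseries0 ?adde0// => -[|n]// _ _; rewrite mu_n0.
Qed.

(** Small horizontal and vertical moves stay in the square. *)
Lemma interior_sqS l : interior (sqS Z) l ->
  `|complex.Re l| < M%:R /\ `|complex.Im l| < M%:R.
Proof.
rewrite /interior => /nbhs_ballP[e' /= /complex_gt0[]].
move: (complex.Re e') => e -> e0 he.
have h z : absr z < e -> sqS Z (l + z).
  by move=> ze; apply: he; rewrite -ball_normE /= opprD addrA subrr add0r normrN -absrE ltcR.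
have e2 : 0 < e / 2 by rewrite divr_gt0.
have e2e : e / 2 < e by rewrite ltr_pdivrMr// ltr_pMr// ltr1n.
have ne : absr (e / 2)%:C%C < e by rewrite absrC ger0_norm// ltW.
have ni : absr (Complex 0 (e / 2)) < e.
  by rewrite /absr normc_def /= expr0n add0r sqrtr_sqr ger0_norm// ltW.
have ne' : absr (- (e / 2)%:C%C) < e by rewrite absrN.
have ni' : absr (- Complex 0 (e / 2)) < e by rewrite absrN.
have := h _ ne; have := h _ ne'; have := h _ ni; have := h _ ni'.
case: l {he h} => a b; rewrite /sqS /square /= !ler_norml !ltr_norml.
do 4![move=> [/andP[? ?] /andP[? ?]]].
by split; apply/andP; split; lra.
Qed.

Lemma bM_gt0 : 0 < M%:R :> R.
Proof. by apply: le_lt_trans (bM_rA Z); exact: sqrtr_ge0. Qed.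

Local Notation rect_full := (rect M (- M%:R) M%:R (- M%:R) M%:R : set R[i]).

Lemma Sqstar_full : Sqstar Z rect_full.
Proof.
exists (- M%:R), M%:R, (- M%:R), M%:R; split=> //.
by split; [exact: NI_left|exact: NI_right|exact: NI_left|exact: NI_right].
Qed.

Lemma mustar_le1 E : (mustar Z E <= 1)%E.
Proof.
apply: (@le_trans _ _ (mu_n Z rect_full)%:E); last by rewrite lee_fin mu_n_le1.
apply: mustar_le; first exact: Sqstar_full.
move=> l [_ li]; split; first exact: (interior_subset li).
- by rewrite -ltr_norml; have [] := interior_sqS li.
- by rewrite -ltr_norml; have [] := interior_sqS li.
Qed.

Lemma mustar_fin E : mustar Z E \is a fin_num.
Proof. by rewrite ge0_fin_numE ?mustar_ge0// (le_lt_trans (mustar_le1 E))// ltry. Qed.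

Definition measurable_mu (E : set R[i]) := (mu_outer Z).-caratheodory E.

Lemma null_measurable E : mustar Z E = 0%E -> measurable_mu E.
Proof.
move=> E0; apply: le_caratheodory_measurable => T.
rewrite [X in (X + _)%E](_ : _ = 0%E) ?add0e; last first.
  apply/eqP; rewrite eq_le outer_measure_ge0 andbT -E0.
  exact: (@le_outer_measure _ _ (mu_outer Z) (T `&` E) E).
by apply: le_outer_measure; exact: subIsetl.
Qed.

Lemma mustar_outside E : E `&` interior (sqS Z) = set0 -> mustar Z E = 0%E.
Proof.
by move=> E0; rewrite /mustar E0 cover_ext0 ?mu_n0// => [|B]; [exact: Sqstar0|rewrite lee_fin mu_n_ge0].
Qed.

Lemma NI_between (a b : R) : a < b -> - M%:R < b -> a < M%:R -> exists c, NI Z c /\ a < c < b.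
Proof.
move=> ab Mb aM.
pose a' := Num.max a (- M%:R); pose b' := Num.min b M%:R.
have M0 := bM_gt0; have a'b' : a' < b'.
  by rewrite /a' /b' gt_max !lt_min ab Mb aM/= lt_neqAle eq_sym -subr_eq0 opprK;
     rewrite -mulr2n mulrn_eq0/= gt_eqF//= ; lra.
have mS : (- M%:R) <= (a' + b') / 2 <= M%:R.
  have : a' >= - M%:R by rewrite /a' le_max lexx orbT.
  have : b' <= M%:R by rewrite /b' ge_min lexx orbT.
  by move=> *; apply/andP; split; lra.
have d0 : 0 < (b' - a') / 2 by rewrite divr_gt0// subr_gt0.
have [c [NIc]] := NI_dense mS (nbhsx_ballx _ _ d0).
rewrite -ball_normE /= ltr_norml => /andP[h1 h2]; exists c; split=> //.
have : a <= a' by rewrite /a' le_max lexx.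
have : b' <= b by rewrite /b' ge_min lexx.
by move=> *; apply/andP; split; lra.
Qed.

End outer_measure.

(** The two coordinate directions are treated at once: [p] is the real or the
    imaginary part. *)
Section half_planes.
Context {R : realType} {H : completeNormedModType R[i]} {X : cyclic_operator H}.
Context {Y : finite_models X}.
Variables (Z : spectral_setting Y) (p : R[i] -> R).

Local Notation M := (bM Z).

Hypothesis p_lt : forall B c, Sqstar Z B -> NI Z c -> Sqstar Z (B `&` [set l | p l < c]).
Hypothesis p_gt : forall B c, Sqstar Z B -> NI Z c -> Sqstar Z (B `&` [set l | c < p l]).
Hypothesis p_int : forall l, interior (sqS Z) l -> `|p l| < M%:R.

(** The line is covered by a thin rectangle with sides at nice reals, whose mass is at
    most that of a strip. *)
Lemma line_null c :
  (forall d : R, 0 < d -> exists2 e, 0 < e & mu_n Z [set l | square M l /\ `|p l - c| < e] < d) ->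
  mustar Z [set l | p l = c] = 0%E.
Proof.
move=> cnice; have [cM|] := pselect (`|c| < M%:R); last first.
  move=> cM; apply: mustar_outside; apply/seteqP; split=> // l [/= lc /p_int].
  by rewrite lc.
have {cM} /andP[cM1 cM2] : - M%:R < c < M%:R by rewrite -ltr_norml.
apply/eqP; rewrite eq_le mustar_ge0 andbT; apply/lee_addgt0Pr => d d0; rewrite add0e.
have [e e0 he] := cnice _ d0.
have [a [NIa /andP[ac1 ac2]]] : exists a, NI Z a /\ c - e < a < c.
  by apply: NI_between => //; [rewrite ltrBlDr ltrDl|rewrite ltrBlDr (lt_trans cM2)// ltrDl].
have [b [NIb /andP[bc1 bc2]]] : exists b, NI Z b /\ c < b < c + e.
  by apply: NI_between => //; [rewrite ltrDl|rewrite (lt_trans cM1)// ltrDl].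
pose B := rect M (- M%:R) M%:R (- M%:R) M%:R `&` [set l | a < p l] `&` [set l | p l < b].
have SB : Sqstar Z B by apply: p_lt => //; apply: p_gt => //; exact: Sqstar_full.
apply: le_trans (mustar_le SB _) _.
  move=> l [/= lc li]; split; last by rewrite /= lc.
  split; last by rewrite /= lc.
  split; first exact: (interior_subset li).
  - by rewrite -ltr_norml; have [] := interior_sqS li.
  - by rewrite -ltr_norml; have [] := interior_sqS li.
rewrite lee_fin; apply: le_trans (ltW he); apply: le_mu_n => l [[[lS _ _] /= l1] /= l2].
by split=> //; rewrite ltr_norml; apply/andP; split; lra.
Qed.

(** Cutting the rectangles of a cover along the line gives covers of the two parts of
    the set, up to the line itself. *)
Lemma half_plane_NI c : NI Z c -> mustar Z [set l | p l = c] = 0%E ->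
  measurable_mu Z [set l | p l < c].
Proof.
pose Lc := [set l | p l < c]; pose Gc := [set l | c < p l]; pose Ec := [set l | p l = c].
move=> NIc c0; apply: le_caratheodory_measurable => T.
apply: (@le_trans _ _ (mustar Z (T `&` Lc) +
                       mustar Z (T `&` Gc))%E).
  apply: leeD => //.
  apply: (@le_trans _ _ (mustar Z (T `&` Gc) + mustar Z Ec)%E).
    apply: le_trans (outer_measureU2 (mu_outer Z) _ _).
    apply: le_outer_measure => l [Tl /negP]; rewrite -leNgt le_eqVlt => /orP[/eqP|] h.
      by right.
    by left.
  by rewrite c0 adde0.
apply: le_ereal_inf_tmp => _ [B [SB TB] <-].
apply: (@le_trans _ _ (\sum_(i <oo) (mu_n Z (B i `&` Lc))%:E +
                       \sum_(i <oo) (mu_n Z (B i `&` Gc))%:E)%E).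
  apply: leeD; apply: ereal_inf_lbound.
    exists (fun i => B i `&` Lc) => //; split=> [i|]; first exact: p_lt.
    by move=> l [[Tl lc] li]; have [i _ Bi] := TB l (conj Tl li); exists i.
  exists (fun i => B i `&` Gc) => //; split=> [i|]; first exact: p_gt.
  by move=> l [[Tl lc] li]; have [i _ Bi] := TB l (conj Tl li); exists i.
rewrite -nneseriesD; try by move=> i _ _; rewrite lee_fin mu_n_ge0.
apply: lee_nneseries => [i _ _|i _]; first by rewrite adde_ge0// lee_fin mu_n_ge0.
rewrite -EFinD lee_fin; apply: mu_n_superadditive.
  apply/disj_setPS => l [[_ /= h1] [_ /= h2]].
  by have := lt_trans h1 h2; rewrite ltxx.
by move=> l [] [].
Qed.

Hypothesis NI_line : forall c, NI Z c -> mustar Z [set l | p l = c] = 0%E.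

(** Half-planes are countable unions of half-planes bounded by nice lines, up to a set
    outside the interior of the square. *)
Lemma half_plane c : measurable_mu Z [set l | p l < c].
Proof.
have [cM|Mc] := leP c (- M%:R).
  apply: null_measurable; apply: mustar_outside; apply/seteqP; split=> // l [/= lc /p_int].
  by rewrite ltr_norml => /andP[h _]; have := lt_trans h lc; rewrite ltNge cM.
(* Points beyond the border of the square cannot be separated from [c] by a nice real. *)
pose W := [set l : R[i] | p l < c /\ M%:R <= p l].
have W0 : measurable_mu Z W.
  apply: null_measurable; apply: mustar_outside; apply/seteqP; split=> // l [/= [_ lc] /p_int].
  by rewrite ltr_norml => /andP[_]; rewrite ltNge lc.
have /countable_injP[f finj] : countable [set t | NI Z t /\ t < c].
  by apply: sub_countable (NI_countable Z); apply: subset_card_le => t [].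
pose F n := [set l | exists t, [/\ NI Z t, t < c, f t = n & p l < t]].
have -> : [set l | p l < c] = \bigcup_n F n `|` W.
  apply/seteqP; split=> [l /= lc|l []].
  - have [Ml|lM] := leP M%:R (p l); first by right.
    have [t [NIt /andP[lt tc]]] : exists t, NI Z t /\ p l < t < c by exact: NI_between.
    by left; exists (f t) => //; exists t.
  - by move=> [n _ [t [NIt tc _]]] /= lt; exact: lt_trans tc.
  - by case.
apply: caratheodory_measurable_setU => //; apply: caratheodory_measurable_bigcup => n.
have [[t [NIt tc ftn]]|no] := pselect (exists t, [/\ NI Z t, t < c & f t = n]); last first.
  rewrite (_ : F n = set0); first exact: caratheodory_measurable_set0.
  by apply/seteqP; split=> // l [t [? ? ? _]]; case: no; exists t.
rewrite (_ : F n = [set l | p l < t]); first by apply: half_plane_NI => //; exact: NI_line.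
apply/seteqP; split=> [l [t' [NIt' t'c ft' lt]]|l lt]; last by exists t.
have <- : t' = t by apply: finj; [exact: mem_set|exact: mem_set|rewrite ftn].
exact: lt.
Qed.

End half_planes.

Section nice_lines.
Context {R : realType} {H : completeNormedModType R[i]} {X : cyclic_operator H}.
Context {Y : finite_models X}.
Variable Z : spectral_setting Y.

Local Notation M := (bM Z).

Let NI_min a c : NI Z a -> NI Z c -> NI Z (Num.min a c).
Proof. by move=> ? ?; rewrite /Num.min; case: ifP. Qed.

Let NI_max a c : NI Z a -> NI Z c -> NI Z (Num.max a c).
Proof. by move=> ? ?; rewrite /Num.max; case: ifP. Qed.

Let Re_lt B c : Sqstar Z B -> NI Z c -> Sqstar Z (B `&` [set l | complex.Re l < c]).
Proof.
move=> [r0 [r1 [r2 [r3 [[h0 h1 h2 h3] ->]]]]] hc.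
exists r0, (Num.min r1 c), r2, r3; split; first by split=> //; exact: NI_min.
apply/seteqP; split=> l.
  by move=> [[? /andP[? ?] ?] /= ?]; split=> //; rewrite lt_min; apply/and3P.
by move=> [? + ?]; rewrite lt_min => /and3P[? ? ?]; split => //; split=> //; apply/andP.
Qed.

Let Re_gt B c : Sqstar Z B -> NI Z c -> Sqstar Z (B `&` [set l | c < complex.Re l]).
Proof.
move=> [r0 [r1 [r2 [r3 [[h0 h1 h2 h3] ->]]]]] hc.
exists (Num.max r0 c), r1, r2, r3; split; first by split=> //; exact: NI_max.
apply/seteqP; split=> l.
  by move=> [[? /andP[? ?] ?] /= ?]; split=> //; rewrite gt_max -andbA; apply/and3P.
by move=> [? + ?]; rewrite gt_max -andbA => /and3P[? ? ?]; split => //; split=> //; apply/andP.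
Qed.

Let Im_lt B c : Sqstar Z B -> NI Z c -> Sqstar Z (B `&` [set l | complex.Im l < c]).
Proof.
move=> [r0 [r1 [r2 [r3 [[h0 h1 h2 h3] ->]]]]] hc.
exists r0, r1, r2, (Num.min r3 c); split; first by split=> //; exact: NI_min.
apply/seteqP; split=> l.
  by move=> [[? ? /andP[? ?]] /= ?]; split=> //; rewrite lt_min; apply/and3P.
by move=> [? ?]; rewrite lt_min => /and3P[? ? ?]; split => //; split=> //; apply/andP.
Qed.

Let Im_gt B c : Sqstar Z B -> NI Z c -> Sqstar Z (B `&` [set l | c < complex.Im l]).
Proof.
move=> [r0 [r1 [r2 [r3 [[h0 h1 h2 h3] ->]]]]] hc.
exists r0, r1, (Num.max r2 c), r3; split; first by split=> //; exact: NI_max.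
apply/seteqP; split=> l.
  by move=> [[? ? /andP[? ?]] /= ?]; split=> //; rewrite gt_max -andbA; apply/and3P.
by move=> [? ?]; rewrite gt_max -andbA => /and3P[? ? ?]; split => //; split=> //; apply/andP.
Qed.

Let Re_int l : interior (sqS Z) l -> `|complex.Re l| < M%:R.
Proof. by move/interior_sqS => []. Qed.

Let Im_int l : interior (sqS Z) l -> `|complex.Im l| < M%:R.
Proof. by move/interior_sqS => []. Qed.

Lemma Re_line_null c :
  (forall d : R, 0 < d -> exists2 e, 0 < e & mu_n Z (stripI M c e) < d) ->
  mustar Z [set l | complex.Re l = c] = 0%E.
Proof. exact: line_null. Qed.

Lemma Im_line_null c :
  (forall d : R, 0 < d -> exists2 e, 0 < e & mu_n Z (stripJ M c e) < d) ->
  mustar Z [set l | complex.Im l = c] = 0%E.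
Proof. exact: line_null. Qed.

Lemma Re_half_plane c : measurable_mu Z [set l | complex.Re l < c].
Proof.
apply: half_plane => // {}c /NI_nice[_ h]; apply: Re_line_null => d /h[e [e0 he _]].
by exists e.
Qed.

Lemma Im_half_plane c : measurable_mu Z [set l | complex.Im l < c].
Proof.
apply: half_plane => // {}c /NI_nice[_ h]; apply: Im_line_null => d /h[e [e0 _ he]].
by exists e.
Qed.

Lemma sqS_measurable : measurable_mu Z (sqS Z).
Proof.
rewrite -[sqS Z]setCK; apply: caratheodory_measurable_setC; apply: null_measurable.
apply: mustar_outside; apply/seteqP; split=> // l [nl] /interior_subset ll.
exact: nl.
Qed.

Lemma rect_measurable a b c d :
  mustar Z [set l | complex.Re l = a] = 0%E -> mustar Z [set l | complex.Im l = c] = 0%E ->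
  measurable_mu Z (rect M a b c d).
Proof.
move=> a0 c0.
have -> : rect M a b c d = sqS Z `&`
    (~` ([set l | complex.Re l < a] `|` [set l | complex.Re l = a]) `&`
      [set l | complex.Re l < b]) `&`
    (~` ([set l | complex.Im l < c] `|` [set l | complex.Im l = c]) `&`
      [set l | complex.Im l < d]).
  apply/seteqP; split=> l.
    move=> [Sl /andP[h1 h2] /andP[h3 h4]]; split; last first.
      by split=> // -[/=|/= e]; [rewrite ltNge (ltW h3)|rewrite e ltxx in h3].
    split => //; split=> // -[/=|/= e]; first by rewrite ltNge (ltW h1).
    by rewrite e ltxx in h1.
  have nlt (x y : R) : ~ (x < y \/ x = y) -> y < x.
    by move=> n; rewrite ltNge le_eqVlt; apply/negP => /orP[/eqP|] ?; apply: n; [right|left].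
  by move=> [[Sl [/nlt h1 h2]] [/nlt h3 h4]]; split=> //; apply/andP.
have lineRe : measurable_mu Z [set l | complex.Re l = a] by exact: null_measurable.
have lineIm : measurable_mu Z [set l | complex.Im l = c] by exact: null_measurable.
apply: caratheodory_measurable_setI; first apply: caratheodory_measurable_setI.
- exact: sqS_measurable.
- apply: caratheodory_measurable_setI; last exact: Re_half_plane.
  apply: caratheodory_measurable_setC; apply: caratheodory_measurable_setU => //.
  exact: Re_half_plane.
- apply: caratheodory_measurable_setI; last exact: Im_half_plane.
  apply: caratheodory_measurable_setC; apply: caratheodory_measurable_setU => //.
  exact: Im_half_plane.
Qed.

Definition fmu (E : set R[i]) : R := fine (mustar Z E).

Lemma fmuE E : mustar Z E = (fmu E)%:E.
Proof. by rewrite fineK// mustar_fin. Qed.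

Lemma fmu_add E E' : measurable_mu Z E -> [disjoint E & E'] -> fmu (E `|` E') = fmu E + fmu E'.
Proof.
move=> mE /disj_setPS dEE; apply: EFin_inj; rewrite EFinD -!fmuE.
rewrite [LHS](mE (E `|` E')); congr (mustar Z _ + mustar Z _)%E.
  by apply/seteqP; split=> [l []//|l El]; split=> //; left.
apply/seteqP; split=> [l [[]//]|l El]; split; first by right.
by move=> El'; apply: (dEE l).
Qed.

End nice_lines.

(** * Grids and their cells *)

Section finitely_additive.
Context {R : realType} {T : Type} {I : choiceType}.
Variables (P : set T -> Prop) (m : set T -> R).
Hypotheses (P0 : P set0) (PU : forall A B, P A -> P B -> P (A `|` B)) (m0 : m set0 = 0)
  (mU : forall A B, P A -> P B -> [disjoint A & B] -> m (A `|` B) = m A + m B).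

Lemma additive_bigsetU (s : seq I) (f : I -> set T) : uniq s ->
  (forall i, i \in s -> P (f i)) ->
  (forall i j t, f i t -> f j t -> i = j) ->
  P (\big[setU/set0]_(i <- s) f i) /\
  m (\big[setU/set0]_(i <- s) f i) = \sum_(i <- s) m (f i).
Proof.
move=> + + inj; elim: s => [|i s IH] /=; first by rewrite !big_nil.
move=> /andP[ns us] Pf.
have [|Ps ms] := IH us; first by move=> j js; apply: Pf; rewrite inE js orbT.
have Pi : P (f i) by apply: Pf; rewrite mem_head.
rewrite !big_cons; split; first exact: PU.
rewrite mU// ?ms//; apply/disj_setPS => t [fit]; rewrite -bigcup_seq => -[j /= js fjt].
by move: ns; rewrite (inj _ _ _ fit fjt) js.
Qed.

End finitely_additive.

Section grid.
Context {R : realType} {H : completeNormedModType R[i]} {X : cyclic_operator H}.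
Context {Y : finite_models X}.
Variables (Z : spectral_setting Y) (r : nat -> nat -> R) (alpha beta : R[i]).
Hypothesis Hr : grid Z r alpha beta.

Local Notation M := (bM Z).
Local Notation size_at n := (2 ^ (n + 2))%N.

Lemma grid_bound n i : (i <= size_at n)%N -> - M%:R <= r n i <= M%:R.
Proof. by move: Hr => [h _] ?; apply: h; rewrite addn1 ltnS. Qed.

Lemma grid_step n i : (i < size_at n)%N ->
  r n i < r n i.+1 /\ r n i.+1 - r n i < 2 * M%:R / n.+1%:R.
Proof. by move: Hr => [_ [h _]] /h. Qed.

Lemma grid_refine1 n i : (i <= size_at n)%N -> exists2 j, (j <= size_at n.+1)%N & r n i = r n.+1 j.
Proof.
move: Hr => [_ [_ [_ [_ [h _]]]]] iN; have [|j jN e] := h n i; first by rewrite addn1 ltnS.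
by exists j => //; move: jN; rewrite addn1 ltnS.
Qed.

Lemma grid_refine p n i : (p <= n)%N -> (i <= size_at p)%N ->
  exists2 j, (j <= size_at n)%N & r p i = r n j.
Proof.
move=> /subnK <-; elim: (n - p)%N => [|k IH] ip; first by exists i.
have [j jk ->] := IH ip; have [j' j'k ->] := grid_refine1 jk.
by exists j'.
Qed.

Lemma grid_le n i j : (i <= j <= size_at n)%N -> r n i <= r n j.
Proof.
move=> /andP[/subnK <-]; elim: (j - i)%N => [|k IH] h //.
by rewrite addSn (le_trans (IH (ltnW h)))// ltW//; case: (grid_step h).
Qed.

Lemma grid_first n : r n 0%N = - M%:R.
Proof.
elim: n => [|n IH]; first by case: Hr => _ [_ []].
have [j jn e] := grid_refine1 (leq0n (size_at n)).
apply/eqP; rewrite eq_le; have /andP[-> _] := grid_bound (leq0n (size_at n.+1)).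
by rewrite andbT -IH e grid_le.
Qed.

Lemma grid_last n : r n (size_at n) = M%:R.
Proof.
elim: n => [|n IH]; first by case: Hr => _ [_ [_ []]].
have [j jn e] := grid_refine1 (leqnn (size_at n)).
apply/eqP; rewrite eq_le; have /andP[_ ->] := grid_bound (leqnn (size_at n.+1)).
by rewrite -IH e grid_le// jn leqnn.
Qed.

Lemma grid_find n x : `|x| < M%:R ->
  (exists2 i, (i <= size_at n)%N & x = r n i) \/
  (exists2 i, (i < size_at n)%N & r n i < x < r n i.+1).
Proof.
rewrite ltr_norml => /andP[x1 x2].
have ex : exists i, (i <= size_at n)%N && (x <= r n i).
  by exists (size_at n); rewrite leqnn grid_last ltW.
case: (ex_minnP ex) => -[|m] /andP[mn xm] hm.
  by move: xm; rewrite grid_first leNgt x1.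
have [xe|xne] := eqVneq x (r n m.+1); first by left; exists m.+1.
right; exists m => //; rewrite [in X in _ && X]lt_neqAle xne xm !andbT ltNge; apply/negP => xm'.
by have := hm m; rewrite xm' (ltnW mn) ltnn => /(_ isT).
Qed.

(** No grid point lies strictly between two consecutive ones. *)
Lemma grid_between n i j x : (i < size_at n)%N -> (j <= size_at n)%N ->
  r n i < x -> x <= r n j -> r n i.+1 <= r n j.
Proof.
move=> iN jN h1 h2; apply: grid_le; rewrite jN andbT ltnNge; apply/negP => ji.
have jiN : (j <= i <= size_at n)%N by apply/andP; split=> //; exact: ltnW.
by have := lt_le_trans h1 (le_trans h2 (grid_le jiN)); rewrite ltxx.
Qed.

Lemma grid_between_inj n i j x : (i < size_at n)%N -> (j < size_at n)%N ->
  r n i < x < r n i.+1 -> r n j < x < r n j.+1 -> i = j.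
Proof.
wlog ij : i j / (i <= j)%N.
  move=> w iN jN hi hj; have [|/ltnW] := leqP i j => h; first exact: w.
  by apply/esym; exact: w.
move=> iN jN /andP[_ hi] /andP[hj _]; apply/eqP; rewrite eqn_leq ij leqNgt; apply/negP => ji.
have := lt_trans hj hi; rewrite ltNge => /negP; apply.
by apply: grid_le; rewrite ji ltnW.
Qed.

(** Coarse grid points are fine grid points, so none of them separates two points of
    the same fine interval. *)
Lemma grid_nested p n i a x y : (p <= n)%N -> (i < size_at p)%N -> (a < size_at n)%N ->
  r p i < x < r p i.+1 -> r n a < x < r n a.+1 -> r n a < y < r n a.+1 ->
  r p i < y < r p i.+1.
Proof.
move=> pn ip an /andP[h1 h2] /andP[h3 h4] /andP[h5 h6].
have [j jn e] := grid_refine pn (ltnW ip); have [k kn e'] := grid_refine pn ip.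
rewrite e e' in h1 h2 *; apply/andP; split; last first.
  by rewrite (lt_le_trans h6)//; apply: grid_between h3 (ltW h2).
rewrite (le_lt_trans _ h5)// leNgt; apply/negP => h.
have := grid_between an jn h (lexx _); rewrite leNgt => /negP; apply.
exact: lt_trans h4.
Qed.

Definition lines n : set R[i] := \bigcup_(i in [set i | (i <= size_at n)%N])
  ([set l | complex.Re l = r n i] `|` [set l | complex.Im l = r n i]).

Lemma cellP n i j l : (i < size_at n)%N -> (j < size_at n)%N ->
  cell Z r n i j l <-> (r n i < complex.Re l < r n i.+1) /\ (r n j < complex.Im l < r n j.+1).
Proof.
move=> iN jN; split=> [[]//|[h1 h2]]; split=> //.
have /andP[i1 i2] := grid_bound (ltnW iN); have /andP[j1 j2] := grid_bound (ltnW jN).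
have /andP[i1' i2'] := grid_bound iN; have /andP[j1' j2'] := grid_bound jN.
by move: h1 h2 => /andP[? ?] /andP[? ?]; split; rewrite ler_norml; apply/andP; split; lra.
Qed.

Lemma cell_inj n i j a b l : (i < size_at n)%N -> (j < size_at n)%N ->
  (a < size_at n)%N -> (b < size_at n)%N ->
  cell Z r n i j l -> cell Z r n a b l -> i = a /\ j = b.
Proof.
move=> iN jN aN bN [_ h1 h2] [_ h3 h4].
by split; [exact: grid_between_inj h1 h3|exact: grid_between_inj h2 h4].
Qed.

Lemma cell_nested p n i j a b l l' : (p <= n)%N -> (i < size_at p)%N -> (j < size_at p)%N ->
  (a < size_at n)%N -> (b < size_at n)%N ->
  cell Z r p i j l -> cell Z r n a b l -> cell Z r n a b l' -> cell Z r p i j l'.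
Proof.
move=> pn ip jp an bn [_ h1 h2] [_ h3 h4] [_ h5 h6]; apply/cellP => //.
by split; [exact: grid_nested h1 h3 h5|exact: grid_nested h2 h4 h6].
Qed.

Lemma cell_interior n i j l : (i < size_at n)%N -> (j < size_at n)%N -> cell Z r n i j l ->
  `|complex.Re l| < M%:R /\ `|complex.Im l| < M%:R.
Proof.
move=> iN jN [_ /andP[? ?] /andP[? ?]].
have /andP[i1 i2] := grid_bound (ltnW iN); have /andP[j1 j2] := grid_bound (ltnW jN).
have /andP[i1' i2'] := grid_bound iN; have /andP[j1' j2'] := grid_bound jN.
by split; rewrite ltr_norml; apply/andP; split; lra.
Qed.

(** The grid reaches the border of the square, so only its lines escape the cells. *)
Lemma cell_cover n l : `|complex.Re l| < M%:R -> `|complex.Im l| < M%:R ->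
  lines n l \/ exists i j, [/\ (i < size_at n)%N, (j < size_at n)%N & cell Z r n i j l].
Proof.
move=> /(grid_find n)[[i iN e] _|[i iN hi]]; first by left; exists i => //; left.
move=> /(grid_find n)[[j jN e]|[j jN hj]]; first by left; exists j => //; right.
by right; exists i, j; split=> //; apply/cellP.
Qed.

Lemma cell_lines n i j l : (i < size_at n)%N -> (j < size_at n)%N ->
  cell Z r n i j l -> ~ lines n l.
Proof.
have off a k x : (a < size_at n)%N -> (k <= size_at n)%N -> r n a < x < r n a.+1 -> x <> r n k.
  move=> aN kN /andP[h1 h2] e; have := grid_between aN kN h1; rewrite e => /(_ (lexx _)).
  by rewrite -e leNgt h2.
by move=> iN jN [_ h1 h2] [k kN [|]] /=; [exact: off h1|exact: off h2].
Qed.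

Lemma cell_diam n i j l l' : (i < size_at n)%N -> (j < size_at n)%N ->
  cell Z r n i j l -> cell Z r n i j l' -> absr (l - l') < 4 * M%:R / n.+1%:R.
Proof.
move=> iN jN [_ /andP[? ?] /andP[? ?]] [_ /andP[? ?] /andP[? ?]].
have [_ si] := grid_step iN; have [_ sj] := grid_step jN.
apply: le_lt_trans (absr_ReIm _) _; rewrite ReB ImB.
have -> : 4 * M%:R / n.+1%:R = 2 * M%:R / n.+1%:R + 2 * M%:R / n.+1%:R :> R by ring.
move: (2 * M%:R / n.+1%:R) si sj => t si sj.
have h1 : `|complex.Re l - complex.Re l'| < t.
  by rewrite ltr_norml; apply/andP; split; lra.
have h2 : `|complex.Im l - complex.Im l'| < t.
  by rewrite ltr_norml; apply/andP; split; lra.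
exact: ltrD.
Qed.

Lemma cell_nbhd n i j l : (i < size_at n)%N -> (j < size_at n)%N -> cell Z r n i j l ->
  exists2 a : R, 0 < a & cball l a `<=` cell Z r n i j.
Proof.
move=> iN jN [_ /andP[h1 h2] /andP[h3 h4]].
pose a := Num.min (Num.min (complex.Re l - r n i) (r n i.+1 - complex.Re l))
  (Num.min (complex.Im l - r n j) (r n j.+1 - complex.Im l)).
exists a; first by rewrite /a !lt_min !subr_gt0 h1 h2 h3 h4.
move=> l' l'a; apply/cellP => //.
have := le_lt_trans (absr_Re _) l'a; have := le_lt_trans (absr_Im _) l'a.
rewrite ReB ImB /a !lt_min !ltr_norml.
move=> /andP[/andP[/andP[? ?] /andP[? ?]] /andP[/andP[? ?] /andP[? ?]]].
by move=> /andP[/andP[/andP[? ?] /andP[? ?]] /andP[/andP[? ?] /andP[? ?]]];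
  split; apply/andP; split; lra.
Qed.

Lemma mesh_small (e : R) : 0 < e -> exists n0, forall n, (n0 <= n)%N -> 4 * M%:R / n.+1%:R < e.
Proof.
move=> e0; pose k := Num.truncn (4 * M%:R / e).
exists k => n kn; rewrite ltr_pdivrMr ?ltr0n// -ltr_pdivrMl// mulrC.
apply: lt_le_trans (truncnS_gt _) _; by rewrite ler_nat.
Qed.

Lemma lines_strips n (e : R) : 0 < e -> lines n `&` square M `<=` strips Z r n e.
Proof.
move=> e0 l [[i /= iN il] lS]; exists i; first by rewrite /= addn1 ltnS.
by case: il => /= il; [left|right]; split; rewrite // il subrr normr0.
Qed.

Lemma grid_line_null n i : (i <= size_at n)%N ->
  mustar Z [set l | complex.Re l = r n i] = 0%E /\ mustar Z [set l | complex.Im l = r n i] = 0%E.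
Proof.
move=> iN; have iN' : (i < size_at n + 1)%N by rewrite addn1 ltnS.
have [_ [_ [_ [_ [_ [_ h]]]]]] := Hr; split.
  apply: Re_line_null => d /(h n)[e [e0 _ he]]; exists e => //; apply: le_lt_trans he.
  by apply: le_mu_n => l ll; exists i => //; left.
apply: Im_line_null => d /(h n)[e [e0 _ he]]; exists e => //; apply: le_lt_trans he.
by apply: le_mu_n => l ll; exists i => //; right.
Qed.

Lemma lines_null n : mustar Z (lines n) = 0%E.
Proof.
apply/eqP; rewrite eq_le mustar_ge0 andbT /lines bigcup_mkcond.
apply: le_trans (mustar_sigma_subadditive _ _) _.
rewrite eseries0// => i _ _; case: ifPn => [/set_mem /= iN|_]; last exact: mustar0.
have [hR hI] := grid_line_null iN.
apply/eqP; rewrite eq_le mustar_ge0 andbT.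
by apply: le_trans (outer_measureU2 (mu_outer Z) _ _) _; rewrite /= hR hI adde0.
Qed.

Lemma cell_measurable n i j : (i < size_at n)%N -> (j < size_at n)%N ->
  measurable_mu Z (cell Z r n i j).
Proof.
move=> iN jN; apply: rect_measurable.
  by have [] := grid_line_null (ltnW iN).
by have [] := grid_line_null (ltnW jN).
Qed.

(** A coarse cell is, up to grid lines, the union of the fine cells it contains. *)
Lemma additive_subcells (P : set R[i] -> Prop) (m : set R[i] -> R) p n i j :
  P set0 -> (forall A B, P A -> P B -> P (A `|` B)) -> m set0 = 0 ->
  (forall A B, P A -> P B -> [disjoint A & B] -> m (A `|` B) = m A + m B) ->
  (p <= n)%N -> (i < size_at p)%N -> (j < size_at p)%N ->
  (forall a b, (a < size_at n)%N -> (b < size_at n)%N -> P (cell Z r n a b)) ->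
  P (cell Z r p i j `&` lines n) ->
  m (cell Z r p i j) =
  \sum_(ab : 'I_(size_at n) * 'I_(size_at n) | `[< cell Z r n ab.1 ab.2 `<=` cell Z r p i j >])
     m (cell Z r n ab.1 ab.2) + m (cell Z r p i j `&` lines n).
Proof.
move=> P0 PU m0 mU pn ip jp Pc Pl.
pose Q (ab : 'I_(size_at n) * 'I_(size_at n)) := `[< cell Z r n ab.1 ab.2 `<=` cell Z r p i j >].
pose s := [seq ab <- index_enum ('I_(size_at n) * 'I_(size_at n))%type | Q ab].
have [|ab _|ab cd t|Ps ms] :=
    @additive_bigsetU _ _ _ P m P0 PU m0 mU s (fun ab => cell Z r n ab.1 ab.2).
- by rewrite filter_uniq// index_enum_uniq.
- exact: Pc.
- case: ab cd => [a b] [c d] /= h1 h2.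
  have [e1 e2] := cell_inj (ltn_ord _) (ltn_ord _) (ltn_ord _) (ltn_ord _) h1 h2.
  by congr pair; exact: val_inj.
rewrite -[X in _ = X + _]big_filter -ms -mU//; last first.
  apply/disj_setPS => l [] ; rewrite -bigcup_seq => -[[a b] _ /= h] [_].
  exact: cell_lines h.
congr m; apply/seteqP; split=> [l lc|l []]; last by move=> [].
- have [lR lI] := cell_interior ip jp lc.
  have [ll|[a [b [an bn lab]]]] := cell_cover n lR lI; first by right.
  left; rewrite -bigcup_seq; exists (Ordinal an, Ordinal bn) => //=.
  rewrite mem_filter mem_index_enum andbT; apply/asboolP => /= l' l'ab.
  exact: cell_nested lc lab l'ab.
- by rewrite -bigcup_seq => -[ab /=]; rewrite mem_filter => /andP[/asboolP + _]; apply.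
Qed.

End grid.

(** * Ultralimits of cell masses *)

Section good_pairs.
Context {R : realType} {H : completeNormedModType R[i]} {X : cyclic_operator H}.
Context {Y : finite_models X}.
Variables (Z : spectral_setting Y) (r : nat -> nat -> R) (alpha beta : R[i]).
Hypothesis Hr : grid Z r alpha beta.
Variables (theta : (R[i] -> R[i]) -> R[i]) (nn : nat -> nat) (ee : nat -> R) (W : set nat).
Hypothesis Hgood : good_pair Z r theta nn ee W.

Local Notation M := (bM Z).
Local Notation size_at n := (2 ^ (n + 2))%N.

Lemma mu_fmu E : mu Z E = (fmu Z E)%:E.
Proof. exact: fmuE. Qed.

Lemma fmu_ge0 E : 0 <= fmu Z E.
Proof. by rewrite -lee_fin -fmuE mustar_ge0. Qed.

Lemma good_large m : UU Z [set N | [/\ W N, (m <= nn N)%N & (0 < nn N)%N]].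
Proof.
have [_ h [UW _] _] := Hgood.
apply: filterS2 UW (h m.+1 isT) => N WN [/= mN _]; split=> //; first exact: ltnW (ltnW mN).
exact: leq_ltn_trans mN.
Qed.

(** The mass of the strips is nonnegative and below the tolerance. *)
Lemma good_delta_gt0 N : W N -> (0 < nn N)%N -> 0 < delta Z r (nn N) N.
Proof.
have [_ _ [_ h] _] := Hgood => WN n0; have [_ _ hb _] := h N WN n0.
by apply: le_lt_trans hb; apply: sumr_ge0 => k _; exact: sqr_ge0.
Qed.

Lemma delta'_le n N i j : (i < size_at n)%N -> (j < size_at n)%N ->
  0 < fmu Z (cell Z r n i j) -> delta' Z r n N <= muN Y N (cell Z r n i j).
Proof.
move=> iN jN c0; apply: ge_inf.
  by exists 0 => _ [a [b [_ _ _ ->]]]; exact: muN_ge0.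
by exists i, j; split=> //; rewrite mu_fmu lte_fin.
Qed.

Lemma delta'_le1 n N : delta' Z r n N <= 1.
Proof.
rewrite /delta'; set D := (X in inf X); have [[d Dd]|] := pselect (exists d, D d); last first.
  move=> nD; rewrite (_ : D = set0) ?inf0//; apply/seteqP; split=> // d Dd.
  by apply: nD; exists d.
have lD : has_lbound D by exists 0 => _ [a [b [_ _ _ ->]]]; exact: muN_ge0.
apply: le_trans (ge_inf lD Dd) _; move: Dd => [a [b [_ _ _ ->]]].
exact: muN_le1.
Qed.

Lemma good_cell_gt0 N i j : W N -> (0 < nn N)%N ->
  (i < size_at (nn N))%N -> (j < size_at (nn N))%N ->
  0 < fmu Z (cell Z r (nn N) i j) -> 0 < muN Y N (cell Z r (nn N) i j).
Proof.
move=> WN n0 iN jN c0; apply: lt_le_trans (delta'_le N iN jN c0).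
by have := good_delta_gt0 WN n0; rewrite /delta pmulr_lgt0// invr_gt0.
Qed.

(** There are [K ^ 2] fine cells for [K = 2 ^ (nn N + 2)], each contributing less than
    the tolerance, which is at most [K ^ -3]; the lines contribute less than the
    tolerance once more. *)
Lemma cell_error p i j N : W N -> (0 < nn N)%N -> (p <= nn N)%N ->
  (i < size_at p)%N -> (j < size_at p)%N ->
  `|muN Y N (cell Z r p i j) - fmu Z (cell Z r p i j)| <= 2 * 2^-1 ^+ nn N.
Proof.
move=> WN n0 pn ip jp; have [_ _ [_ /(_ N WN n0)[_ _ hb hc]] _] := Hgood.
have d0 := good_delta_gt0 WN n0.
set n := nn N in n0 pn hb hc d0 *; set d := delta Z r n N in hb hc d0.
rewrite (@additive_subcells _ _ _ _ Z r alpha beta Hr (fun=> True) (muN Y N) p n)//; last 2 first.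
  by rewrite /muN big_pred0// => k; rewrite in_set0.
  by move=> A B _ _; exact: muN_setU.
have null : mustar Z (cell Z r p i j `&` lines r n) = 0%E.
  apply/eqP; rewrite eq_le mustar_ge0 andbT -(lines_null Hr n).
  by apply: le_mustar => l [].
rewrite (@additive_subcells _ _ _ _ Z r alpha beta Hr (measurable_mu Z) (fmu Z) p n)//; last 6 first.
  exact: caratheodory_measurable_set0.
  exact: caratheodory_measurable_setU.
  by rewrite /fmu mustar0.
  by move=> A B mA _; exact: fmu_add.
  by move=> a b an bn; exact: (cell_measurable Hr).
  exact: null_measurable.
rewrite [X in _ - (_ + X)](_ : _ = 0) ?addr0; last by rewrite /fmu null.
rewrite addrAC -sumrB; set K : R := (size_at n)%:R.
have K0 : 0 < K by rewrite ltr0n expn_gt0.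
apply: (@le_trans _ _ (K ^+ 2 * d + d)).
  apply: le_trans (ler_normD _ _) _; apply: lerD.
    apply: le_trans (ler_norm_sum _ _ _) _.
    apply: (@le_trans _ _ (\sum_(ab : 'I_(size_at n) * 'I_(size_at n)) d)).
      rewrite [leRHS](bigID (fun ab : 'I_(size_at n) * 'I_(size_at n) =>
        `[< cell Z r n ab.1 ab.2 `<=` cell Z r p i j >])) /=.
      apply: ler_wpDr; first by apply: sumr_ge0 => *; exact: ltW.
      by apply: ler_sum => ab _; apply: ltW; exact: hc.
    by rewrite sumr_const card_prod card_ord -mulr_natl natrM expr2.
  rewrite ger0_norm ?muN_ge0//; apply: le_trans (ltW hb); apply: le_muN => l [lc ll].
  have [h _ _ _] := Hgood; apply: (lines_strips (h N)); split=> //.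
  by case: lc.
have K1 : 1 <= K by rewrite ler1n expn_gt0.
have dE : d * K ^+ 3 <= 1.
  by rewrite /d /delta /K natrX -exprM (mulnC (n + 2)%N) divfK ?delta'_le1//.
have KE : K = 4 * 2 ^+ n by rewrite /K natrX exprD mulrC -natrX.
rewrite exprVn ler_pdivlMr ?exprn_gt0//.
apply: (@le_trans _ _ ((K ^+ 2 * d + d) * K)).
  apply: ler_wpM2l; first by apply: addr_ge0; [apply: mulr_ge0 => //; [exact: sqr_ge0|exact: ltW]|exact: ltW].
  by rewrite KE ler_peMl ?exprn_ge0// ler1n.
apply: (@le_trans _ _ (2 * (d * K ^+ 3))); last by rewrite -[leRHS]mulr1 ler_wpM2l.
have : d * K <= d * K ^+ 3 by rewrite ler_wpM2l ?(ltW d0)// ler_eXnr.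
by rewrite mulrDl => h; rewrite mulr_natl mulr2n lerD// le_eqVlt; apply/orP; left; apply/eqP; ring.
Qed.

Lemma muN_cell_cvg p i j : (i < size_at p)%N -> (j < size_at p)%N ->
  muN Y N (cell Z r p i j) @[N --> UU Z] --> fmu Z (cell Z r p i j).
Proof.
move=> ip jp; apply/cvgrPdist_lt => e e0.
have e2 : 0 < e / 2 by rewrite divr_gt0.
have h01 : 0 <= (2^-1 : R) < 1 by apply/andP; split; lra.
have [n0 hn0] := expr_lt_eps h01 e2.
apply: filterS (good_large (maxn n0 p)) => N [WN]; rewrite geq_max => /andP[n0N pN] N0 /=.
rewrite distrC (le_lt_trans (cell_error WN N0 pN ip jp))//.
by rewrite mulrC -ltr_pdivlMr// hn0.
Qed.

(** A null cell would have masses tending to zero, although it is a neighbourhood of a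
    point of the spectrum. *)
Lemma sigma_cell_gt0 p i j x : (i < size_at p)%N -> (j < size_at p)%N ->
  sigma X x -> cell Z r p i j x -> 0 < fmu Z (cell Z r p i j).
Proof.
move=> ip jp sx xc; rewrite lt_neqAle fmu_ge0 andbT; apply/eqP => c0.
have [a a0 ac] := cell_nbhd Hr ip jp xc.
apply: (sigma_not_vanishing (Z := Z) sx a0) => e e0.
have := muN_cell_cvg ip jp; rewrite -c0 => /cvgrPdist_lt/(_ e e0).
apply: filterS => N; rewrite /= sub0r normrN ger0_norm ?muN_ge0//.
by apply: le_lt_trans; exact: le_muN.
Qed.

End good_pairs.

(** * Cell averages and Dirac deltas *)

Section dirac.
Context {R : realType} {H : completeNormedModType R[i]} {X : cyclic_operator H}.
Context {Y : finite_models X}.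
Variables (Z : spectral_setting Y) (r : nat -> nat -> R) (alpha beta : R[i]).
Hypothesis Hr : grid Z r alpha beta.

Local Notation M := (bM Z).
Local Notation size_at n := (2 ^ (n + 2))%N.

Lemma near_absr (x : R[i]) (e : R) : 0 < e -> \forall t \near x, absr (x - t) < e.
Proof.
move=> e0; apply/nbhs_ballP; exists e%:C%C => /=; first by rewrite ltcR.
by move=> t; rewrite -ball_normE /= -absrE ltcR.
Qed.

Lemma Re_continuous : continuous (@complex.Re R : R[i] -> R).
Proof.
move=> x; apply/(@cvgrPdist_lt _ _ _ (nbhs x)) => e e0.
near=> t; rewrite -ReB (le_lt_trans (absr_Re _))//; near: t.
exact: near_absr.
Unshelve. all: by end_near. Qed.

Lemma Im_continuous : continuous (@complex.Im R : R[i] -> R).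
Proof.
move=> x; apply/(@cvgrPdist_lt _ _ _ (nbhs x)) => e e0.
near=> t; rewrite -ImB (le_lt_trans (absr_Im _))//; near: t.
exact: near_absr.
Unshelve. all: by end_near. Qed.

Definition cell_depth n i j (l : R[i]) : R :=
  Num.min (Num.min (complex.Re l - r n i) (r n i.+1 - complex.Re l))
          (Num.min (complex.Im l - r n j) (r n j.+1 - complex.Im l)).

Definition tent n i j (e : R) (l : R[i]) : R :=
  Num.max 0 (Num.min 1 (cell_depth n i j l / e)).

Lemma tent_continuous n i j e : continuous (tent n i j e).
Proof.
have cR a : continuous (fun l : R[i] => complex.Re l - a).
  by move=> x; exact: (cvgB (Re_continuous (x := x)) (cvg_cst a)).
have cR' a : continuous (fun l : R[i] => a - complex.Re l).
  by move=> x; exact: (cvgB (cvg_cst a) (Re_continuous (x := x))).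
have cI a : continuous (fun l : R[i] => complex.Im l - a).
  by move=> x; exact: (cvgB (Im_continuous (x := x)) (cvg_cst a)).
have cI' a : continuous (fun l : R[i] => a - complex.Im l).
  by move=> x; exact: (cvgB (cvg_cst a) (Im_continuous (x := x))).
have cd : continuous (cell_depth n i j).
  by apply: min_fun_continuous; apply: min_fun_continuous.
have c0 (a : R) : continuous (fun _ : R[i] => a) by move=> x; exact: (@cvg_cst _ a _ (nbhs x)).
apply: max_fun_continuous; first exact: c0.
apply: min_fun_continuous; first exact: c0.
by move=> x; exact: (cvgM (cd x) (cvg_cst e^-1)).
Qed.

Lemma tent_Xfunction n i j (e : R) : (i < size_at n)%N -> (j < size_at n)%N -> 0 < e ->
  Xfunction Z (cell Z r n i j) (fun l => (tent n i j e l)%:C%C).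
Proof.
move=> iN jN e0; split.
- apply: continuous_subspaceT => x; apply/(@cvg_absr _ _ (nbhs x)) => d d0.
  have /(@cvgrPdist_lt _ _ _ (nbhs x))/(_ d d0) := @tent_continuous n i j e x.
  by apply: filterS => t; rewrite -rmorphB absrC.
- move=> l _; have t0 : 0 <= tent n i j e l by rewrite /tent le_max lexx.
  by rewrite absrC ger0_norm// /tent ge_max ler01 ge_min lexx.
- move=> l lS nl; apply: (congr1 (real_complex R) (x := tent n i j e l) (y := 0)).
  apply/max_idPl; rewrite ge_min; apply/orP; right.
  rewrite pmulr_lle0 ?invr_gt0// leNgt; apply/negP => h; apply: nl; apply/(cellP Hr) => //.
  by move: h; rewrite /cell_depth !lt_min !subr_gt0 => /andP[h1 h2]; split.
Qed.

Lemma tent_inside n i j (e : R) l : 0 < e ->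
  r n i + e < complex.Re l < r n i.+1 - e ->
  r n j + e < complex.Im l < r n j.+1 - e -> tent n i j e l = 1.
Proof.
move=> e0 /andP[h1 h2] /andP[h3 h4].
rewrite /tent (min_idPl _); first by apply/max_idPr.
by rewrite ler_pdivlMr// mul1r /cell_depth !le_min; apply/andP; split; apply/andP; split; lra.
Qed.

(** Along any admissible family the values at [x] are eventually constant; the tents
    show that there is an admissible family, so the limit is determined. *)
Lemma theta_cellE x n i j : square M x -> (i < size_at n)%N -> (j < size_at n)%N ->
  theta_cell Z r (dirac_delta x) n i j = \1_(cell Z r n i j) x.
Proof.
move=> Sx iN jN; rewrite /theta_cell; set D := (X in get X).
have D1 : D (\1_(cell Z r n i j) x).
  move=> f hf; apply/cvg_absr => d d0; rewrite indicE; have [xc|xc] := boolP (x \in _).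
    have [_ /andP[h1 h2] /andP[h3 h4]] := set_mem xc.
    pose a := cell_depth n i j x.
    have a0 : 0 < a by rewrite /a /cell_depth !lt_min !subr_gt0 h1 h2 h3 h4.
    near=> e; have e0 : 0 < e by [].
    have ea : e < a by [].
    have [_ fe] := hf e e0; rewrite /dirac_delta fe; first by rewrite conjC1 (_ : true%:R = 1)// subrr absr0.
    + by move: ea; rewrite /a /cell_depth !lt_min => /andP[/andP[? ?] _]; apply/andP; split; lra.
    + by move: ea; rewrite /a /cell_depth !lt_min => /andP[_ /andP[? ?]]; apply/andP; split; lra.
  near=> e; have e0 : 0 < e by [].
  have [[_ _ f0] _] := hf e e0; rewrite /dirac_delta f0//; last first.
    by move=> xc'; move/negP: xc; apply; exact: mem_set.
  by rewrite conjC0 subr0 absr0.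
have Dget : D (get D) by apply: getPex; exists (\1_(cell Z r n i j) x).
have tentP (e : R) : 0 < e -> Xfunction Z (cell Z r n i j) (fun l => (tent n i j e l)%:C%C) /\
    forall l, r n i + e < complex.Re l < r n i.+1 - e ->
      r n j + e < complex.Im l < r n j.+1 - e -> (tent n i j e l)%:C%C = 1 :> R[i].
  move=> e0; split; first exact: tent_Xfunction.
  by move=> l h1 h2; rewrite (tent_inside e0 h1 h2).
exact: (cvg_unique _ (Dget _ tentP) (D1 _ tentP)).
Unshelve. all: by end_near. Qed.

Lemma upointE x n i j N : (i < size_at n)%N -> (j < size_at n)%N -> cell Z r n i j x ->
  upoint Z r x n N = ucell Z r n i j N.
Proof.
move=> iN jN xc; rewrite /upoint; case: pickP => [[a b] /= /set_mem xab|].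
  by have [-> ->] := cell_inj Hr iN jN (ltn_ord a) (ltn_ord b) xc xab.
by move=> /(_ (Ordinal iN, Ordinal jN)) /=; rewrite mem_set.
Qed.

Lemma uthetaE x nn N i j : square M x -> (i < size_at (nn N))%N -> (j < size_at (nn N))%N ->
  cell Z r (nn N) i j x -> 0 < fmu Z (cell Z r (nn N) i j) ->
  0 < muN Y N (cell Z r (nn N) i j) ->
  utheta Z r (dirac_delta x) nn N = ucell Z r (nn N) i j N.
Proof.
move=> Sx iN jN xc mc muc; rewrite /utheta /ucell gt_eqF//=.
have mc0 : mu Z (cell Z r (nn N) i j) != 0%E by rewrite mu_fmu eqe gt_eqF.
rewrite (bigD1 (Ordinal iN))//= (bigD1 (Ordinal jN))//=.
have off a b : (a < size_at (nn N))%N -> (b < size_at (nn N))%N -> (a != i) || (b != j) ->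
    theta_cell Z r (dirac_delta x) (nn N) a b = 0.
  move=> aN bN ab; rewrite theta_cellE// indicE; case: (boolP (x \in _)) => // /set_mem xab.
  by have [e1 e2] := cell_inj Hr iN jN aN bN xc xab; rewrite e1 e2 !eqxx in ab.
rewrite [X in _ + X]big1 ?addr0 => [|a ai]; last first.
  have ai' : (a : nat) != i by exact: ai.
  by apply: big1 => b _; apply: big1 => k _; rewrite off ?ai'// mulr0 mul0r scale0r.
rewrite [X in _ + X]big1 ?addr0 => [|b /andP[_ bj]]; last first.
  have bj' : (b : nat) != j by exact: bj.
  by apply: big1 => k _; rewrite off ?bj' ?orbT// mulr0 mul0r scale0r.
apply: eq_bigr => k _; congr (_ *: _); rewrite theta_cellE// indicE mem_set//=.
by rewrite mulr1 rmorphM fmorphV.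
Qed.

Lemma ucell_coef n i j N (k : 'I_(dimH Y N)) :
  coef Y (ucell Z r n i j N) k =
  (if eigval k \in cell Z r n i j then xi k / muN Y N (cell Z r n i j) else 0)%:C%C.
Proof.
rewrite /ucell; case: eqVneq => [->|_] /=.
  by rewrite coef0 invr0 mulr0 if_same.
by rewrite coef_sum; case: ifP.
Qed.

Lemma ucell_spH n i j N : spH X N (ucell Z r n i j N).
Proof.
rewrite /ucell; case: ifP => _; last exact: span0.
by apply: span_sum => k _; apply: spanZ; exact: eigvec_spH.
Qed.

Lemma norm0_ucell E n i j N : norm0 Y E N (ucell Z r n i j N) =
  muN Y N (E `&` cell Z r n i j) / muN Y N (cell Z r n i j).
Proof.
rewrite /norm0 {1}/muN mulr_suml; under eq_bigr do rewrite ucell_coef absrC.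
under [RHS]eq_bigl do rewrite in_setI.
rewrite [LHS](bigID (fun k => eigval k \in cell Z r n i j)) /= [X in _ + X]big1 ?addr0; last first.
  by move=> k /andP[_ /negbTE ->]; rewrite normr0 mulr0.
apply: eq_bigr => k /andP[_ ->]; rewrite ger0_norm; last by rewrite divr_ge0 ?xi_ge0 ?muN_ge0.
by rewrite mulrA expr2.
Qed.

End dirac.

(** * The pairing of the two weighted norms *)

Section weighted_norms.
Context {R : realType} {H : completeNormedModType R[i]} {X : cyclic_operator H}.
Context {Y : finite_models X}.
Implicit Types (u v w f h : H) (A : set R[i]).

Lemma norm_infty_ge0 A N v : 0 <= norm_infty Y A N v.
Proof.
apply: (big_ind (fun x : R => 0 <= x)) => // [x y x0 y0|k _].
  by rewrite le_max x0.
by rewrite mulr_ge0 ?absr_ge0// invr_ge0 xi_ge0.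
Qed.

Lemma norm_infty_coef A N v (k : 'I_(dimH Y N)) : eigval k \in A ->
  absr (coef Y v k) <= norm_infty Y A N v * xi k.
Proof.
move=> kA; rewrite -ler_pdivrMr ?xi_gt0// mulrC.
exact: (@le_bigmax_cond _ _ _ 0 k (fun k => eigval k \in A)
  (fun k : 'I_(dimH Y N) => (xi k)^-1 * absr (coef Y v k))).
Qed.

Lemma norm_infty_le A N v (c : R) : 0 <= c ->
  (forall k : 'I_(dimH Y N), eigval k \in A -> absr (coef Y v k) <= c * xi k) ->
  norm_infty Y A N v <= c.
Proof.
move=> c0 h; apply: bigmax_le => // k kA.
by rewrite mulrC ler_pdivrMr ?xi_gt0//; exact: h.
Qed.

Lemma norm0_ge0 A N v : 0 <= norm0 Y A N v.
Proof. by apply: sumr_ge0 => k _; rewrite mulr_ge0 ?xi_ge0 ?absr_ge0. Qed.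

Lemma le_norm0 A A' N v : (forall k : 'I_(dimH Y N), A (eigval k) -> A' (eigval k)) ->
  norm0 Y A N v <= norm0 Y A' N v.
Proof.
move=> AA; rewrite /norm0 [leRHS](bigID (fun k => eigval k \in A)) /=.
rewrite (eq_bigl (fun k : 'I_(dimH Y N) => (eigval k \in A') && (eigval k \in A))).
  by rewrite lerDl; apply: sumr_ge0 => k _; rewrite mulr_ge0 ?xi_ge0 ?absr_ge0.
by move=> k /=; rewrite andb_idl// => /set_mem/AA; exact: mem_set.
Qed.

(** The two weighted norms are dual to each other. *)
Lemma ip_split_bound A N f h (c C : R) : spH X N f ->
  (forall k : 'I_(dimH Y N), eigval k \in A -> absr (coef Y h k) <= c * xi k) ->
  (forall k : 'I_(dimH Y N), absr (coef Y h k) <= C * xi k) ->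
  absr (ip X f h) <= c * norm0 Y A N f + C * norm0 Y (~` A) N f.
Proof.
move=> fN hc hC; rewrite (parseval Y _ fN) (le_trans (absr_sum _ _ _))//.
rewrite (bigID (fun k => eigval k \in A)) /= /norm0 !mulr_sumr; apply: lerD.
  apply: ler_sum => k kA; rewrite absrM absrJ.
  have -> : c * (xi k * absr (coef Y f k)) = absr (coef Y f k) * (c * xi k) by ring.
  by rewrite ler_wpM2l ?absr_ge0// hc.
under [leRHS]eq_bigl do rewrite in_setC.
apply: ler_sum => k _; rewrite absrM absrJ.
have -> : C * (xi k * absr (coef Y f k)) = absr (coef Y f k) * (C * xi k) by ring.
by rewrite ler_wpM2l ?absr_ge0// hC.
Qed.

Lemma ip_bound N f h (C : R) : spH X N f ->
  (forall k : 'I_(dimH Y N), absr (coef Y h k) <= C * xi k) ->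
  absr (ip X f h) <= C * norm0 Y setT N f.
Proof.
move=> fN hC; apply: le_trans (@ip_split_bound setT N f h C C fN (fun k _ => hC k) hC) _.
rewrite setCT [X in _ + _ * X]/norm0 big_pred0 ?mulr0 ?addr0// => k.
by rewrite in_set0.
Qed.

End weighted_norms.

Section infinity_equivalence.
Context {R : realType} {H : completeNormedModType R[i]} {X : cyclic_operator H}.
Context {Y : finite_models X}.
Variable Z : spectral_setting Y.
Implicit Types (u v w f h : nat -> H).

Lemma infty_bounded_le w : infty_bounded Z w -> exists2 p : nat, (0 < p)%N &
  UU Z [set N | forall k : 'I_(dimH Y N), absr (coef Y (w N) k) <= p%:R * xi k].
Proof.
move=> [p hp]; exists p.+1 => //; apply: filterS hp => N h k.
rewrite -ler_pdivrMr ?xi_gt0// (le_trans (ltW (h k)))// ler_nat //.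
Qed.

Lemma norm_infty_eps_cvg w e : infty_bounded Z w ->
  exists l : R, norm_infty_eps Z e w = l%:E /\
    (fun N => norm_infty Y (sigma_nbhd (X := X) e) N (w N)) @ UU Z --> l.
Proof.
move=> /infty_bounded_le[p p0 hp].
have [l _ hl] : exists2 l : R, `|l| <= p%:R &
    norm_infty Y (sigma_nbhd (X := X) e) N (w N) @[N --> UU Z] --> l.
  apply: ultra_cvg_bounded; apply: filterS hp => N hN /=.
  by rewrite ger0_norm ?norm_infty_ge0//; apply: norm_infty_le.
exists l; split=> //; rewrite /norm_infty_eps; apply: cvg_lim => //.
by apply: cvg_EFin; [exact: filterE|exact: hl].
Qed.

(** The infinity seminorms decrease with the tube, so their limit is their infimum. *)
Lemma sim_infty_small u v : sim_infty Z u v -> infty_bounded Z (subu u v) /\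
  forall d : R, 0 < d -> exists2 e, 0 < e &
    UU Z [set N | norm_infty Y (sigma_nbhd (X := X) e) N (subu u v N) < d].
Proof.
rewrite /sim_infty /norm_infty_u; set w := subu u v.
case: asboolP => // wb w0; split=> // d d0.
pose g e := norm_infty_eps Z e w.
have nd : {in Interval (BRight (0 : R)) (BLeft 1) &, {homo g : a b / a <= b >-> (a <= b)%E}}.
  move=> a b _ _ ab; rewrite /g.
  have [l [-> hl]] := norm_infty_eps_cvg a wb; have [l' [-> hl']] := norm_infty_eps_cvg b wb.
  rewrite lee_fin; apply: (ler_cvg_to hl hl'); apply: filterE => N /=.
  apply: norm_infty_le => [|k /set_mem ka]; first exact: norm_infty_ge0.
  by apply: norm_infty_coef; apply: mem_set; rewrite /sigma_nbhd /=; exact: le_trans ab.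
have lt01 : (BRight (0 : R) < BLeft 1)%O by rewrite bnd_simp.
have := nondecreasing_at_right_cvge _ lt01 nd.
move=> /cvg_lim -/(_ (@ereal_hausdorff _)); rewrite w0 => inf0.
have : (0%:E < d%:E)%E by rewrite lte_fin.
rewrite [X in (X < _)%E]inf0 => /ereal_inf_lt[_ [e /= e01 <-]].
have [l [gl hl]] := norm_infty_eps_cvg e wb; rewrite /g gl lte_fin => ld.
exists e; first by move: e01; rewrite in_itv /= => /andP[].
have dl : 0 < d - l by rewrite subr_gt0.
move/cvgrPdist_lt : hl => /(_ _ dl); apply: filterS => N /=.
by rewrite distrC => /(le_lt_trans (ler_norm _)); rewrite ltrD2r.
Qed.

Lemma sim_infty_refl w : sim_infty Z w w.
Proof.
rewrite /sim_infty /norm_infty_u.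
have w0 N : subu w w N = 0 by rewrite /subu subrr.
case: asboolP => [_|nb]; last first.
  exfalso; apply: nb; exists 1%N; apply: filterE => N k /=.
  by rewrite w0 coef0 absr0 mul0r.
rewrite (_ : norm_infty_eps Z ^~ (subu w w) = fun=> 0%E) ?lim_cst//.
apply/funext => e; rewrite /norm_infty_eps.
rewrite (_ : (fun N => _) = fun=> 0%E) ?lim_cst//.
apply/funext => N; congr EFin; rewrite w0; apply/eqP; rewrite eq_le norm_infty_ge0 andbT.
by apply: norm_infty_le => // k _; rewrite coef0 absr0 mul0r.
Qed.

Definition infinitesimal_complex (x : nat -> R[i]) :=
  forall d : R, 0 < d -> UU Z [set N | absr (x N) < d].

(** Away from the spectrum [f] has no weight, close to it [u - v] is small. *)
Lemma pairing_infinitesimal f u v (C : R) :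
  UU Z [set N | spH X N (f N)] ->
  UU Z [set N | norm0 Y setT N (f N) <= C] ->
  (forall e d : R, 0 < e -> 0 < d ->
     UU Z [set N | norm0 Y (~` sigma_tube (X := X) e) N (f N) < d]) ->
  sim_infty Z u v ->
  infinitesimal_complex (fun N => ip X (f N) (subu u v N)).
Proof.
move=> fH fC ftube /sim_infty_small[/infty_bounded_le[p p0 hp] hs] d d0.
have C1 : 0 < `|C| + 1 by rewrite ltr_wpDl.
have dC : 0 < d / 2 / (`|C| + 1) by rewrite !divr_gt0.
have [e e0 he] := hs _ dC.
have dp : 0 < d / 2 / p%:R by rewrite !divr_gt0// ltr0n.
have hf := ftube e _ e0 dp.
near=> N.
have fN : spH X N (f N) by near: N; exact: fH.
have fCN : norm0 Y setT N (f N) <= C by near: N; exact: fC.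
have hpN : forall k : 'I_(dimH Y N), absr (coef Y (subu u v N) k) <= p%:R * xi k.
  by near: N; exact: hp.
have heN : norm_infty Y (sigma_nbhd (X := X) e) N (subu u v N) < d / 2 / (`|C| + 1).
  by near: N; exact: he.
have hfN : norm0 Y (~` sigma_tube (X := X) e) N (f N) < d / 2 / p%:R by near: N; exact: hf.
have := @ip_split_bound _ _ X Y (sigma_tube (X := X) e) N (f N) (subu u v N)
  (d / 2 / (`|C| + 1)) p%:R fN _ hpN.
move=> /(_ _)/le_lt_trans; apply.
  move=> k /set_mem ke; have kn : eigval k \in sigma_nbhd (X := X) e.
    by apply: mem_set; exact: sigma_tube_nbhd.
  apply: le_trans (norm_infty_coef (subu u v N) kn) _.
  by rewrite ler_wpM2r ?xi_ge0// ltW.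
rewrite [ltRHS]splitr; apply: ler_ltD; last by rewrite mulrC -ltr_pdivlMr ?ltr0n.
rewrite mulrAC ler_pdivrMr// ler_wpM2l ?divr_ge0 ?(ltW d0)//.
apply: le_trans (le_norm0 _ (A' := setT) _) _ => //; apply: le_trans fCN _.
by rewrite (le_trans (ler_norm C))// lerDl.
Unshelve. all: by end_near. Qed.

End infinity_equivalence.

Section zero_good.
Context {R : realType} {H : completeNormedModType R[i]} {X : cyclic_operator H}.
Context {Y : finite_models X}.
Variables (Z : spectral_setting Y) (Sq : nat -> set (set R[i])).
Hypothesis HSq : refinement Z Sq.

Lemma closure_near (A : set R[i]) x (d : R) : closure A x -> 0 < d ->
  exists2 y, A y & absr (x - y) < d.
Proof.
move=> cx d0; have [y [Ay xy]] := cx _ (near_absr x d0).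
by exists y.
Qed.

Lemma closure_diam (A : set R[i]) (d : R) x y :
  (forall a b, A a -> A b -> absr (a - b) <= d) -> closure A x -> closure A y ->
  absr (x - y) <= d.
Proof.
move=> Ad cx cy; apply: (@le_eps _ _ _ 2) => e e0.
have [a Aa xa] := closure_near cx e0; have [b Ab yb] := closure_near cy e0.
have h1 := absr_dist x a y; have h2 := absr_dist a b y; have h3 := Ad a b Aa Ab.
by rewrite absrB in yb; lra.
Qed.

(** For a mesh below half the width of the tube, the cells that come close to the
    spectrum form a good family, and they stay inside the tube. *)
Lemma zero_good_off_tube f : sigma X !=set0 -> zero_good Z Sq f ->
  forall e d : R, 0 < e -> 0 < d ->
     UU Z [set N | norm0 Y (~` sigma_tube (X := X) e) N (f N) < d].
Proof.
move=> [s0 s0s] fgood e d e0 d0.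
have [_ [_ [Scov [_ [_ Srect]]]]] := HSq.
have e2 : 0 < e / 2 by rewrite divr_gt0.
have [n hn] := mesh_small Z e2.
pose Wn := [set A | Sq n A /\ exists a s, [/\ closure A a, sigma X s & absr (a - s) < e / 2]].
have diam A x y : Sq n A -> closure A x -> closure A y -> absr (x - y) < e / 2.
  move=> SA cx cy; apply: le_lt_trans (hn n (leqnn n)); move: cx cy; apply: closure_diam.
  move=> a b; have [r0 [r1 [r2 [r3 [_ -> /andP[_ h1] /andP[_ h2]]]]]] := Srect n A SA.
  move=> [_ /andP[? ?] /andP[? ?]] [_ /andP[? ?] /andP[? ?]].
  apply: le_trans (absr_ReIm _) _; rewrite ReB ImB.
  have -> : 4 * (bM Z)%:R / n.+1%:R = 2 * (bM Z)%:R / n.+1%:R + 2 * (bM Z)%:R / n.+1%:R :> R by ring.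
  move: (2 * (bM Z)%:R / n.+1%:R) h1 h2 => t h1 h2.
  by apply: lerD; rewrite ler_norml; apply/andP; split; lra.
have out x : sqS Z x -> (~` sigma_tube (X := X) e) x -> outer_region Sq n Wn x.
  move=> Sx nx; have [A SA cA] : (\bigcup_(A in Sq n) closure A) x by rewrite Scov.
  exists A => //; split=> // -[_ [a [s [ca ss as_]]]]; apply: nx; exists s => //.
  have := diam A x a SA cA ca; have := absr_dist x a s; lra.
have Wgood : good_subset (X := X) Sq n Wn.
  split; first by move=> A [].
  have [[x ox]|no] := pselect (exists x, outer_region Sq n Wn x); last first.
    by left; apply/seteqP; split=> // x ox; apply: no; exists x.
  right; apply: (@lt_le_trans _ _ (e / 2)) => //; apply: lb_le_inf.
    by exists (absr (x - s0)); exists x, s0.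
  move=> _ [a [s [[A [SA nA] ca] ss ->]]]; rewrite leNgt; apply/negP => as_.
  by apply: nA; split=> //; exists a, s.
have := fgood n Wn Wgood => /cvgrPdist_lt/(_ d d0); apply: filterS => N /=.
rewrite sub0r normrN ger0_norm ?norm0_ge0//; apply: le_lt_trans.
by apply: le_norm0 => k; apply: out; exact: eigval_sqS.
Qed.

End zero_good.

(** * Averages of the kernel *)

Section average.
Context d (T : measurableType d) {R : realType} (mu : {measure set T -> \bar R}).
Variables (D : set T) (mD : measurable D).

(** Integrals of nonnegative functions are suprema over the simple functions below
    the integrand. *)
Lemma ge0_le_integral_all (f g : T -> \bar R) :
  (forall x, D x -> (0 <= f x)%E) -> (forall x, D x -> (f x <= g x)%E) ->
  (\int[mu]_(x in D) f x <= \int[mu]_(x in D) g x)%E.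
Proof.
move=> f0 fg; have g0 x : D x -> (0 <= g x)%E by move=> Dx; exact: le_trans (f0 x Dx) (fg x Dx).
rewrite !ge0_integralE//.
apply: ge_ereal_sup => _ [h hf <-]; apply: ereal_sup_ubound; exists h => // x.
apply: le_trans (hf x) _; rewrite /patch; case: ifPn => // /set_mem; exact: fg.
Qed.

Variables (C : set T) (mC : measurable C) (CD : C `<=` D) (m : R).
Hypotheses (m_gt0 : 0 < m) (muC : mu C = m%:E).

Lemma integral_plateau (t : R) : 0 <= t ->
  (\int[mu]_(x in D) ((t / m) * \1_C x)%:E = t%:E)%E.
Proof.
move=> t0; under eq_integral do rewrite EFinM.
rewrite ge0_integralZl_EFin//.
- by rewrite integral_indic// setIidl// muC -EFinM divfK// gt_eqF.
- by apply/measurable_EFinP; exact: measurable_indic.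
- by rewrite divr_ge0// ltW.
Qed.

(** The positive and negative parts of [f] are squeezed between multiples of the
    indicator of [C], whose integrals are explicit. *)
Lemma Rintegral_average (f : T -> R) (a b : R) :
  (forall x, C x -> a / m <= f x <= b / m) -> (forall x, ~ C x -> f x = 0) ->
  a <= b -> a <= Rintegral mu D f <= b.
Proof.
move=> fC f0 ab; rewrite /Rintegral integralE.
set p := (\int[mu]_(x in D) _^\+ x)%E; set q := (\int[mu]_(x in D) _^\- x)%E.
have max0 (x : R) : 0 <= Num.max x 0 by rewrite le_max lexx orbT.
have pos (t : R) (x : T) : 0 <= Num.max t 0 / m * \1_C x.
  by rewrite mulr_ge0// divr_ge0// ltW.
have pE : p = (\int[mu]_(x in D) (Num.max (f x) 0)%:E)%E.
  by rewrite /p; apply: eq_integral => x _; rewrite funeposE EFin_max.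
have qE : q = (\int[mu]_(x in D) (Num.max (- f x) 0)%:E)%E.
  by rewrite /q; apply: eq_integral => x _; rewrite funenegE EFin_max.
have maxm (x : R) : Num.max x 0 / m = Num.max (x / m) 0.
  by rewrite maxr_pMl ?invr_ge0 ?(ltW m_gt0)// mul0r.
have le_max2 (x y : R) : x <= y -> Num.max x 0 <= Num.max y 0.
  by move=> xy; rewrite ge_max !le_max xy lexx orbT.
have bound (g : T -> R) (u v : R) :
    (forall x, C x -> u / m <= g x <= v / m) -> (forall x, ~ C x -> g x = 0) ->
    ((Num.max u 0)%:E <= \int[mu]_(x in D) (Num.max (g x) 0)%:E <= (Num.max v 0)%:E)%E.
  move=> gC g0; rewrite -(integral_plateau (max0 u)) -(integral_plateau (max0 v)).
  apply/andP; split; apply: ge0_le_integral_all => x Dx; rewrite lee_fin//.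
  - have [Cx|nCx] := pselect (C x).
      rewrite indicE mem_set// mulr1 maxm; apply: le_max2.
      by have /andP[] := gC x Cx.
    by rewrite indicE memNset// mulr0.
  - have [Cx|nCx] := pselect (C x).
      rewrite indicE mem_set// mulr1 maxm; apply: le_max2.
      by have /andP[] := gC x Cx.
    by rewrite g0// maxxx.
have /andP[p1 p2] := bound f a b fC f0.
have /andP[q1 q2] : ((Num.max (- b) 0)%:E <= q <= (Num.max (- a) 0)%:E)%E.
  rewrite qE; apply: bound => x Cx; last by rewrite f0// oppr0.
  by have /andP[? ?] := fC x Cx; rewrite !mulNr !lerN2; apply/andP.
rewrite -pE in p1 p2.
have fin (z : \bar R) (u v : R) : (u%:E <= z)%E -> (z <= v%:E)%E -> z = (fine z)%:E.
  move=> uz zv; rewrite fineK// fin_numE; apply/andP; split.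
    by apply/eqP => e; rewrite e in uz.
  by apply/eqP => e; rewrite e in zv.
have pF := fin _ _ _ p1 p2; have qF := fin _ _ _ q1 q2.
move: p1 p2 q1 q2; rewrite pF qF !lee_fin -EFinB /=.
have aE (x : R) : x = Num.max x 0 - Num.max (- x) 0.
  by rewrite /Num.max; case: (ltrP x 0); case: (ltrP (- x) 0) => *; lra.
have := aE a; have := aE b.
by move=> *; apply/andP; split; lra.
Qed.

End average.

Section kernel_values.
Context {R : realType} {H : completeNormedModType R[i]} {X : cyclic_operator H}.
Context {Y : finite_models X}.
Variables (Z : spectral_setting Y) (r : nat -> nat -> R) (alpha beta : R[i]).
Hypothesis Hr : grid Z r alpha beta.

Local Notation M := (bM Z).
Local Notation size_at n := (2 ^ (n + 2))%N.

Lemma sigma_square x : sigma X x -> square M x.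
Proof. by move=> /sigma_circle/(circle_in_square Z)[/ltW ? /ltW ?]. Qed.

Lemma point_cell n x : sigma X x ->
  (forall i, (i < size_at n + 1)%N -> ~ lineI M (r n i) x /\ ~ lineJ M (r n i) x) ->
  exists i j, [/\ (i < size_at n)%N, (j < size_at n)%N & cell Z r n i j x].
Proof.
move=> sx off; have [hR hI] := circle_in_square Z (sigma_circle sx).
have Sx := sigma_square sx.
have [[i iN]|//] := cell_cover Hr n hR hI.
have [nI nJ] : ~ lineI M (r n i) x /\ ~ lineJ M (r n i) x by apply: off; rewrite addn1 ltnS.
by move=> [e|e]; exfalso; [apply: nI|apply: nJ].
Qed.

Lemma Fseq_coef f N (k : 'I_(dimH Y N)) : coef Y (Fseq Y f N) k = (xi k)%:C%C * f (eigval k).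
Proof. by rewrite /Fseq (coef_sum xpredT). Qed.

Lemma Fseq_spH f N : spH X N (Fseq Y f N).
Proof. by apply: span_sum => k _; apply: spanZ; exact: eigvec_spH. Qed.

Lemma ucell_off_tube p i j : 0 < fmu Z (cell Z r p i j) ->
  muN Y N (cell Z r p i j) @[N --> UU Z] --> fmu Z (cell Z r p i j) ->
  forall e d : R, 0 < e -> 0 < d ->
     UU Z [set N | norm0 Y (~` sigma_tube (X := X) e) N (ucell Z r p i j N) < d].
Proof.
set m := fmu Z _ => m0 hm e d e0 d0.
have m2 : 0 < m / 2 by rewrite divr_gt0.
have dm : 0 < d * (m / 2) by rewrite mulr_gt0.
move/cvgrPdist_lt : hm => /(_ _ m2).
apply: filterS2 (vanishing_off_tube Z e0 dm) => N /= h1 h2.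
have mN : m / 2 < muN Y N (cell Z r p i j).
  by have := le_lt_trans (ler_norm _) h2; lra.
rewrite norm0_ucell ltr_pdivrMr; last exact: lt_trans mN.
apply: le_lt_trans (lt_trans h1 _); first by apply: le_muN => l [].
by rewrite ltr_pM2l.
Qed.

Lemma norm0_ucell_le1 p i j N : norm0 Y setT N (ucell Z r p i j N) <= 1.
Proof.
rewrite norm0_ucell setTI; have [->|h] := eqVneq (muN Y N (cell Z r p i j)) 0.
  by rewrite mul0r ler01.
by rewrite divff.
Qed.

Variable K : R[i] -> R[i] -> R[i].

(** Real and imaginary parts are averaged separately, whence the factor [2]. *)
Lemma BD_average p i j (y k : R[i]) (e : R) : (i < size_at p)%N -> (j < size_at p)%N ->
  0 < fmu Z (cell Z r p i j) -> 0 < e ->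
  (forall x, cell Z r p i j x -> absr (K x y - k) < e) ->
  absr (BD Z K (chi' Z r p i j) y - k) <= 2 * e.
Proof.
set C := cell Z r p i j; set m := fmu Z C => iN jN m0 e0 hK.
have mS : measurable (sqS Z : set (caratheodory_type (mu_outer Z))) by exact: sqS_measurable.
have mC : measurable (C : set (caratheodory_type (mu_outer Z))) by exact: (cell_measurable Hr).
have CS : C `<=` sqS Z by move=> l [].
have muC : mu Z C = m%:E by exact: mu_fmu.
have chiE x : chi' Z r p i j x = (\1_C x / m)%:C%C by [].
have ReM (z : R[i]) (t : R) : complex.Re (z * t%:C%C) = complex.Re z * t.
  by case: z => a b /=; rewrite mulr0 subr0.
have ImM (z : R[i]) (t : R) : complex.Im (z * t%:C%C) = complex.Im z * t.
  by case: z => a b /=; rewrite mulr0 add0r.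
have avg (q : R[i] -> R) (g : R[i] -> R) : (forall x, C x -> `|g x - q k| <= e) ->
    `|Rintegral (mu Z) (sqS Z) (fun x => g x * (\1_C x / m)) - q k| <= e.
  move=> hg; have h1 x : C x -> (q k - e) / m <= g x * (\1_C x / m) <= (q k + e) / m.
    move=> Cx; rewrite indicE mem_set// mul1r.
    by have := hg x Cx; rewrite ler_norml => /andP[? ?]; apply/andP; split;
       rewrite ler_pM2r ?invr_gt0//; lra.
  have h2 x : ~ C x -> g x * (\1_C x / m) = 0.
    by move=> nC; rewrite indicE memNset// mul0r mulr0.
  have h3 : q k - e <= q k + e by lra.
  have := @Rintegral_average _ _ _ (mu Z) _ mS _ mC CS m m0 muC _ _ _ h1 h2 h3.
  by move=> /andP[? ?]; rewrite ler_norml; apply/andP; split; lra.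
rewrite mulr_natl mulr2n; apply: le_trans (absr_ReIm _) _; rewrite ReB ImB; apply: lerD.
  rewrite /BD /cintegral /=.
  under eq_Rintegral do rewrite chiE ReM.
  by apply: avg => x Cx; rewrite -ReB (le_trans (absr_Re _))// ltW// hK.
rewrite /BD /cintegral /=.
under eq_Rintegral do rewrite chiE ImM.
by apply: avg => x Cx; rewrite -ImB (le_trans (absr_Im _))// ltW// hK.
Qed.

Variable BN : nat -> H -> H.
Hypotheses (HBN : forall N, linear_from_to (spH X N) (spH X N) (BN N))
  (H1 : C1' Z BN) (H2 : C2' Z r K BN).

Lemma BN_spH N v : spH X N v -> spH X N (BN N v).
Proof. exact: linear_from_to_in (HBN N). Qed.

Lemma BN_sub N u v : spH X N u -> spH X N v -> BN N (u - v) = BN N u - BN N v.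
Proof.
move=> uN vN; rewrite addrC -scaleN1r (linear_from_to_comb _ (HBN N))//.
by rewrite scaleN1r addrC.
Qed.

Lemma Hu_applyu v : Hu Z v -> Hu Z (applyu BN v).
Proof. by apply: filterS => N; exact: BN_spH. Qed.

Lemma C2_sim p i j : (i < size_at p)%N -> (j < size_at p)%N -> 0 < fmu Z (cell Z r p i j) ->
  sim_infty Z (applyu BN (Fseq Y (chi' Z r p i j))) (Fseq Y (BD Z K (chi' Z r p i j))).
Proof.
move=> iN jN m0; have e := H2 iN jN (n := p).
have FH f : Hu Z (Fseq Y f) by apply: filterE => N; exact: Fseq_spH.
have : Binfty Z BN (class_infty Z (Fseq Y (chi' Z r p i j))) (applyu BN (Fseq Y (chi' Z r p i j))).
  split; first exact: Hu_applyu.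
  exists (Fseq Y (chi' Z r p i j)); last exact: sim_infty_refl.
  by split => //; exact: sim_infty_refl.
by rewrite e ?mu_fmu ?lte_fin// => -[].
Qed.

(** The weights [xi ^ 2 / muN] of the cell add up to one. *)
Lemma ip_ucell_Fseq p i j N (g : R[i] -> R[i]) (k : R[i]) (c : R) : 0 <= c ->
  0 < muN Y N (cell Z r p i j) ->
  (forall y, cell Z r p i j y -> absr (g y - k) <= c) ->
  absr (ip X (ucell Z r p i j N) (Fseq Y g N) - k) <= c.
Proof.
set C := cell Z r p i j; set u := ucell Z r p i j N; set m := muN Y N C => c0 m0 hg.
have uN : spH X N u by exact: ucell_spH.
have kE : ip X u (Fseq Y (fun=> k) N) = k.
  rewrite (parseval Y _ uN) -[RHS]mul1r -(@divff _ m%:C%C); last first.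
    by rewrite eq_complex /= eqxx andbT gt_eqF.
  rewrite [X in X / _ * _]rmorph_sum /= -mulrA mulr_suml [RHS]big_mkcond /=.
  apply: eq_bigr => l _; rewrite ucell_coef Fseq_coef -/C -/m; case: ifP => _; last first.
    by rewrite conjC_conjc conjc_real mul0r.
  rewrite conjC_conjc conjc_real rmorphM fmorphV rmorphXn /=; ring.
rewrite -{1}kE -ipBr.
have := @ip_split_bound _ _ X Y C N u (Fseq Y g N - Fseq Y (fun=> k) N) c
  (norm_infty Y setT N (Fseq Y g N - Fseq Y (fun=> k) N)) uN.
move=> /(_ _ _)/le_trans; apply.
- move=> l /set_mem lC; rewrite coefB !Fseq_coef -mulrBr absrM absrC ger0_norm ?xi_ge0//.
  by rewrite mulrC ler_wpM2r ?xi_ge0// hg.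
- by move=> l; apply: norm_infty_coef; rewrite in_setT.
rewrite [X in _ * X + _](_ : _ = 1); last first.
  by rewrite norm0_ucell setIid divff// gt_eqF.
rewrite [X in _ + _ * X](_ : _ = 0); last first.
  by rewrite norm0_ucell setICl /muN big_pred0 ?mul0r// => l; rewrite in_set0.
by rewrite mulr1 mulr0 addr0.
Qed.

End kernel_values.

Section level_pairing.
Context {R : realType} {H : completeNormedModType R[i]} {X : cyclic_operator H}.
Context {Y : finite_models X}.
Variables (Z : spectral_setting Y) (r : nat -> nat -> R) (alpha beta : R[i]).
Hypothesis Hr : grid Z r alpha beta.

Local Notation M := (bM Z).
Local Notation size_at n := (2 ^ (n + 2))%N.

Variables (K : R[i] -> R[i] -> R[i]) (BN : nat -> H -> H).
Hypotheses (HBN : forall N, linear_from_to (spH X N) (spH X N) (BN N))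
  (H1 : C1' Z BN) (H2 : C2' Z r K BN).

Lemma ucell_Fseq_close p i j N (k : 'I_(dimH Y N)) :
  absr (coef Y (ucell Z r p i j N - Fseq Y (chi' Z r p i j) N) k) <=
  `|(muN Y N (cell Z r p i j))^-1 - (fmu Z (cell Z r p i j))^-1| * xi k.
Proof.
rewrite coefB ucell_coef Fseq_coef -rmorphM -rmorphB absrC indicE.
rewrite -[fine (mu Z _)]/(fmu Z (cell Z r p i j)).
case: (_ \in _) => /=; last by rewrite mul0r mulr0 subrr normr0 mulr_ge0 ?xi_ge0.
by rewrite mul1r -mulrBr normrM mulrC (ger0_norm (xi_ge0 k)).
Qed.

(** The pairing splits into the error made on the cell vector, controlled by [C1'], the
    error of [C2'], which is infinitesimal near the spectrum, and an average of the
    kernel over both cells. *)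
Lemma level_pairing p ia ja ib jb (k : R[i]) (e : R) :
  (ia < size_at p)%N -> (ja < size_at p)%N -> 
  0 < fmu Z (cell Z r p ia ja) -> 0 < fmu Z (cell Z r p ib jb) ->
  muN Y N (cell Z r p ia ja) @[N --> UU Z] --> fmu Z (cell Z r p ia ja) ->
  muN Y N (cell Z r p ib jb) @[N --> UU Z] --> fmu Z (cell Z r p ib jb) ->
  0 < e ->
  (forall x y, cell Z r p ia ja x -> cell Z r p ib jb y -> absr (K x y - k) < e) ->
  absr (st_ip Z (ucell Z r p ib jb) (applyu BN (ucell Z r p ia ja)) - k) <= 2 * e.
Proof.
move=> iaN jaN ma0 mb0 cva cvb e0 hK.
set ca := cell Z r p ia ja in ma0 cva hK *; set cb := cell Z r p ib jb in mb0 cvb hK *.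
set ua := ucell Z r p ia ja; set ub := ucell Z r p ib jb.
pose x N := ip X (ub N) (BN N (ua N)).
(* The pairings are bounded, so their ultralimit exists and inherits the bound. *)
suff claim d : 0 < d -> UU Z [set N | absr (x N - k) <= 2 * e + d].
  have [l hl] : exists l : R[i], x @ UU Z --> l.
    apply: (@ultra_cvg_complex _ _ _ _ _ (absr k + (2 * e + 1))).
    apply: filterS (claim 1 ltr01) => N /= hN.
    have -> : x N = k + (x N - k) by rewrite addrC subrK.
    by apply: le_trans (absrD _ _) _; rewrite lerD2l.
  have -> : st_ip Z ub (applyu BN ua) = l by apply: cvg_lim => //; exact: norm_hausdorff.
  apply: (@le_eps _ _ _ 2) => d d0.
  have [N [/= h1 h2]] := filter_ex (filterI (claim d d0) ((cvg_absr _ _ _).1 hl d d0)).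
  by have := absr_dist l (x N) k; lra.
move=> d0; have [[KD hKD] _] := H1; have d2 : 0 < d / 2 by rewrite divr_gt0.
have KD1 : 0 < KD%:R + 1 :> R by rewrite ltr_wpDl.
have inv_cvg : (muN Y N ca)^-1 @[N --> UU Z] --> (fmu Z ca)^-1.
  by apply: cvgV => //; rewrite gt_eqF.
have dK : 0 < d / 2 / (KD%:R + 1) by rewrite divr_gt0.
have t1 := (@cvgrPdist_lt _ _ _ _ _ _ _).1 inv_cvg _ dK.
have sim := C2_sim HBN H2 iaN jaN ma0.
have ubH : UU Z [set N | spH X N (ub N)] by apply: filterE => N; exact: ucell_spH.
have ub1 : UU Z [set N | norm0 Y setT N (ub N) <= 1] by apply: filterE => N; exact: norm0_ucell_le1.
have t2 := pairing_infinitesimal ubH ub1 (ucell_off_tube mb0 cvb) sim d2.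
have t3 := (@cvgrPdist_lt _ _ _ _ _ _ _).1 cvb _ mb0.
near=> N.
have T1 : `|(fmu Z ca)^-1 - (muN Y N ca)^-1| < d / 2 / (KD%:R + 1) by near: N; exact: t1.
have T2 : absr (ip X (ub N) (subu (applyu BN (Fseq Y (chi' Z r p ia ja)))
   (Fseq Y (BD Z K (chi' Z r p ia ja))) N)) < d / 2 by near: N; exact: t2.
have T3 : `|fmu Z cb - muN Y N cb| < fmu Z cb by near: N; exact: t3.
have mbN : 0 < muN Y N cb.
  by have := le_lt_trans (ler_norm _) T3; rewrite ltrBlDr ltrDl.
have uaN : spH X N (ua N) by exact: ucell_spH.
have FaN : spH X N (Fseq Y (chi' Z r p ia ja) N) by exact: Fseq_spH.
pose c := `|(muN Y N ca)^-1 - (fmu Z ca)^-1|; have c0 : 0 <= c by exact: normr_ge0.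
have vN : spH X N (ua N - Fseq Y (chi' Z r p ia ja) N) by exact: spanB.
have E1 : absr (ip X (ub N) (BN N (ua N - Fseq Y (chi' Z r p ia ja) N))) <= d / 2.
  apply: le_trans (@ip_bound _ _ X Y N (ub N) _ (KD%:R * c) _ _) _.
  - exact: ucell_spH.
  - move=> l; have lS : eigval l \in sqS Z by apply: mem_set; exact: eigval_sqS.
    apply: le_trans (norm_infty_coef _ lS) _; rewrite ler_wpM2r ?xi_ge0//.
    apply: le_trans (hKD N _ vN) _; rewrite ler_wpM2l//.
    by apply: norm_infty_le => // l' _; exact: ucell_Fseq_close.
  apply: (@le_trans _ _ (KD%:R * c)).
    by rewrite -[leRHS]mulr1 ler_wpM2l ?mulr_ge0//; exact: norm0_ucell_le1.
  rewrite /c distrC; apply: (@le_trans _ _ ((KD%:R + 1) * (d / 2 / (KD%:R + 1)))).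
    by apply: ler_pM => //; [rewrite lerDl|exact: ltW].
  by rewrite mulrC divfK// gt_eqF.
have E3 : absr (ip X (ub N) (Fseq Y (BD Z K (chi' Z r p ia ja)) N) - k) <= 2 * e.
  apply: ip_ucell_Fseq => //; first by rewrite mulr_ge0// ltW.
  move=> y yb; apply: (BD_average Hr) => //.
  by move=> z za; exact: hK.
rewrite /=; have -> : x N - k = ip X (ub N) (BN N (ua N - Fseq Y (chi' Z r p ia ja) N)) +
   ip X (ub N) (subu (applyu BN (Fseq Y (chi' Z r p ia ja)))
     (Fseq Y (BD Z K (chi' Z r p ia ja))) N) +
   (ip X (ub N) (Fseq Y (BD Z K (chi' Z r p ia ja)) N) - k).
  by rewrite (BN_sub HBN)// /subu /applyu !ipBr /x; ring.
have := absrD (ip X (ub N) (BN N (ua N - Fseq Y (chi' Z r p ia ja) N)) +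
   ip X (ub N) (subu (applyu BN (Fseq Y (chi' Z r p ia ja)))
     (Fseq Y (BD Z K (chi' Z r p ia ja))) N))
   (ip X (ub N) (Fseq Y (BD Z K (chi' Z r p ia ja)) N) - k).
have := absrD (ip X (ub N) (BN N (ua N - Fseq Y (chi' Z r p ia ja) N)))
   (ip X (ub N) (subu (applyu BN (Fseq Y (chi' Z r p ia ja)))
     (Fseq Y (BD Z K (chi' Z r p ia ja))) N)).
by move: T2 E1 E3; lra.
Unshelve. all: by end_near. Qed.

Lemma kernel_near (e : R) : {within sqS Z `*` sqS Z, continuous (fun p : R[i] * R[i] => K p.1 p.2)} ->
  sigma X alpha -> sigma X beta -> 0 < e -> exists p0, forall p i j a b,
  [/\ (p0 <= p)%N, (i < size_at p)%N, (j < size_at p)%N, (a < size_at p)%N & (b < size_at p)%N] ->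
  cell Z r p i j alpha -> cell Z r p a b beta ->
  forall x y, cell Z r p i j x -> cell Z r p a b y -> absr (K x y - K alpha beta) < e.
Proof.
move=> /subspace_continuousP Kc sa sb e0.
have Sab : (sqS Z `*` sqS Z) (alpha, beta) by split; apply: sigma_square.
have := Kc _ Sab => /(cvg_absr _ _ _).1/(_ e e0).
rewrite /= near_withinE => -[[A B] /= [nA nB] AB].
move: nA nB => /nbhs_ballP[a' /= /complex_gt0[-> a0] hA] /nbhs_ballP[b' /= /complex_gt0[-> b0] hB].
have ab0 : 0 < Num.min (complex.Re a') (complex.Re b') by rewrite lt_min a0.
have [p0 hp0] := mesh_small Z ab0; exists p0 => p i j a b [pp iN jN aN bN] ca cb x y cx cy.
rewrite absrB; apply: (AB (x, y)); last by split; [case: cx|case: cy].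
have := hp0 p pp; rewrite lt_min => /andP[h1 h2].
split => /=; [apply: hA|apply: hB]; rewrite -ball_normE /= -absrE ltcR.
- exact: lt_trans (cell_diam Hr iN jN ca cx) h1.
- exact: lt_trans (cell_diam Hr aN bN cb cy) h2.
Qed.

End level_pairing.

(** * The vectors of the Dirac deltas and the kernel value *)

Section delta_vectors.
Context {R : realType} {H : completeNormedModType R[i]} {X : cyclic_operator H}.
Context {Y : finite_models X}.
Variables (Z : spectral_setting Y) (r : nat -> nat -> R) (alpha beta : R[i]).
Hypothesis Hr : grid Z r alpha beta.
Variables (nn : nat -> nat) (ee : nat -> R).

Local Notation M := (bM Z).
Local Notation size_at n := (2 ^ (n + 2))%N.

Variables (x : R[i]) (W : set nat).
Hypotheses (sx : sigma X x)
  (off : forall n i, (i < size_at n + 1)%N -> ~ lineI M (r n i) x /\ ~ lineJ M (r n i) x)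
  (Hgood : good_pair Z r (dirac_delta x) nn ee W).

Definition delta_cell N i j :=
  [/\ (i < size_at (nn N))%N /\ (j < size_at (nn N))%N, cell Z r (nn N) i j x,
      0 < muN Y N (cell Z r (nn N) i j),
      utheta Z r (dirac_delta x) nn N = ucell Z r (nn N) i j N &
      upoint Z r x (nn N) = ucell Z r (nn N) i j].

(** The cell of [x] has positive measure because [x] is in the spectrum, and then
    positive mass because the tolerance of a good pair is positive. *)
Lemma utheta_cell m :
  UU Z [set N | [/\ W N, (m <= nn N)%N, (0 < nn N)%N & exists i j, delta_cell N i j]].
Proof.
apply: filterS (good_large Hgood m) => N [WN mN N0]; split=> //.
have [i [j [iN jN xc]]] := point_cell Hr sx (off (n := nn N)).
have m0 : 0 < fmu Z (cell Z r (nn N) i j) by exact: (sigma_cell_gt0 Hr Hgood iN jN sx xc).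
have mN0 := good_cell_gt0 Hgood WN N0 iN jN m0.
exists i, j; split=> //; last by apply/funext => N'; exact: (upointE Hr).
by apply: (uthetaE Hr) => //; exact: sigma_square.
Qed.

Lemma utheta_Hu : Hu Z (utheta Z r (dirac_delta x) nn).
Proof.
apply: filterS (utheta_cell 0) => N [_ _ _ [i [j [_ _ _ uE _]]]] /=.
by rewrite uE; exact: ucell_spH.
Qed.

(** Once the mesh is below the distance from the spectrum to the outer region of a good
    family, the cell of [x] does not meet that region. *)
Lemma utheta_Hm0 (Sq : nat -> set (set R[i])) : Hm0 Z Sq (utheta Z r (dirac_delta x) nn).
Proof.
split; first exact: utheta_Hu.
  move=> n Wn [_ good]; apply/cvgrPdist_lt => d d0.
  case: good => [->|dist0].
    apply: filterE => N /=.
    by rewrite sub0r normrN /norm0 big_pred0 ?normr0// => k; rewrite in_set0.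
  have [n0 hn0] := mesh_small Z dist0.
  apply: filterS (utheta_cell n0) => N [_ nN _ [i [j [[iN jN] xc _ uE _]]]] /=.
  rewrite sub0r normrN uE norm0_ucell.
  rewrite (_ : _ `&` _ = set0).
    by rewrite /muN big_pred0 ?mul0r ?normr0// => k; rewrite in_set0.
  apply/seteqP; split=> // l [lo lc].
  have := cell_diam Hr iN jN lc xc; move/lt_trans => /(_ _ (hn0 _ nN)).
  rewrite ltNge => /negP; apply; apply: ge_inf; last by exists l, x.
  by exists 0 => _ [? [? [_ _ ->]]]; exact: absr_ge0.
exists 1%N; apply: filterS (utheta_cell 0) => N [_ _ _ [i [j [_ _ _ uE _]]]] /=.
by rewrite uE; exact: norm0_ucell_le1.
Qed.

End delta_vectors.

Unset Implicit Arguments.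

Theorem proposition5p4
  (R : realType) (H : completeNormedModType R[i])
  (X : cyclic_operator H) (Y : finite_models X) (Z : spectral_setting Y)
  (Sq : nat -> set (set R[i])) (HSq : refinement Z Sq)
  (G : (R[i] -> R[i]) -> H) (HG : spectral_iso Z G)
  (B : {linear H -> H}) (HB : continuous B)
  (K : R[i] -> R[i] -> R[i]) (HK : continuous_kernel Z G B K)
  (alpha beta : R[i]) (Halpha : sigma X alpha) (Hbeta : sigma X beta)
  (r : nat -> nat -> R) (Hr : grid Z r alpha beta)
  (BN : nat -> H -> H)
  (HBN : forall N, linear_from_to (spH X N) (spH X N) (BN N))
  (H1 : C1' Z BN) (H2 : C2' Z r K BN) (H3 : C3' Z r BN)
  (nn : nat -> nat) (ee : nat -> R) (Ualpha Ubeta : set nat)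
  (Hgood_alpha : good_pair Z r (dirac_delta alpha) nn ee Ualpha)
  (Hgood_beta : good_pair Z r (dirac_delta beta) nn ee Ubeta)
  (Hclose : forall N, Ualpha N -> Ubeta N -> (0 < nn N)%N ->
     absr (ip X (upoint Z r beta (nn N) N) (BN N (upoint Z r alpha (nn N) N))
           - st_ip Z (upoint Z r beta (nn N))
                     (applyu BN (upoint Z r alpha (nn N))))
       < (nn N)%:R^-1) :
  pairs_to Z (class0 Z Sq (utheta Z r (dirac_delta beta) nn))
    (Binfty Z BN (class_infty Z (utheta Z r (dirac_delta alpha) nn)))
    (K alpha beta).
Proof.
have [_ [_ [_ [_ [_ [off _]]]]]] := Hr; have [Kc _] := HK; have [_ C1b] := H1.
have offa n i : (i < 2 ^ (n + 2) + 1)%N -> ~ lineI (bM Z) (r n i) alpha /\ ~ lineJ (bM Z) (r n i) alpha.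
  by move=> /(off n)[].
have offb n i : (i < 2 ^ (n + 2) + 1)%N -> ~ lineI (bM Z) (r n i) beta /\ ~ lineJ (bM Z) (r n i) beta.
  by move=> /(off n)[].
set ua := utheta Z r (dirac_delta alpha) nn; set ub := utheta Z r (dirac_delta beta) nn.
have uaH : Hu Z ua := utheta_Hu Hr Halpha offa Hgood_alpha.
have ubH : Hm0 Z Sq ub := utheta_Hm0 Hr Hbeta offb Hgood_beta Sq.
split.
- exists ub; split=> //; apply/cvgrPdist_lt => d d0; apply: filterE => N /=.
  rewrite /subu subrr /norm0 big1 ?subrr ?normr0// => k _.
  by rewrite coef0 absr0 mulr0.
- exists (applyu BN ua); split; first exact: Hu_applyu.
  by exists ua; [split => //; exact: sim_infty_refl|exact: sim_infty_refl].
move=> f g [[fH f0 [C fC]] fub] [gH [v [vH vua] gv]].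
have tube := zero_good_off_tube HSq (ex_intro _ alpha Halpha) f0.
have t1 := pairing_infinitesimal fH fC tube gv.
have t2 := pairing_infinitesimal fH fC tube (C1b _ _ vH uaH vua).
have [p hp] := H3.
apply/cvg_absr => e e0; pose e' := e / 8; have e'0 : 0 < e' by rewrite divr_gt0.
have [p0 hp0] := kernel_near Hr Kc Halpha Hbeta e'0.
have [q hq] : exists q : nat, forall n, (q < n)%N -> (n%:R^-1 : R) < e'.
  exists (Num.truncn e'^-1) => n qn.
  rewrite -[ltRHS]invrK ltf_pV2 ?posrE ?invr_gt0 ?ltr0n ?(leq_ltn_trans _ qn)//.
  by apply: lt_le_trans (truncnS_gt _) _; rewrite ler_nat.
have p1 : (0 : R) < p%:R + 1 by rewrite ltr_wpDl.
have ep : 0 < e' / (p%:R + 1) by rewrite divr_gt0.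
have t3 := (@cvgrPdist_lt _ _ _ _ _ _ _).1 fub _ ep.
near=> N.
have Ha : [/\ Ualpha N, (maxn p0 q.+1 <= nn N)%N, (0 < nn N)%N & exists i j, delta_cell Z r nn alpha N i j].
  by near: N; exact: (utheta_cell Hr Halpha offa Hgood_alpha).
have Hb : [/\ Ubeta N, (maxn p0 q.+1 <= nn N)%N, (0 < nn N)%N & exists i j, delta_cell Z r nn beta N i j].
  by near: N; exact: (utheta_cell Hr Hbeta offb Hgood_beta).
have T1 : absr (ip X (f N) (subu g (applyu BN v) N)) < e' by near: N; exact: t1.
have T2 : absr (ip X (f N) (subu (applyu BN v) (applyu BN ua) N)) < e' by near: N; exact: t2.
have T3 : `|0 - norm0 Y setT N (subu f ub N)| < e' / (p%:R + 1) by near: N; exact: t3.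
have fN : spH X N (f N) by near: N; exact: fH.
move: Ha Hb => [Wa la N0 [ia [ja [[iaN jaN] ca ma uaE paE]]]].
move=> [Wb _ _ [ib [jb [[ibN jbN] cb mb ubE pbE]]]].
set P := nn N in la N0 iaN jaN ca ma uaE paE ibN jbN cb mb ubE pbE.
have gHN : spH X N (g N) by near: N; exact: gH.
have vHN : spH X N (v N) by near: N; exact: vH.
have uaHN : spH X N (ua N) by near: N; exact: uaH.
have ubHN : spH X N (ub N) by near: N; case: ubH.
have T3' : absr (ip X (f N - ub N) (BN N (ua N))) < e'.
  apply: le_lt_trans (@ip_bound _ _ X Y N _ _ p%:R _ _) _; first exact: spanB.
    move=> k; have kS : eigval k \in sqS Z by apply: mem_set; exact: eigval_sqS.
    apply: le_trans (norm_infty_coef _ kS) _; rewrite ler_wpM2r ?xi_ge0//.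
    by rewrite /ua uaE ltW//; exact: hp.
  rewrite -/(subu f ub N).
  move: T3; rewrite sub0r normrN ger0_norm ?norm0_ge0// ltr_pdivlMr// => T3.
  apply: le_lt_trans T3; rewrite mulrC; apply: ler_wpM2l; first exact: norm0_ge0.
  by rewrite lerDl.
have T4 : absr (ip X (ub N) (BN N (ua N)) -
    st_ip Z (ucell Z r P ib jb) (applyu BN (ucell Z r P ia ja))) < e'.
  have := Hclose N Wa Wb N0; rewrite -/P paE pbE /ua /ub uaE ubE => /lt_trans; apply; apply: hq.
  by apply: leq_trans la; exact: leq_maxr.
have T5 : absr (st_ip Z (ucell Z r P ib jb) (applyu BN (ucell Z r P ia ja)) - K alpha beta) <= 2 * e'.
  apply: (level_pairing Hr HBN H1 H2) => //.
  - exact: (sigma_cell_gt0 Hr Hgood_alpha iaN jaN Halpha ca).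
  - exact: (sigma_cell_gt0 Hr Hgood_alpha ibN jbN Hbeta cb).
  - exact: (muN_cell_cvg Hr Hgood_alpha iaN jaN).
  - exact: (muN_cell_cvg Hr Hgood_alpha ibN jbN).
  - apply: (hp0 P ia ja ib jb) => //; split=> //.
    by apply: leq_trans la; exact: leq_maxl.
rewrite /= absrB.
(* In turn: the freedom in [g], in the preimage [v] and in [f], the transfer to a
   standard level, and the pairing at that level. *)
have -> : ip X (f N) (g N) - K alpha beta =
    ip X (f N) (subu g (applyu BN v) N) + ip X (f N) (subu (applyu BN v) (applyu BN ua) N) +
    ip X (f N - ub N) (BN N (ua N)) +
    (ip X (ub N) (BN N (ua N)) - st_ip Z (ucell Z r P ib jb) (applyu BN (ucell Z r P ia ja))) +
    (st_ip Z (ucell Z r P ib jb) (applyu BN (ucell Z r P ia ja)) - K alpha beta).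
  by rewrite /subu /applyu !ipBr ipBl; ring.
move: (ip X (f N) (subu g (applyu BN v) N)) (ip X (f N) (subu (applyu BN v) (applyu BN ua) N))
  (ip X (f N - ub N) (BN N (ua N))) T1 T2 T3' => z1 z2 z3 T1 T2 T3'.
set z4 := (ip X (ub N) _ - _) in T4 *; set z5 := (st_ip _ _ _ - _) in T5 *.
have := absrD (z1 + z2 + z3 + z4) z5; have := absrD (z1 + z2 + z3) z4.
have := absrD (z1 + z2) z3; have := absrD z1 z2.
have e'E : e = 8 * e' by rewrite /e'; field.
rewrite e'E; lra.
Unshelve. all: by end_near. Qed.
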